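(* Let $k,d\in\mathbb{N}$ with $0<k<d$. Then \[ \limsup_{\substack{\mathcal{H}\in B(k,d)\\ \mathcal{H}\to\infty}}\frac{\log|A(k,d,\mathcal{H})|}{\log\mathcal{H}}=d(\gcd(k,d)-1). \]
   Context: For algebraic $\alpha$ of degree $d$, with $a_0>0$ the leading coefficient of a minimal polynomial of $\alpha$ in $\mathbb{Z}[t]$ and conjugates $\alpha_1,\dots,\alpha_d$, $H(\alpha)=\big(a_0\prod_i\max\{1,|\alpha_i|\}\big)^{1/d}$ (absolute multiplicative Weil height). $A(k,d,\mathcal{H})=\{\alpha\in\mathbb{C}: [\mathbb{Q}(\alpha):\mathbb{Q}]=d,\ H(\alpha)=\mathcal{H},$ precisely $k$ conjugates of $\alpha$ in the open unit disk$\}$; $A(k,d)=\bigcup_{\mathcal{H}\ge1}A(k,d,\mathcal{H})$; $B(k,d)=\{H(\alpha):\alpha\in A(k,d)\}$. *)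

(* Defs.v *)
From HB Require Import structures.
From mathcomp Require Import all_boot all_order all_algebra.
From mathcomp Require Import all_classical all_reals.
From mathcomp Require Import ereal exp.
From mathcomp Require Import complex finmap.
Set Implicit Arguments. Unset Strict Implicit. Unset Printing Implicit Defensive.
Import Order.TTheory GRing.Theory Num.Theory.
Local Open Scope ring_scope.
Local Open Scope classical_set_scope.

Section Height.
Variable R : realType.
Local Notation C := R[i].

Definition polyZC (p : {poly int}) : {poly C} := map_poly (fun z : int => z%:~R) p.

Definition minpolyZ (alpha : C) (p : {poly int}) : Prop :=
  [/\ p != 0, root (polyZC p) alpha,
      (forall q : {poly int}, q != 0 -> root (polyZC q) alpha -> (size p <= size q)%N),
      zcontents p = 1 & 0 < lead_coef p].

(* A(k,d,H): algebraic alpha of degree d (= deg of its minimal polynomial),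
   whose conjugates rs (all roots of the minimal polynomial in C, listed with
   multiplicity) have exactly k elements in the open unit disk, and with
   absolute Weil height H = (a0 * prod max(1,|alpha_i|))^(1/d). *)
Definition A_set (k d : nat) (H : R) : set C :=
  [set alpha | exists (p : {poly int}) (rs : seq C),
     [/\ minpolyZ alpha p,
         polyZC p = (lead_coef p)%:~R *: \prod_(r <- rs) ('X - r%:P),
         size rs = d,
         count (fun r => Normc.normc r < 1) rs = k &
         H = ((lead_coef p)%:~R * \prod_(r <- rs) Num.max 1 (Normc.normc r)) `^ (d%:R)^-1]].

Definition B_set (k d : nat) : set R := [set H | A_set k d H !=set0].

(* number of elements of a (finite) set; fset_set of an infinite set is empty *)
Definition ncard (S : set C) : nat := (#|` fset_set S|)%fset.

Definition limsup_along (B : set R) (f : R -> R) : \bar R :=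
  ereal_inf [set ereal_sup [set (f h)%:E | h in B `&` [set h | T < h]] | T in [set: R]].

End Height.

(* Main.v *)
Require Import Defs.
From HB Require Import structures.
From mathcomp Require Import all_boot all_order all_fingroup all_algebra all_field.
From mathcomp Require Import all_classical all_reals.
From mathcomp Require Import ereal sequences exp.
From mathcomp Require Import complex finmap.
From mathcomp Require Import zify ring lra.
Set Implicit Arguments. Unset Strict Implicit. Unset Printing Implicit Defensive.
Import Order.TTheory GRing.Theory Num.Theory.
Local Open Scope ring_scope.

(* Upper bound. Let f = a prod (X - r) be the minimal polynomial of x, with k roots in the open
   disc, and let M be its Mahler measure; up to sign, M is a times the product of the roots outside
   the disc. Call two roots equivalent when the same automorphisms send them into the disc. An
   automorphism fixing all the conjugates of M respects this relation, so f = a prod c_v where each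
   c_v, the product of X - r over a class, has coefficients in the Galois closure K of Q(M), and the
   degree b of c_v divides k and d. Since a and f(0) divide the norm of M from K, the divisor bound
   leaves M^o(1) possibilities for a, f(0), the contents of the c_v, the ideals of the c_v(0) and the
   dyadic sizes of the c_v(0); valuation rings of the algebraic numbers replace ideals. The norm of
   the difference of two values of one coefficient of c_v is then bounded below, and packing the
   vectors of conjugates gives O(1) values for c_v(0) and O(M) for each of the
   b - 1 <= gcd(k, d) - 1 other coefficients.

   Lower bound. Put g = gcd(k, d), n = d / g. Let th run through the roots of a trinomial of degree n
   which is Eisenstein at 3, k / g of them being tiny and the others huge. For an integer t and
   integer polynomials e_i with coefficients small against t, the product over th of
   t X^g + th (t + 1 + sum_(0 < i < g) e_i(th) X^i) has degree d, its roots have valuation 1 / d at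
   3, and its Mahler measure depends on t only and is of order t^n; there are about t^(n (g - 1))
   choices of the e_i. *)

(** Counting integer polynomials of Mahler measure M directly loses too much; the gain comes from
    factoring over the varying field K, where a single block determines x up to d choices. With its
    ideal and dyadic sizes known, the constant coefficient divides the difference of any two
    candidates, and the product of its conjugates is fixed, so packing leaves O(1) values. The other
    coefficients are only bounded by multiples of max(1, |c_v(0)|), and these maxima times a
    multiply to M: hence one factor M each. No ideal class theory enters. The product over the
    blocks of a difference is rational, so its integrality can be tested with one valuation ring
    above each prime, and ideals matter only through valuations there. Since the degree of K is
    bounded in terms of d, these valuations have denominators dividing a fixed D!; the D!-th power
    of an ideal is thus recorded by a natural number dividing a power of a or of a f(0), and this is
    where the divisor bound acts. In the lower family, t and t + 1 are coprime and, for t = 1 mod 3,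
    units at 3, so that the product is primitive and Eisenstein-like. The factor d in the limit
    reflects M = H^d. *)

Notation autC := {rmorphism algC -> algC}.

(** If [x1] had another conjugate [y], the embedding sending [x1] to [y] would extend to the
    splitting field [Qr] and then to an automorphism of [algC] moving [x]. In characteristic 0 a
    single conjugate means degree 1. *)
Lemma aut_fixed_rat (x : algC) : (forall s : autC, s x = x) -> x \in Crat.
Proof.
move=> fx.
have [p [Dp mon_p] dvp] := minCpolyP x.
have [r Dr] := closed_field_poly_normal (map_poly ratr p : {poly algC}).
rewrite lead_coef_map (monicP mon_p) rmorph1 scale1r in Dr.
have rx : x \in r by rewrite -root_prod_XsubC -Dr dvp dvdpp.
have [Qr [QrC [rr Drr genQr]]] := num_field_exists r.
have [x1 x1rr Dx] : exists2 x1, x1 \in rr & QrC x1 = x.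
  by move: rx; rewrite -Drr => /mapP[y yr ->]; exists y.
pose pr := map_poly (in_alg Qr) p.
have mapQ (q : {poly rat}) : map_poly QrC (map_poly (in_alg Qr) q) = map_poly ratr q.
  by rewrite -map_poly_comp; apply: eq_map_poly => a /=; rewrite rmorphZ_num rmorph1 mulr1.
have prE : pr = \prod_(y <- rr) ('X - y%:P).
  apply: (map_poly_inj QrC); rewrite mapQ Dr -Drr big_map rmorph_prod /=.
  by apply: eq_bigr => zz _; rewrite map_polyXsubC.
have Qpr: pr \is a polyOver 1%VS.
  by apply/polyOverP=> i; rewrite coef_map memvZ ?memv_line.
have splitQr: splittingFieldFor 1 pr {:Qr}%VS by exists rr => //; rewrite prE eqpxx.
have char0 : [pchar Qr] =i pred0 by move=> q; rewrite pchar_lalg pchar_num.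
have x11 : x1 \in 1%VS; last first.
  have [a Da] := vlineP _ _ x11.
  by apply/CratP; exists a; rewrite -Dx Da rmorphZ_num rmorph1 mulr1.
have sep := pcharf0_separable 1 char0 x1.
rewrite -adjoin_deg_eq1 -eqSS -size_minPoly.
have dvdm : minPoly 1 x1 %| pr by rewrite minPoly_dvdp // prE root_prod_XsubC.
rewrite prE in dvdm.
have [msk Em] := dvdp_prod_XsubC dvdm.
set t := mask _ _ in Em.
have {}Em : minPoly 1 x1 = \prod_(z <- t) ('X - z%:P).
  by apply/eqP; rewrite -eqp_monic ?monic_minPoly ?monic_prod_XsubC.
have ut : uniq t by rewrite -separable_prod_XsubC -Em; exact: sep.
rewrite Em size_prod_XsubC. rewrite eqSS; change (size t == size [:: x1]).
rewrite -uniq_size_uniq // => y; rewrite inE -root_prod_XsubC -Em.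
apply/eqP/idP => [->|ry]; first exact: root_minPoly.
have hom1 : kHom 1 1 (\1%VF : 'End(Qr)) by rewrite kHom1.
have ry' : root (map_poly \1%VF (minPoly 1 x1)) y.
  by rewrite (kHom_poly_id hom1) // minPolyOver.
have homx := kHomExtendP (sub1v _) hom1 ry'.
have splitQr' : splittingFieldFor <<1%AS; x1>> pr {:Qr}%VS.
  by apply: splittingFieldForS (subv_adjoin _ _) (subvf _) splitQr.
have [g gh Dg] := kHom_extends (sub1v _) homx Qpr splitQr'.
pose gM := GRing.isMonoidMorphism.Build _ _ g (kHom_monoid_morphism gh).
pose gR : {rmorphism _ -> _} := HB.pack (fun_of_lfun g) gM.
have [nu Dnu] := extend_algC_subfield_aut QrC gR.
apply: (fmorph_inj QrC); rewrite Dx -(fx nu) -{1}Dx -Dnu /= -Dg ?memv_adjoin //.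
by rewrite (kHomExtend_val hom1).
Qed.

Local Open Scope classical_set_scope.

(** * Valuation rings of the algebraic numbers *)

Definition is_subring (A : set algC) : Prop :=
  [/\ A 1, forall x y, A x -> A y -> A (x - y) & forall x y, A x -> A y -> A (x * y)].

(** For [p] prime, excluding [p^-1] puts [p] in the maximal ideal, so that the valuation extends the
    p-adic one. *)
Definition valuation_ring (p : nat) (A : set algC) : Prop :=
  [/\ is_subring A, ~ A p%:R^-1 & forall x, A x \/ A x^-1].

Section Subring.
Variables (A : set algC) (hA : is_subring A).

Lemma subring1 : A 1. Proof. by case: hA. Qed.
Lemma subringB x y : A x -> A y -> A (x - y). Proof. by case: hA => _ + _; apply. Qed.
Lemma subringM x y : A x -> A y -> A (x * y). Proof. by case: hA => _ _; apply. Qed.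
Lemma subring0 : A 0. Proof. by rewrite -(subrr 1); apply: subringB; exact: subring1. Qed.
Lemma subringN x : A x -> A (- x).
Proof. by move=> Ax; rewrite -sub0r; apply: subringB => //; exact: subring0. Qed.
Lemma subringD x y : A x -> A y -> A (x + y).
Proof. by move=> Ax Ay; rewrite -[y]opprK; apply/subringB/subringN. Qed.
Lemma subring_sum I (r : seq I) (P : pred I) F :
  (forall i, P i -> A (F i)) -> A (\sum_(i <- r | P i) F i).
Proof. by move=> h; apply: big_ind => //; [exact: subring0 | exact: subringD]. Qed.
Lemma subring_prod I (r : seq I) (P : pred I) F :
  (forall i, P i -> A (F i)) -> A (\prod_(i <- r | P i) F i).
Proof. by move=> h; apply: big_ind => //; [exact: subring1 | exact: subringM]. Qed.
Lemma subringX x n : A x -> A (x ^+ n).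
Proof. by move=> Ax; elim: n => [|n IH]; [exact: subring1 | rewrite exprS; exact: subringM]. Qed.
Lemma subring_nat n : A n%:R.
Proof. by elim: n => [|n IH]; [exact: subring0 | rewrite -natr1; apply: subringD => //; exact: subring1]. Qed.
Lemma subring_int (z : int) : A z%:~R.
Proof. by case: z => n; rewrite ?NegzE ?rmorphN; [|apply: subringN]; exact: subring_nat. Qed.

Definition adjoin (x : algC) : set algC :=
  [set z | exists2 q : {poly algC}, forall i, A q`_i & z = q.[x]].

Lemma adjoin_subring x : is_subring (adjoin x).
Proof.
split.
- exists 1; last by rewrite hornerC.
  by move=> i; rewrite coef1; exact: subring_nat.
- move=> _ _ [q Aq ->] [r Ar ->]; exists (q - r); last by rewrite !hornerE.
  by move=> i; rewrite coefB; apply: subringB.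
- move=> _ _ [q Aq ->] [r Ar ->]; exists (q * r); last by rewrite !hornerE.
  by move=> i; rewrite coefM; apply: subring_sum => j _; apply: subringM.
Qed.

Lemma sub_adjoin x : A `<=` adjoin x.
Proof.
move=> z Az; exists z%:P; last by rewrite hornerC.
by move=> i; rewrite coefC; case: eqP => // _; exact: subring0.
Qed.

Lemma mem_adjoin x : adjoin x x.
Proof. by exists 'X; [move=> i; rewrite coefX; exact: subring_nat | rewrite hornerX]. Qed.
End Subring.

(** * A maximal subring avoiding 1/p is a valuation ring *)

Section Maximal.
Variables (p : nat) (A : set algC) (hA : is_subring A) (p1 : (1 < p)%N).
Hypothesis nAp : ~ A p%:R^-1.
Hypothesis maxA : forall B, is_subring B -> A `<=` B -> ~ B p%:R^-1 -> B `<=` A.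

Let p0 : p%:R != 0 :> algC. Proof. by rewrite pnatr_eq0; case: p p1. Qed.

Let pA (z : algC) := A (z / p%:R).

(** By maximality [A[x]] contains [1/p]; multiplying that expression by [p] puts its coefficients in
    [pA]. *)
Let badP x : ~ A x -> exists n (a : nat -> algC),
  (forall i, pA (a i)) /\ 1 = \sum_(i < n.+1) a i * x ^+ i.
Proof.
move=> nAx.
have : adjoin A x p%:R^-1.
  apply: contrapT => h; apply: nAx.
  by apply: (maxA (adjoin_subring hA x) _ h); [exact: sub_adjoin | exact: mem_adjoin].
case=> q Aq Eq; exists (size q), (fun i => p%:R * q`_i); split.
  by move=> i; rewrite /pA mulrC mulKf.
rewrite -[LHS](mulfV p0) Eq (horner_coef_wide _ (leqnSn _)) mulr_sumr.
by apply: eq_bigr => i _; rewrite mulrA.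
Qed.

(** An expression of [1/p] as a polynomial in [w = (1 - z)^-1] would, once multiplied by a power of
    [1 - z], put some [(1 - z)^n / p] in [A]; as [(1 - z)^n] is 1 modulo [pA], this would put [1/p]
    in [A]. So adjoining [w] does not enlarge [A]. *)
Let unit_one_sub z : pA z -> A (1 - z)^-1.
Proof.
move=> Az; have Az' : A z by rewrite -(divfK p0 z); apply: subringM => //; exact: subring_nat.
pose w := (1 - z)^-1.
have [z1|z1] := eqVneq (1 - z) 0; first by rewrite z1 invr0; exact: subring0.
apply: (maxA (adjoin_subring hA w) (sub_adjoin hA w) _ (mem_adjoin hA w)).
case=> q Aq Eq; apply: nAp.
have key n : A (1 / p%:R - (1 - z) ^+ n / p%:R).
  elim: n => [|n IH]; first by rewrite subrr; exact: subring0.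
  have -> : 1 / p%:R - (1 - z) ^+ n.+1 / p%:R =
    1 / p%:R - (1 - z) ^+ n / p%:R + (z / p%:R) * (1 - z) ^+ n by rewrite exprS; ring.
  apply: subringD => //; apply: subringM => //; apply: subringX => //.
  by apply: subringB => //; exact: subring1.
rewrite -[_^-1]mul1r -[X in A X](subrK ((1 - z) ^+ size q / p%:R)).
apply: subringD => //; rewrite Eq (horner_coef_wide _ (leqnn _)) mulr_sumr.
apply: subring_sum => // i _; rewrite mulrCA; apply: subringM => //.
rewrite -[X in (1 - z) ^+ X](subnK (ltnW (ltn_ord i))) exprD -mulrA -exprMn divff // expr1n mulr1.
by apply: subringX => //; apply: subringB => //; exact: subring1.
Qed.

(** The exchange argument of Chevalley's extension theorem: the shorter relation, divided by the
    unit [1 - b 0], rewrites the top power in the longer one, so [n + m] decreases until a constant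
    relation puts 1 in [pA]. *)
Let no_bad N : forall x y n m (a b : nat -> algC), x * y = 1 -> (n + m <= N)%N ->
  (forall i, pA (a i)) -> (forall i, pA (b i)) ->
  1 = \sum_(i < n.+1) a i * x ^+ i -> 1 = \sum_(i < m.+1) b i * y ^+ i -> False.
Proof.
elim: N => [|N IH] x y n m a b xy nmN pa pb Ea Eb.
  move: nmN Ea; rewrite leqn0 addn_eq0 => /andP[/eqP-> _].
  rewrite big_ord1 expr0 mulr1 => a1; apply: nAp.
  by have := pa 0%N; rewrite -a1 /pA mul1r.
wlog le_mn : x y n m a b xy nmN pa pb Ea Eb / (m <= n)%N.
  move=> H; case: (leqP m n) => [|/ltnW] h; first exact: (H x y n m a b).
  by apply: (H y x m n b a) => //; [rewrite mulrC | rewrite addnC].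
case: n => [|n] in nmN Ea le_mn *.
  move: le_mn Eb; rewrite leqn0 => /eqP ->.
  rewrite big_ord1 expr0 mulr1 => b1; apply: nAp.
  by have := pb 0%N; rewrite -b1 /pA mul1r.
pose u := (1 - b 0%N)^-1.
have b1 : 1 - b 0%N != 0.
  by apply: contra_notN nAp; rewrite subr_eq0 => /eqP b1; have := pb 0%N; rewrite -b1 /pA mul1r.
have Au : A u by exact: unit_one_sub.
have Aa i : A (a i) by rewrite -(divfK p0 (a i)); apply: subringM (subring_nat _ _) => //; exact: pa.
(* The relation for y expresses the top power of x through lower ones. *)
have Exn : x ^+ n.+1 = \sum_(i < n.+1) (if (n.+1 - i <= m)%N then u * b (n.+1 - i)%N else 0) * x ^+ i.
  have : 1 - b 0%N = \sum_(j < m) b j.+1 * y ^+ j.+1.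
    by rewrite {1}Eb big_ord_recl expr0 mulr1 addrC addKr.
  move=> /(congr1 (fun z => u * z)); rewrite mulVf // => E1.
  rewrite -[LHS]mul1r E1 -mulrA mulr_suml mulr_sumr.
  transitivity (\sum_(i < n.+1) if (i < m)%N then u * b i.+1 * x ^+ (n.+1 - i.+1) else 0); last first.
    rewrite [RHS](reindex_inj rev_ord_inj) /=; apply: eq_bigr => i _.
    have -> : (n.+1 - (n.+1 - i.+1))%N = i.+1 by rewrite subKn.
    by case: ifP => _; rewrite ?mul0r.
  rewrite -big_mkcond /= (big_ord_narrow le_mn) /=; apply: eq_bigr => i _.
  rewrite -!mulrA; congr (_ * (_ * _)).
  have im : (i.+1 <= n.+1)%N by apply: leq_trans le_mn.
  by rewrite -{1}(subnK im) exprD mulrCA -exprMn [y * x]mulrC xy expr1n mulr1.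
pose a' i := a i + a n.+1 * (if (n.+1 - i <= m)%N then u * b (n.+1 - i)%N else 0).
apply: (IH x y n m a' b) => //.
  move=> i; rewrite /pA /a' mulrDl; apply: subringD => //; first exact: pa.
  case: ifP => _; last by rewrite mulr0 mul0r; exact: subring0.
  by rewrite -!mulrA; apply: subringM => //; apply: subringM => //; exact: pb.
rewrite Ea big_ord_recr /= Exn mulr_sumr -big_split /=.
by apply: eq_bigr => i _; rewrite /a' mulrDl mulrA.
Qed.

Lemma maximal_valuation : valuation_ring p A.
Proof.
split=> // x; have [->|x0] := eqVneq x 0; first by left; exact: subring0.
apply: contrapT => /not_orP[/badP[n [a [pa Ea]]] /badP[m [b [pb Eb]]]].
by apply: (no_bad (divff x0) (leqnn _) pa pb Ea Eb).
Qed.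
End Maximal.

Lemma valuation_ring_exists (p : nat) : (1 < p)%N -> exists A, valuation_ring p A.
Proof.
move=> p1.
pose P := [set A : set algC | A = set0 \/ (is_subring A /\ ~ A p%:R^-1)].
have [|A [PA maxA]] := @Zorn_bigcup _ P.
  move=> F FP totF.
  have [[X FX X0]|noX] := pselect (exists2 X, F X & X !=set0); last first.
    left; rewrite -subset0 => z [X FX Xz]; apply: noX; exists X => //; by exists z.
  have FP' Y z : F Y -> Y z -> is_subring Y /\ ~ Y p%:R^-1.
    by move=> /FP[->//|].
  have dir Y Z : F Y -> F Z -> exists2 W, F W & Y `<=` W /\ Z `<=` W.
    by move=> FY FZ; case: (totF _ _ FY FZ) => h; [exists Z | exists Y] => //; split => //; exact: subset_refl.
  right; split; last by case=> Y FY Yp; case: (FP' _ _ FY Yp).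
  split.
  - by case: X0 => z Xz; exists X => //; case: (FP' _ _ FX Xz) => -[].
  - move=> x y [Y FY Yx] [Z FZ Zy]; have [W FW [/(_ _ Yx) Wx /(_ _ Zy) Wy]] := dir _ _ FY FZ.
    by exists W => //; case: (FP' _ _ FW Wx) => h _; exact: (subringB h Wx Wy).
  - move=> x y [Y FY Yx] [Z FZ Zy]; have [W FW [/(_ _ Yx) Wx /(_ _ Zy) Wy]] := dir _ _ FY FZ.
    by exists W => //; case: (FP' _ _ FW Wx) => h _; exact: (subringM h Wx Wy).
have Pint : P [set z : algC | z \is a Num.int].
  right; split; first by split=> [|x y|x y] /=; [exact: rpred1|exact: rpredB|exact: rpredM].
  move=> /= h; have := h; rewrite intrE => /orP[] hn.
    have /natrP[n En] := hn.
    have : p%:R * n%:R = 1 :> algC by rewrite -En divff // pnatr_eq0 -lt0n ltnW.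
    by move/eqP; rewrite -natrM pnatr_eq1 muln_eq1 => /andP[/eqP p1' _]; rewrite p1' in p1.
  have /natrP[n En] := hn.
  have : 0 <= - (p%:R^-1) :> algC by rewrite En ler0n.
  by rewrite oppr_ge0 invr_le0 lern0 => /eqP p0; rewrite p0 in p1.
exists A; case: PA => [A0|[hA nAp]].
  exfalso; apply: (maxA _ _ Pint); rewrite A0; split; first exact: sub0set.
  by move=> /(_ 1 (rpred1 _)).
apply: maximal_valuation => // B hB AB nBp; apply: contrapT => nBA.
by apply: (maxA B); [split | right].
Qed.
Local Close Scope classical_set_scope.

(** * Associates, contents and Gauss's lemma *)

Local Open Scope classical_set_scope.

Definition associate (A : set algC) (x y : algC) : Prop :=
  [/\ x != 0, y != 0, A (x / y) & A (y / x)].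

(* [c] generates the fractional ideal of [A] spanned by the coefficients of [P]. *)
Definition is_content (A : set algC) (P : {poly algC}) (c : algC) : Prop :=
  [/\ c != 0, forall i, A (P`_i / c) & exists2 i, P`_i != 0 & A (c / P`_i)].

(** The maximal ideal of [A]. Zero is listed apart because [0^-1 = 0] lies in [A]. *)
Definition nonunit (A : set algC) (x : algC) : Prop := x = 0 \/ ~ A x^-1.

Section Valuation.
Variables (p : nat) (A : set algC) (vA : valuation_ring p A).

Let hA : is_subring A. Proof. by case: vA. Qed.
Let A1 := subring1 hA.
Let AB x y := @subringB _ hA x y.
Let AM x y := @subringM _ hA x y.
Let totA x : A x \/ A x^-1. Proof. by case: vA. Qed.

Lemma valuation_total x y : x != 0 -> y != 0 -> A (x / y) \/ A (y / x).
Proof. by move=> x0 y0; have [|] := totA (x / y); [left|right; rewrite -invf_div]. Qed.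

Let div_trans x y z : y != 0 -> A (x / y) -> A (y / z) -> A (x / z).
Proof.
  move=> y0 xy yz; have -> : x / z = (x / y) * (y / z) by rewrite mulrA divfK.
  by apply: AM. Qed.

Lemma associate_refl x : x != 0 -> associate A x x.
Proof. by move=> x0; split; rewrite ?divff. Qed.
Lemma associate_sym x y : associate A x y -> associate A y x.
Proof. by case. Qed.
Lemma associate_trans x y z : associate A x y -> associate A y z -> associate A x z.
Proof.
case=> x0 y0 xy yx [_ z0 yz zy]; split=> //.
  by apply: (div_trans y0).
by apply: (div_trans y0).
Qed.
Lemma associateM x y z t : associate A x y -> associate A z t -> associate A (x * z) (y * t).
Proof.
by case=> x0 y0 xy yx [z0 t0 zt tz]; split; rewrite ?mulf_neq0 // -mulf_div; apply: AM.
Qed.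
Lemma associateV x y : associate A x y -> associate A x^-1 y^-1.
Proof. by case=> x0 y0 xy yx; split; rewrite ?invr_eq0 // invrK mulrC. Qed.
Lemma associateX x y n : associate A x y -> associate A (x ^+ n) (y ^+ n).
Proof.
move=> xy; elim: n => [|n IH]; first by apply: associate_refl; rewrite oner_eq0.
by rewrite !exprS; apply: associateM.
Qed.
Lemma associate_mem x y : associate A x y -> A x -> A y.
Proof. by case=> x0 _ _ h Ax; rewrite -(divfK x0 y); apply: AM. Qed.

Lemma memX_inv x n : (0 < n)%N -> A (x ^+ n) -> A x.
Proof.
case: n => // n _ Axn; have [->|x0] := eqVneq x 0; first exact: subring0.
case: (totA x) => // Axi; have -> : x = x ^+ n.+1 * x^-1 ^+ n; last by apply: AM => //; apply: subringX.
by rewrite exprS exprVn mulfK ?expf_neq0.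
Qed.

Lemma associateX_inv x y n : (0 < n)%N -> x != 0 -> y != 0 ->
  associate A (x ^+ n) (y ^+ n) -> associate A x y.
Proof.
move=> n0 x0 y0 [_ _ h1 h2]; split=> //; apply: (memX_inv n0); by rewrite expr_div_n.
Qed.

Lemma nonunitN x : ~ (nonunit A x) -> x != 0 /\ A x^-1.
Proof.
by move=> /not_orP[/eqP x0 /contrapT].
Qed.
Lemma nonunit_mem x : nonunit A x -> A x.
Proof. by case=> [->|h]; [exact: subring0 | case: (totA x)]. Qed.
Lemma nonunitM x y : nonunit A x -> A y -> nonunit A (x * y).
Proof.
case=> [->|h] Ay; first by left; rewrite mul0r.
have [->|y0] := eqVneq y 0; first by left; rewrite mulr0.
right=> h'; apply: h; have -> : x^-1 = y * (x * y)^-1 by rewrite invfM mulrCA divff // mulr1.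
exact: AM.
Qed.
Lemma nonunitN1 x : nonunit A x -> nonunit A (- x).
Proof. by move=> h; rewrite -mulrN1; apply: nonunitM => //; apply: subringN. Qed.
Lemma nonunitD x y : nonunit A x -> nonunit A y -> nonunit A (x + y).
Proof.
move=> hx hy; have [->|x0] := eqVneq x 0; first by rewrite add0r.
have [->|y0] := eqVneq y 0; first by rewrite addr0.
wlog Axy : x y hx hy x0 y0 / A (x / y).
  by move=> H; case: (valuation_total x0 y0) => h; [apply: H | rewrite addrC; apply: H].
rewrite -[X in nonunit A X](divfK y0) mulrC; apply: nonunitM => //.
by rewrite mulrDl divff //; apply: subringD.
Qed.
Lemma nonunit_sum I (r : seq I) (P : pred I) F :
  (forall i, P i -> nonunit A (F i)) -> nonunit A (\sum_(i <- r | P i) F i).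
Proof. by move=> h; apply: big_ind => //; [left | exact: nonunitD]. Qed.
Lemma nonunit1 : ~ nonunit A 1.
Proof. by case=> [/eqP|]; rewrite ?oner_eq0 // invr1. Qed.
Lemma unitD_nonunit x y : x != 0 -> A x^-1 -> nonunit A y -> x + y != 0 /\ A (x + y)^-1.
Proof.
move=> x0 Ax hy; apply: nonunitN => h.
have := nonunitD h (nonunitN1 hy); rewrite addrK => -[/eqP|//].
by rewrite (negPf x0).
Qed.

Lemma content_exists P : P != 0 -> exists c, is_content A P c.
Proof.
move=> P0; have [c c0 [[i Ec] hc]] : exists2 c, c != 0 & ((exists i, c = P`_i) /\ forall i, A (P`_i / c)).
  suff [i Pi hi] : exists2 i, P`_i != 0 & forall j, (j < size P)%N -> A (P`_j / P`_i).
    exists P`_i => //; split; first by exists i.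
    move=> j; case: (ltnP j (size P)) => [/hi//|/(nth_default 0)->].
    by rewrite mul0r; exact: subring0.
  suff H n : (exists2 i, P`_i != 0 & forall j, (j < n)%N -> A (P`_j / P`_i)) by exact: H.
  elim: n => [|n [i Pi hi]]; first by exists (size P).-1; rewrite // -lead_coefE lead_coef_eq0.
  have [Pn|Pn] := eqVneq P`_n 0.
    exists i => // j; rewrite ltnS leq_eqVlt => /orP[/eqP->|/hi//].
    by rewrite Pn mul0r; exact: subring0.
  have [h|h] := valuation_total Pn Pi.
    by exists i => // j; rewrite ltnS leq_eqVlt => /orP[/eqP->|/hi].
  exists n => // j; rewrite ltnS leq_eqVlt => /orP[/eqP->|/hi hj]; first by rewrite divff.
  by apply: (div_trans Pi).
by exists c; split=> //; exists i; rewrite -Ec ?divff.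
Qed.

Lemma content_uniq P c c' : is_content A P c -> is_content A P c' -> associate A c c'.
Proof.
case=> c0 hc [i Pi ic] [c'0 hc' [j Pj jc']]; split=> //.
  by apply: (div_trans Pi).
by apply: (div_trans Pj).
Qed.

Lemma content_assoc P c c' : is_content A P c -> associate A c c' -> is_content A P c'.
Proof.
case=> c0 hc [i Pi ic] [_ c'0 cc' c'c]; split=> //.
  by move=> j; apply: (div_trans c0).
by exists i => //; apply: (div_trans c0).
Qed.

(* Gauss's lemma, through the least indices at which the two contents are attained. *)
Lemma content_mul P Q c c' :
  is_content A P c -> is_content A Q c' -> is_content A (P * Q) (c * c').
Proof.
move=> [c0 hc exP] [c'0 hc' exQ].
have least (R : {poly algC}) b : b != 0 -> (exists2 i, R`_i != 0 & A (b / R`_i)) ->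
    exists2 i, R`_i != 0 /\ A (b / R`_i) & forall j, (j < i)%N -> nonunit A (R`_j / b).
  move=> b0 [i Ri hi]; pose a i := `[< R`_i != 0 /\ A (b / R`_i) >].
  have exa : exists i, a i by exists i; apply/asboolP.
  case: (ex_minnP exa) => m /asboolP am minm; exists m => // j jm.
  apply: contrapT => /nonunitN[]; rewrite mulf_eq0 negb_or invr_eq0 => /andP[Rj _].
  rewrite invf_div => h; move: jm; rewrite ltnNge => /negP; apply; apply: minm.
  by apply/asboolP.
have [i [Pi hi] li] := least P c c0 exP.
have [j [Qj hj] lj] := least Q c' c'0 exQ.
split; first by rewrite mulf_neq0.
  move=> k; rewrite coefM mulr_suml; apply: subring_sum => // l _.
  by rewrite -mulf_div; apply: AM.
(* In the coefficient of index [i + j], every other term has a factor below its least index, hence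
   becomes a nonunit after division by [c * c']. *)
have [] := @unitD_nonunit (P`_i * Q`_j / (c * c'))
   (\sum_(l < (i + j).+1 | l != inord i) P`_l * Q`_(i + j - l) / (c * c')).
- by rewrite !mulf_neq0 ?invr_eq0 ?mulf_neq0.
- by rewrite invf_div -mulf_div; apply: AM.
- apply: nonunit_sum => l li'; rewrite -mulf_div.
  have {li'} : (l < i)%N \/ (i < l)%N.
    case: (ltngtP l i) => [||E]; [by left|by right|].
    case/eqP: li'; apply: val_inj; rewrite /= inordK // -?E //.
    by rewrite E ltnS leq_addr.
  case=> h; first by apply: nonunitM => //; exact: li.
  rewrite mulrC; apply: nonunitM => //; apply: lj.
  by rewrite ltn_subLR ?ltn_add2r // -ltnS ltn_ord.
have -> : P`_i * Q`_j / (c * c') + \sum_(l < (i + j).+1 | l != inord i) P`_l * Q`_(i + j - l) / (c * c')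
   = (P * Q)`_(i + j) / (c * c').
  rewrite coefM mulr_suml [RHS](bigD1 (inord i)) //= inordK ?ltnS ?leq_addr //.
  by rewrite addKn.
rewrite mulf_eq0 negb_or invf_div => /andP[h1 _] h2.
by exists (i + j)%N.
Qed.

Lemma content1 : is_content A 1 1.
Proof.
split; rewrite ?oner_eq0 //; first by move=> i; rewrite divr1 coef1; exact: subring_nat.
by exists 0%N; rewrite coef1 ?oner_eq0 // divr1.
Qed.

Lemma contentC a : a != 0 -> is_content A a%:P a.
Proof.
move=> a0; split=> //.
  by move=> i; rewrite coefC; case: eqP => _; rewrite ?mul0r ?divff //; exact: subring0.
by exists 0%N; rewrite coefC //= divff.
Qed.

Lemma content_prod I (r : seq I) (P : pred I) (F : I -> {poly algC}) c :
  (forall i, P i -> is_content A (F i) (c i)) ->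
  is_content A (\prod_(i <- r | P i) F i) (\prod_(i <- r | P i) c i).
Proof.
by move=> h; apply: (big_ind2 (is_content A)) => //; [exact: content1 | move=> *; exact: content_mul].
Qed.

Lemma content_monic P c : P \is monic -> is_content A P c -> A c^-1.
Proof. by move=> /monicP mP [_ + _] => /(_ (size P).-1); rewrite -lead_coefE mP mul1r. Qed.

Hypothesis p_pr : prime p.

Lemma char_nonunit : nonunit A p%:R.
Proof. by right; case: vA. Qed.

Lemma coprime_unit n : coprime p n -> A n%:R^-1.
Proof.
move=> cop; apply: contrapT => h; apply: nonunit1.
have n0 : (0 < n)%N.
  rewrite lt0n; apply: contraTneq cop => ->; rewrite /coprime gcdn0.
  by rewrite gtn_eqF // prime_gt1.
have [u v E _] := egcdnP p n0.
have -> : 1 = u%:R * n%:R - v%:R * p%:R :> algC.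
  by rewrite -!natrM E gcdnC (eqP cop) natrD addrAC subrr add0r.
apply: nonunitD; last apply: nonunitN1; rewrite mulrC; apply: nonunitM;
  by [right | exact: subring_nat | exact: char_nonunit].
Qed.

Lemma associate_nat n : (0 < n)%N -> associate A n%:R (p%:R ^+ logn p n).
Proof.
move=> n0; have [m cop En] := pfactor_coprime p_pr n0.
have p0 : p%:R != 0 :> algC by rewrite pnatr_eq0 -lt0n prime_gt0.
have m0 : m%:R != 0 :> algC.
  by rewrite pnatr_eq0; apply: contraTneq n0 => m0; rewrite En m0.
rewrite {1}En natrM natrX -[X in associate _ _ X]mul1r; apply: associateM.
  split; rewrite ?oner_eq0 //; first by rewrite divr1; exact: subring_nat.
  by rewrite div1r; exact: coprime_unit.
by apply: associate_refl; rewrite expf_neq0.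
Qed.

Lemma associate_int (z : int) : z != 0 -> associate A z%:~R (p%:R ^+ logn p `|z|).
Proof.
move=> z0; apply: associate_trans (associate_nat _); last by rewrite absz_gt0.
have z0' : z%:~R != 0 :> algC by rewrite intr_eq0.
have E : z%:~R = (-1) ^+ (z < 0)%R * (`|z|%N)%:R :> algC.
  by rewrite {1}[z]intEsign rmorphM rmorphXn rmorphN1.
have n0 : (`|z|%N)%:R != 0 :> algC by rewrite pnatr_eq0 absz_eq0.
rewrite E; split=> //; first by rewrite -E.
  by rewrite mulfK //; apply: subringX => //; apply: subringN.
rewrite invfM mulrCA divff // mulr1 invr_sign.
by apply: subringX => //; apply: subringN.
Qed.

Lemma powp_inj m n : associate A (p%:R ^+ m) (p%:R ^+ n) -> m = n.
Proof.
wlog mn : m n / (m <= n)%N.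
  by move=> H; case: (leqP m n) => [/H//|/ltnW/H h /associate_sym/h].
have p0 : p%:R != 0 :> algC by rewrite pnatr_eq0 -lt0n prime_gt0.
case=> _ _ + _; rewrite -(subnK mn) exprD invfM mulrCA divff ?expf_neq0 // mulr1.
case: (n - m)%N => // l; rewrite -exprVn => /memX_inv h; case: vA => _ []; exact: h.
Qed.

Lemma powp_le m n : A (p%:R ^+ n / p%:R ^+ m) -> (m <= n)%N.
Proof.
have p0 : p%:R != 0 :> algC by rewrite pnatr_eq0 -lt0n prime_gt0.
move=> h; case: leqP => // nm; suff : n = m by move=> E; rewrite E ltnn in nm.
apply: powp_inj; split; rewrite ?expf_neq0 // -(subnK (ltnW nm)) exprD mulfK ?expf_neq0 //.
by apply: subringX => //; exact: subring_nat.
Qed.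

(* Two terms of a vanishing sum share the extremal valuation, so [x] has a rational valuation with denominator at most [D]. *)
Lemma algebraic_associate (x : algC) (Q : {poly int}) D : x != 0 -> Q != 0 -> (size Q <= D.+1)%N ->
  root (map_poly (intr : int -> algC) Q) x ->
  exists u w, associate A (x ^+ D`! * p%:R ^+ w) (p%:R ^+ u).
Proof.
move=> x0 Q0 sQ /eqP Qx.
(* The terms of the vanishing sum [Q(x)] become the coefficients of [P], so a content of [P] is a
   term of least valuation. *)
pose P := \poly_(i < size Q) ((Q`_i)%:~R * x ^+ i).
have coP i : P`_i = (Q`_i)%:~R * x ^+ i.
  rewrite coef_poly; case: ltnP => // h; by rewrite [Q`_i]nth_default // mul0r.
have P0 : P != 0.
  apply/eqP => /polyP/(_ (size Q).-1); rewrite coP coef0 => /eqP.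
  by rewrite mulf_eq0 intr_eq0 expf_eq0 (negPf x0) andbF orbF -lead_coefE lead_coef_eq0 (negPf Q0).
have [c [c0 hc [i Pi ci]]] := content_exists P0.
have isz : (i < size Q)%N.
  by rewrite ltnNge; apply: contra Pi => h; rewrite coef_poly ltnNge h.
have sumP : \sum_(j < size Q) P`_j = 0.
  rewrite -[RHS]Qx (@horner_coef_wide _ (size Q)) ?size_poly //.
  by apply: eq_bigr => j _; rewrite coP coef_map.
have [j jsz [ij Pj cj]] : exists2 j, (j < size Q)%N & [/\ j != i, P`_j != 0 & A (c / P`_j)].
  apply: contrapT => nex.
  suff [] : P`_i / c + \sum_(j < size Q | j != Ordinal isz) P`_j / c != 0 /\
     A (P`_i / c + \sum_(j < size Q | j != Ordinal isz) P`_j / c)^-1.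
    rewrite -(bigD1 (Ordinal isz) (P := xpredT) (F := fun j : 'I_(size Q) => P`_j / c)) //=.
    by rewrite -mulr_suml sumP mul0r eqxx.
  apply: unitD_nonunit; rewrite ?invf_div ?mulf_neq0 ?invr_eq0 //.
  apply: nonunit_sum => j ji; apply: contrapT => /nonunitN[].
  rewrite mulf_eq0 negb_or invf_div => /andP[h1 _] h2; apply: nex; exists j => //.
have ass a (Pa : P`_a != 0) (ca : A (c / P`_a)) : associate A c P`_a by split.
have assij : associate A P`_i P`_j.
  by apply: associate_trans (ass _ Pj cj); apply: associate_sym; exact: ass.
wlog lij : i j Pi Pj isz jsz ij ci cj assij / (i < j)%N.
  move=> H; case: (ltngtP i j) ij => // [h|h] _; first by apply: (H i j); rewrite // gtn_eqF.
  by apply: (H j i) => //; [rewrite gtn_eqF | exact: associate_sym].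
have [Qi Qj] : Q`_i != 0 /\ Q`_j != 0.
  by split; [move: Pi | move: Pj]; rewrite coP mulf_eq0 negb_or intr_eq0 => /andP[].
rewrite !coP in assij.
have l0 : (0 < j - i)%N by rewrite subn_gt0.
have lD : (j - i <= D)%N by move: (leq_trans jsz sQ); lia.
(* The two terms give [x^(j - i)] the valuation of a quotient of integers. As [j - i <= D], the
   exponent [D!] serves for all pairs of indices. *)
have [q Eq] : exists q, D`! = ((j - i) * q)%N.
  have /dvdnP[q Eq] : ((j - i) %| D`!)%N by rewrite dvdn_fact // l0 lD.
  by exists q; rewrite mulnC.
exists (logn p `|(Q`_i)%R| * q)%N, (logn p `|(Q`_j)%R| * q)%N.
rewrite Eq !exprM -exprMn; apply: associateX.
apply: associate_trans (associate_int Qi).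
apply: (@associate_trans _ (x ^+ (j - i) * (Q`_j)%:~R)).
  apply: associateM; first by apply: associate_refl; rewrite expf_neq0.
  by apply: associate_sym; exact: associate_int.
apply: associate_sym.
have := associateM assij (associate_refl (invr_neq0 (expf_neq0 i x0))).
have -> : x ^+ j = x ^+ (j - i) * x ^+ i by rewrite -exprD subnK // ltnW.
by rewrite mulfK ?expf_neq0 // mulrA mulfK ?expf_neq0 // mulrC.
Qed.

(** Since [x] and [N / x] both lie in [A], the exponent of [x^D!] is trapped between 0 and that of
    [N^D!]. *)
Lemma integral_associate (x : algC) (Q : {poly int}) D (N : nat) : Q != 0 -> (size Q <= D.+1)%N ->
  root (map_poly (intr : int -> algC) Q) x -> (0 < N)%N -> x != 0 -> A x -> A (N%:R / x) ->
  exists2 e, (e <= logn p (N ^ D`!))%N & associate A (x ^+ D`!) (p%:R ^+ e).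
Proof.
move=> Q0 sQ Qx N0 x0 Ax ANx.
have p0 : p%:R != 0 :> algC by rewrite pnatr_eq0 -lt0n prime_gt0.
have [u [w h]] := algebraic_associate x0 Q0 sQ Qx.
have wu : (w <= u)%N.
  apply: powp_le; case: h => _ _ _ h.
  have -> : p%:R ^+ u / p%:R ^+ w = x ^+ D`! * (p%:R ^+ u / (x ^+ D`! * p%:R ^+ w)).
    by rewrite invfM mulrCA mulVKf ?expf_neq0.
  by apply: AM => //; apply: subringX.
have h' : associate A (x ^+ D`!) (p%:R ^+ (u - w)).
  have := associateM h (associate_refl (invr_neq0 (expf_neq0 w p0))).
  by rewrite mulfK ?expf_neq0 // -{1}(subnK wu) exprD mulfK ?expf_neq0.
exists (u - w)%N => //; apply: powp_le.
have [_ _ _ hN] : associate A (N ^ D`!)%:R (p%:R ^+ logn p (N ^ D`!)).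
  by apply: associate_nat; rewrite expn_gt0 N0.
have [_ _ hx _] := h'.
have -> : p%:R ^+ logn p (N ^ D`!) / p%:R ^+ (u - w) =
  p%:R ^+ logn p (N ^ D`!) / (N ^ D`!)%:R * ((N%:R / x) ^+ D`!) * (x ^+ D`! / p%:R ^+ (u - w)) :> algC.
  rewrite natrX expr_div_n -!mulrA !mulKf ?expf_neq0 //.
  by rewrite pnatr_eq0 -lt0n.
by do 2!apply: AM => //; apply: subringX.
Qed.
End Valuation.

(* A chosen valuation ring of [algC] above [p]; it is [setT] when there is none. *)
Definition vring (p : nat) : set algC :=
  if pselect (exists A, valuation_ring p A) is left h then projT1 (cid h) else setT.

Lemma vringP p : prime p -> valuation_ring p (vring p).
Proof.
move=> p_pr; rewrite /vring; case: pselect => [h|[]]; first exact: projT2 (cid h).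
exact/valuation_ring_exists/prime_gt1.
Qed.

(** One valuation ring above each prime suffices for rationals, where it restricts to the p-adic
    one: a prime dividing the denominator would be inverted. *)
Lemma Crat_vring_int (x : algC) : x \in Crat -> (forall p, prime p -> vring p x) -> x \is a Num.int.
Proof.
move=> /CratP[q ->{x}] h; rewrite Cint_rat.
have d0 := denq_gt0 q.
have [|p_gt1] := leqP `|denq q|%N 1.
  rewrite leq_eqVlt ltnS leqn0 absz_eq0 (negPf (denq_neq0 q)) orbF => /eqP d1.
  by rewrite Qint_def -(gtz0_abs d0) d1.
set p := pdiv `|denq q|; have p_pr : prime p := pdiv_prime p_gt1.
have vp := vringP p_pr; have hA : is_subring (vring p) by case: vp.
have /dvdnP[v Ev] : (p %| `|denq q|)%N := pdiv_dvd _.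
exfalso; case: (vp) => _ np _; apply: np.
have p0 : p%:R != 0 :> algC by rewrite pnatr_eq0 -lt0n prime_gt0.
have Ed : (denq q)%:~R = v%:R * p%:R :> algC.
  by rewrite -natrM -Ev -{1}(gtz0_abs d0).
have d0' : (denq q)%:~R != 0 :> algC by rewrite intr_eq0 denq_neq0.
have Eq : ratr q = (numq q)%:~R / (denq q)%:~R :> algC by rewrite -[in LHS](divq_num_den q) fmorph_div /= !ratr_int.
have num : vring p ((numq q)%:~R / p%:R).
  have -> : (numq q)%:~R / p%:R = v%:R * ratr q :> algC.
    have v0 : v%:R != 0 :> algC by apply: contraNneq d0' => v0; rewrite Ed v0 mul0r.
    by rewrite Eq Ed; field; rewrite v0 p0.
  by apply: subringM => //; [exact: subring_nat | exact: h].
have cop : coprime p `|numq q|%N.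
  rewrite coprime_sym; apply: coprime_dvdr (coprime_num_den q); exact: pdiv_dvd.
have num0 : (numq q)%:~R != 0 :> algC.
  rewrite intr_eq0 -absz_eq0; apply: contraTneq cop => ->; rewrite /coprime gcdn0.
  by apply: contraTneq p_pr => ->.
have inv : vring p (numq q)%:~R^-1.
  have numi : logn p `|numq q| = 0%N by rewrite logn_coprime.
  have [] := associate_int vp p_pr (z := numq q); first by rewrite -(@intr_eq0 algC).
  by rewrite numi expr0 div1r.
by rewrite -[X in vring p X](mulKf num0); apply: subringM.
Qed.

(** Encodes the [D!]-th power of an ideal by one natural number, so that ideals can be counted as
    divisors. The element [x p] varies with [p] because a content is only given by local
    generators. *)
Lemma family_associate (x : nat -> algC) D (N : nat) : (0 < N)%N ->
  (forall p, prime p -> exists Q : {poly int}, [/\ Q != 0, (size Q <= D.+1)%N &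
    root (map_poly (intr : int -> algC) Q) (x p)]) ->
  (forall p, prime p -> [/\ x p != 0, vring p (x p) & vring p (N%:R / x p)]) ->
  exists2 E, (E %| N ^ D`!)%N & forall p, prime p -> associate (vring p) (x p ^+ D`!) E%:R.
Proof.
move=> N0 hQ hx; set M := (N ^ D`!)%N.
have M0 : (0 < M)%N by rewrite expn_gt0 N0.
have ex p : exists e, (e <= logn p M)%N /\ (prime p -> associate (vring p) (x p ^+ D`!) (p%:R ^+ e)).
  case: (boolP (prime p)) => [p_pr|np]; last by exists 0%N.
  have [Q [Q0 sQ Qx]] := hQ p p_pr; have [x0 Ax ANx] := hx p p_pr.
  by have [e eM he] := integral_associate (vringP p_pr) p_pr Q0 sQ Qx N0 x0 Ax ANx; exists e.
have /choice[e he] := ex.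
(* The exponents [e p <= logn p M] vanish when [p] is not prime or exceeds [M], so this finite
   product carries all of them. *)
exists (\prod_(0 <= p < M.+1) p ^ e p)%N.
  rewrite -[X in (_ %| X)%N](partnT M0) /partn.
  rewrite (eq_bigl predT) //; apply: (big_ind2 (fun a b => a %| b)%N) => // [a b c d|p _].
    exact: dvdn_mul.
  by rewrite dvdn_exp2l //; case: (he p).
move=> p p_pr; have vp := vringP p_pr.
have [_ /(_ p_pr) h] := he p; apply: (associate_trans vp h).
apply: associate_sym.
have E0 : (0 < \prod_(0 <= q < M.+1) q ^ e q)%N.
  rewrite big_nat; elim/big_ind: _ => // [a b|q _]; first by rewrite muln_gt0 => -> ->.
  case: q => [|q]; last by rewrite expn_gt0.
  by have [] := he 0%N; rewrite leqn0 => /eqP ->.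
suff <- : logn p (\prod_(0 <= q < M.+1) q ^ e q) = e p by exact: associate_nat.
have el q : q != p -> logn p (q ^ e q) = 0%N.
  move=> qp; have [eq _] := he q; case: (boolP (prime q)) => [q_pr|nq].
    by rewrite lognX logn_prime // eq_sym (negPf qp) muln0.
  by move: eq; rewrite lognE (negPf nq) leqn0 => /eqP ->; rewrite expn0 logn1.
have lognP (r : seq nat) : {in r, forall q, (0 < q ^ e q)%N} ->
   logn p (\prod_(q <- r) q ^ e q) = (\sum_(q <- r) logn p (q ^ e q))%N.
  elim: r => [|q r IH] hr; first by rewrite !big_nil logn1.
  rewrite !big_cons lognM ?IH ?hr ?mem_head //.
    by move=> y yr; apply: hr; rewrite inE yr orbT.
  rewrite big_seq; elim/big_ind: _ => // [a b|y yr]; first by rewrite muln_gt0 => -> ->.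
  by apply: hr; rewrite inE yr orbT.
rewrite lognP; last first.
  move=> q _; case: q => [|q]; last by rewrite expn_gt0.
  by have [] := he 0%N; rewrite leqn0 => /eqP ->.
have [pM|pM] := ltnP p M.+1.
  rewrite big_mkord (bigD1 (Ordinal pM)) //= lognX logn_prime // eqxx muln1.
  rewrite big1 => [|q qp]; first by rewrite addn0.
  apply: el; by apply: contraNneq qp => qp; apply/eqP/val_inj.
rewrite big_mkord big1 => [|q _].
  have pM' : ~~ (p %| M)%N by apply/negP => /(dvdn_leq M0); rewrite leqNgt pM.
  by have [] := he p; rewrite lognE p_pr M0 (negPf pM') leqn0 => /eqP->.
by apply: el; rewrite neq_ltn (leq_trans (ltn_ord q) pM).
Qed.
Local Close Scope classical_set_scope.

(** * Counting *)

(** Quantifying over duplicate-free lists makes finiteness a consequence of the bound, and lets [P]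
    be undecidable. *)
Definition bounded (T : eqType) (P : T -> Prop) (N : nat) : Prop :=
  forall s : seq T, uniq s -> (forall x, x \in s -> P x) -> (size s <= N)%N.

(** The workhorse of the count: fix a datum with [m] possible values, then count in a fibre. A
    relation [R] instead of a function accommodates data that are only known to exist, such as the
    integers recording ideals. *)
Lemma bounded_fiber (T T' : eqType) (P : T -> Prop) (Q : T' -> Prop) (R : T -> T' -> Prop) m n :
  (forall x, P x -> exists2 y, Q y & R x y) -> bounded Q m ->
  (forall y, Q y -> bounded (fun x => P x /\ R x y) n) -> bounded P (m * n).
Proof.
move=> hR hQ hn s us Ps; case: (posnP (size s)) => [->//|].
rewrite -has_predT => /hasP[x0 x0s _].
have [] : exists f : T -> T', (forall x, x \in s -> Q (f x)) /\ (forall x, x \in s -> R x (f x)).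
  have [y0 _ _] := hR x0 (Ps _ x0s).
  have /choice[f hf] : forall x, exists y, P x -> Q y /\ R x y.
    move=> x; have [/hR[y Qy Rxy]|nP] := pselect (P x); first by exists y.
    by exists y0.
  by exists f; split=> x /Ps /hf[].
move=> f [Qf Rf].
have main (l : seq T') : forall t : seq T, uniq t -> {subset t <= s} ->
    (forall x, x \in t -> f x \in l) -> (forall y, y \in l -> Q y) -> (size t <= size l * n)%N.
  elim: l => [|y l IH] t ut ts tl Ql.
    by case: t tl {ut ts} => // x t /(_ x (mem_head _ _)).
  rewrite -(count_predC (fun x => f x == y) t) mulSn -!size_filter leq_add //.
    apply: (hn y (Ql y (mem_head _ _))); first exact: filter_uniq.
    by move=> x; rewrite mem_filter => /andP[/eqP <- /ts xs]; split; [exact: Ps | exact: Rf].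
  apply: IH; first exact: filter_uniq.
  - by move=> x; rewrite mem_filter => /andP[_ /ts].
  - by move=> x; rewrite mem_filter /= => /andP[fx /tl]; rewrite inE (negPf fx).
  - by move=> z zl; apply: Ql; rewrite inE zl orbT.
have Qu y : y \in undup (map f s) -> Q y.
  by rewrite mem_undup => /mapP[x xs ->]; exact: Qf.
apply: leq_trans (main (undup (map f s)) s us _ _ Qu) _ => //.
  by move=> x xs; rewrite mem_undup map_f.
by rewrite leq_mul2r hQ ?orbT // undup_uniq.
Qed.

Lemma bounded_le (T : eqType) (P : T -> Prop) m n : (m <= n)%N -> bounded P m -> bounded P n.
Proof. by move=> mn h s us Ps; apply: leq_trans (h s us Ps) mn. Qed.

Lemma bounded_sub (T : eqType) (P Q : T -> Prop) n :
  (forall x, Q x -> P x) -> bounded P n -> bounded Q n.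
Proof. by move=> QP h s us Qs; apply: h => // x /Qs/QP. Qed.

(** Gives access to one element, whose data set the sizes of a packing box. *)
Lemma bounded_empty (T : eqType) (P : T -> Prop) n :
  ((exists x, P x) -> bounded P n) -> bounded P n.
Proof. by move=> h [|x s] us Ps //; apply: h => //; exists x; apply: Ps; rewrite mem_head. Qed.

Lemma bounded_fin (T : finType) (P : T -> Prop) : bounded P #|T|.
Proof. by move=> s us _; rewrite -(card_uniqP us) max_card. Qed.

Lemma bounded_seq (T : eqType) (P : T -> Prop) (l : seq T) :
  (forall x, P x -> x \in l) -> bounded P (size l).
Proof. by move=> h s us Ps; apply: uniq_leq_size => // x /Ps/h. Qed.

Lemma bounded_ltn n : bounded (fun m : nat => (m < n)%N) n.
Proof. by rewrite -[X in bounded _ X](size_iota 0 n); apply: bounded_seq => m; rewrite mem_iota. Qed.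

Lemma bounded1 (T : eqType) (P : T -> Prop) :
  (forall x y, P x -> P y -> x = y) -> bounded P 1.
Proof.
move=> h [|x [|y s]] //= /andP[xs _] Ps; move: xs; rewrite inE negb_or => /andP[/eqP[]].
by apply: h; apply: Ps; rewrite !inE eqxx ?orbT.
Qed.

Lemma bounded_family (T T' I : eqType) (d : T') (r : seq I) (P : T -> Prop) (Q : I -> T' -> Prop)
    (R : I -> T -> T' -> Prop) m n : uniq r ->
  (forall i x, i \in r -> P x -> exists2 y, Q i y & R i x y) ->
  (forall i, i \in r -> bounded (Q i) m) ->
  (forall f, (forall i, i \in r -> Q i (f i)) -> bounded (fun x => P x /\ forall i, i \in r -> R i x (f i)) n) ->
  bounded P (m ^ size r * n).
Proof.
elim: r P => [|i r IH] P ur hR hQ hn.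
  by rewrite mul1n; apply: bounded_sub (hn (fun=> d) _).
have /andP[ir ur'] := ur; rewrite /= expnS -mulnA.
apply: (bounded_fiber (R := R i) (Q := Q i)).
- by move=> x; apply: hR; rewrite mem_head.
- by apply: hQ; rewrite mem_head.
move=> y Qy; apply: IH => //.
- by move=> j x jr [Px _]; apply: hR => //; rewrite inE jr orbT.
- by move=> j jr; apply: hQ; rewrite inE jr orbT.
move=> f Qf; pose g j := if j == i then y else f j.
have gr j : j \in r -> g j = f j by rewrite /g; case: eqP => // ->; rewrite (negPf ir).
apply: (bounded_sub _ (hn g _)).
  move=> x [[Px Rx] h]; split=> // j; rewrite inE => /orP[/eqP->|jr]; first by rewrite /g eqxx.
  by rewrite gr //; exact: h.
move=> j; rewrite inE => /orP[/eqP->|jr]; first by rewrite /g eqxx.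
by rewrite gr //; exact: Qf.
Qed.

Lemma bounded_ord_family (T T' : eqType) (d : T') n (P : T -> Prop) (Q : 'I_n -> T' -> Prop)
    (R : 'I_n -> T -> T' -> Prop) m B :
  (forall i x, P x -> exists2 y, Q i y & R i x y) ->
  (forall i, bounded (Q i) m) ->
  (forall f, bounded (fun x => P x /\ forall i, R i x (f i)) B) ->
  bounded P (m ^ n * B).
Proof.
move=> hR hQ hB; have <- : size (enum 'I_n) = n by exact: size_enum_ord.
apply: (bounded_family d (enum_uniq _) (fun i x _ => hR i x) (fun i _ => hQ i)) => f _.
by apply: bounded_sub (hB f) => x [Px h]; split=> // i; apply: h; rewrite mem_enum.
Qed.

Lemma leq_pow2r m n e : (m <= n)%N -> (m ^ e <= n ^ e)%N.
Proof. by move=> mn; case: e => // e; rewrite leq_exp2r. Qed.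

Lemma dvdn_bounded n : (0 < n)%N -> bounded (fun d => (d %| n)%N) (size (divisors n)).
Proof. by move=> n0; apply: bounded_seq => d; rewrite dvdn_divisors. Qed.

Lemma bounded_dvdn_mul (p v m B : nat) : prime p -> coprime p m -> (0 < m)%N ->
  bounded (fun d => (d %| m)%N) B -> bounded (fun d => (d %| p ^ v * m)%N) (v.+1 * B).
Proof.
move=> p_pr cop m0 hB.
have n0 : (0 < p ^ v * m)%N by rewrite muln_gt0 m0 expn_gt0 prime_gt0.
apply: (bounded_fiber (Q := fun j => (j < v.+1)%N) (R := fun d j => logn p d = j)).
- move=> d dn; exists (logn p d) => //; rewrite ltnS.
  have := dvdn_leq_log p n0 dn; rewrite lognM // ?expn_gt0 ?prime_gt0 //.
  by rewrite pfactorK // [logn p m]logn_coprime // addn0.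
- exact: bounded_ltn.
move=> j _; rewrite -[B]muln1.
apply: (bounded_fiber (Q := fun d => (d %| m)%N) (R := fun d e => d = (p ^ j * e)%N)) => //.
- move=> d [dn lj]; have d0 : (0 < d)%N by apply: dvdn_gt0 dn.
  have [e cope Ed] := pfactor_coprime p_pr d0; rewrite lj mulnC in Ed.
  exists e => //; have : (e %| p ^ v * m)%N by apply: dvdn_trans dn; rewrite Ed dvdn_mull.
  by rewrite Gauss_dvdr // coprime_sym coprimeXl.
by move=> e _; apply: bounded1 => x y [_ ->] [_ ->].
Qed.

(** For [e > 0], [v + 1 <= e (v %/ e + 1) <= e 2^(v %/ e)]. It absorbs the [v + 1] divisors of the
    power of a small prime. *)
Lemma exp_le_exp2 e v : (v.+1 ^ e <= e ^ e * 2 ^ v)%N.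
Proof.
case: e => [|e]; first by rewrite !expn0 mul1n expn_gt0.
apply: (@leq_trans ((e.+1 * 2 ^ (v %/ e.+1)) ^ e.+1)).
  rewrite leq_exp2r //; apply: (@leq_trans (e.+1 * (v %/ e.+1).+1)).
    by rewrite mulnS {1}(divn_eq v e.+1) -addnS addnC leq_add ?ltn_pmod // mulnC.
  by rewrite leq_mul2l ltn_expl ?orbT.
by rewrite expnMn -expnM leq_mul2l leq_exp2l ?leq_trunc_div ?orbT // mulnC leq_trunc_div orbT.
Qed.

(* [F n = O(n ^ (1 / e))] for every [e]. *)
Definition subpolynomial (F : nat -> nat) : Prop :=
  forall e, exists C, forall n, (0 < n)%N -> (F n ^ e <= C * n)%N.

(** A prime [p >= 2^e] of exponent [v] costs nothing, as [(v + 1)^e <= 2^(e v) <= p^v]; each smaller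
    one costs the constant [c = e^e], and there are fewer than [2^e] of them. The induction runs
    over a bound [P] for the prime divisors, and [minn P (2^e)] counts the small candidates. *)
Lemma divisors_subpolynomial : subpolynomial (fun n => size (divisors n)).
Proof.
move=> e; pose c := (e ^ e)%N; exists (c ^ (2 ^ e))%N.
have c0 : (0 < c)%N by rewrite expn_gt0; case: e {c}.
suff H P : forall n, (0 < n)%N -> (forall p, prime p -> (p %| n)%N -> (p < P)%N) ->
    exists2 B, bounded (fun d => (d %| n)%N) B & (B ^ e <= c ^ minn P (2 ^ e) * n)%N.
  move=> n n0; have [p p_pr pn|B hB hle] := H n.+1 n n0.
    by rewrite ltnS dvdn_leq.
  apply: (@leq_trans (B ^ e)).
    by apply/leq_pow2r/hB; [exact: divisors_uniq | move=> d; rewrite -dvdn_divisors].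
  by apply: leq_trans hle _; rewrite leq_mul2r leq_pexp2l ?geq_minr ?orbT.
elim: P => [|P IH] n n0 hn.
  exists 1%N; last by rewrite exp1n muln_gt0 n0 expn_gt0 c0.
  have -> : n = 1%N.
    case: (ltngtP n 1) n0 => // n1 _; have := hn (pdiv n) (pdiv_prime n1) (pdiv_dvd n).
    by rewrite ltn0.
  by apply: bounded1 => x y; rewrite !dvdn1 => /eqP -> /eqP ->.
case: (boolP (prime P)) => [P_pr|nP]; last first.
  have [|B hB hle] := IH n n0.
    move=> p p_pr pn; have := hn p p_pr pn; rewrite ltnS leq_eqVlt => /orP[/eqP E|//].
    by move: nP; rewrite -E p_pr.
  exists B => //; apply: leq_trans hle _; rewrite leq_mul2r leq_pexp2l ?orbT //.
  by rewrite leq_min geq_minr andbT (leq_trans (geq_minl _ _)).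
have [m cop En] := pfactor_coprime P_pr n0; set v := logn P n in En; rewrite mulnC in En.
have m0 : (0 < m)%N by move: n0; rewrite En muln_gt0 => /andP[].
have [|B hB hle] := IH m m0.
  move=> p p_pr pm; have := hn p p_pr; rewrite En dvdn_mull // => /(_ isT).
  rewrite ltnS leq_eqVlt => /orP[/eqP E|//]; move: cop; rewrite -E prime_coprime //.
  by rewrite pm.
exists (v.+1 * B)%N; first by rewrite En; exact: bounded_dvdn_mul.
rewrite expnMn En.
have [Pe|Pe] := ltnP P (2 ^ e).
  rewrite (minn_idPl Pe); rewrite (minn_idPl (ltnW Pe)) in hle.
  rewrite expnS mulnACA leq_mul //.
  apply: leq_trans (exp_le_exp2 e v) _; rewrite leq_mul2l.
  by case: v En => [|v] _; rewrite ?leqnn ?orbT // leq_exp2r ?prime_gt1 ?orbT.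
rewrite (minn_idPr (leqW Pe)); rewrite (minn_idPr Pe) in hle.
rewrite mulnCA leq_mul //.
apply: (@leq_trans ((2 ^ e) ^ v)).
  by rewrite -expnM mulnC expnM; apply: leq_pow2r; exact: ltn_expl.
exact: leq_pow2r.
Qed.

Definition max_divisors (m N : nat) : nat := (\max_(i < N ^ m) size (divisors i.+1))%N.

Lemma leq_max_divisors m N a : (0 < a)%N -> (a <= N ^ m)%N -> (size (divisors a) <= max_divisors m N)%N.
Proof.
case: a => // a _ aN.
exact: (leq_bigmax (F := fun i : 'I_(N ^ m) => size (divisors i.+1)) (Ordinal aN)).
Qed.

Lemma max_divisors_gt0 m N : (0 < N)%N -> (0 < max_divisors m N)%N.
Proof.
move=> N0; apply: leq_trans (leq_max_divisors (a := 1) _ _) => //.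
by rewrite expn_gt0 N0.
Qed.

Lemma max_divisors_subpolynomial m : subpolynomial (max_divisors m).
Proof.
(* The arguments reach [N^m], so the divisor bound is used with the exponent [e (m + 1)] and an
   [(m + 1)]-th root is taken. *)
move=> e; have [C hC] := divisors_subpolynomial (e * m.+1)%N.
have C0 : (0 < C)%N.
  by have := hC 1%N isT; rewrite muln1; apply: leq_trans; rewrite expn_gt0.
exists C => N N0; rewrite /max_divisors.
elim/big_ind: _ => [|a b ha hb|i _].
- by case: e {hC} => [|e]; rewrite ?expn0 ?exp0n // muln_gt0 C0.
- by case: (leqP a b).
have h := hC i.+1 isT.
have : ((size (divisors i.+1) ^ e) ^ m.+1 <= (C * N) ^ m.+1)%N.
  rewrite -expnM; apply: leq_trans h _; rewrite expnMn.
  apply: leq_mul; first by rewrite -{1}(expn1 C) leq_pexp2l.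
  by apply: leq_trans (ltn_ord i) _; rewrite leq_pexp2l.
by rewrite leq_exp2r.
Qed.

Lemma subpolynomialX F k : subpolynomial F -> subpolynomial (fun n => F n ^ k)%N.
Proof. by move=> hF e; have [C hC] := hF (k * e)%N; exists C => n n0; rewrite -expnM; exact: hC. Qed.

(** * Packing conjugate vectors in a box *)

Lemma norm_Re_le (z : algC) : `|'Re z| <= `|z|.
Proof.
rewrite -(@ler_pXn2r _ 2) ?nnegrE ?normr_ge0 // [leRHS]normC2_Re_Im real_normK ?Creal_Re //.
by rewrite lerDl -realEsqr Creal_Im.
Qed.

Lemma norm_Im_le (z : algC) : `|'Im z| <= `|z|.
Proof.
rewrite -(@ler_pXn2r _ 2) ?nnegrE ?normr_ge0 // [leRHS]normC2_Re_Im real_normK ?Creal_Im //.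
by rewrite lerDr -realEsqr Creal_Re.
Qed.

(* A real coordinate whose values at [z] and at its conjugate determine [z]. *)
Definition skew (z : algC) : algC := 'Re z + 'Im z.

Lemma skew_real z : skew z \is Num.real.
Proof. by rewrite rpredD ?Creal_Re ?Creal_Im. Qed.

Lemma skewB z w : skew (z - w) = skew z - skew w.
Proof. by rewrite /skew !raddfB /= addrACA -opprD. Qed.

Lemma norm_skew_le z : `|skew z| <= 2 * `|z|.
Proof.
rewrite mulr2n mulrDl mul1r; apply: le_trans (ler_normD _ _) _.
by apply: lerD; [exact: norm_Re_le | exact: norm_Im_le].
Qed.

(** One real coordinate per embedding treats real and complex embeddings alike: the missing
    coordinate is read at the conjugate embedding. *)
Lemma norm_le_skew z : `|z| <= `|skew z| + `|skew z^*|.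
Proof.
have ReE : 'Re z = (skew z + skew z^*) / 2.
  by rewrite /skew Re_conj Im_conj; field.
have ImE : 'Im z = (skew z - skew z^*) / 2.
  by rewrite /skew Re_conj Im_conj; field.
have hR : `|'Re z| <= (`|skew z| + `|skew z^*|) / 2.
  by rewrite ReE normrM [ `|2^-1|]ger0_norm ?invr_ge0 ?ler0n // ler_pM2r ?invr_gt0 ?ltr0n // ler_normD.
have hI : `|'Im z| <= (`|skew z| + `|skew z^*|) / 2.
  by rewrite ImE normrM [ `|2^-1|]ger0_norm ?invr_ge0 ?ler0n // ler_pM2r ?invr_gt0 ?ltr0n // ler_normB.
rewrite {1}[z]Crect; apply: le_trans (ler_normD _ _) _.
rewrite normrM normCi mul1r [leRHS](_ : _ = (`|skew z| + `|skew z^*|) / 2 + (`|skew z| + `|skew z^*|) / 2).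
  exact: lerD.
by field.
Qed.

Lemma truncn_eq_dist (x y : algC) : 0 <= x -> 0 <= y -> Num.truncn x = Num.truncn y -> `|x - y| < 1.
Proof.
move=> x0 y0 E; have /andP[x1 x2] := truncn_itv x0; have /andP[y1 y2] := truncn_itv y0.
rewrite -E in y1 y2; set n := Num.truncn x in x1 x2 y1 y2.
rewrite -natr1 in x2 y2.
rewrite real_ltr_norml ?rpredB ?ger0_real //; apply/andP; split.
  rewrite ltrBrDr addrC ltrBlDr; apply: lt_le_trans y2 _.
  by rewrite lerD2r.
rewrite ltrBlDr; apply: lt_le_trans x2 _.
by rewrite addrC lerD2l.
Qed.

Section Packing.
Variables (I : finType) (s : I -> autC) (V : {set I}) (r c : I -> I) (L : I -> algC).
Variables (A : algC) (N : nat) (P : algC -> Prop).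
Hypotheses (V0 : (0 < #|V|)%N) (N0 : (0 < N)%N) (A0 : 0 <= A) (L0 : forall i, 0 < L i).
Hypotheses (rV : forall i, r i \in V) (Lr : forall i, L (r i) = L i) (Lc : forall i, L (c i) = L i).
Hypothesis Pr : forall y i, P y -> s (r i) y = s i y.
Hypothesis Pc : forall y i, P y -> s (c i) y = (s i y)^*.
Hypothesis PL : forall y i, P y -> `|s i y| <= L i.
Hypothesis vol : A * \prod_(i in V) L i <= N%:R.
Hypothesis sep : forall y z, P y -> P z -> y != z -> 1 <= A * \prod_(i in V) `|s i (y - z)|.

(* Two points in the same cell of mesh 4L/q in every coordinate are too close. *)
Lemma packing : bounded P (24 ^ #|V| * N).
Proof.
set n := #|V|; have n0 : (0 < n)%N := V0.
(* For the least such [q], [(q - 1)^n <= 8^n N], and [q + 1 <= 3 (q - 1)] turns the [(q + 1)^n]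
   cells into at most [24^n N]. The strict inequality makes two points of one cell too close. *)
have exq : exists q, (8 ^ n * N < q ^ n)%N.
  exists (8 ^ n * N).+1; apply: leq_trans (ltnSn _) _.
  by rewrite -{1}(expn1 (_.+1)) leq_pexp2l.
case: (ex_minnP exq) => q hq qmin.
have q8 : (8 < q)%N.
  rewrite -(ltn_exp2r _ _ n0); apply: leq_ltn_trans hq.
  by rewrite -{1}[(8 ^ n)%N]muln1 leq_mul2l N0 orbT.
have q0 : 0 < q%:R :> algC by rewrite ltr0n (leq_trans _ q8).
apply: (@bounded_le _ _ (q.+1 ^ size (enum V) * 1)).
  have q1 : (q.-1 ^ n <= 8 ^ n * N)%N.
    rewrite leqNgt; apply/negP => /qmin; rewrite leqNgt prednK ?leqnn //.
    exact: leq_trans q8.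
  rewrite -cardE muln1 -/n -[24%N]/(3 * 8)%N expnMn -mulnA.
  apply: (@leq_trans (3 ^ n * q.-1 ^ n)); last by rewrite leq_mul2l q1 orbT.
  by rewrite -expnMn leq_exp2r //; lia.
pose cell i y := Num.truncn ((skew (s i y) + 2 * L i) / (4 * L i) * q%:R).
have L4 i : 0 < 4 * L i by rewrite mulr_gt0 ?ltr0n.
have box y i : P y -> 0 <= (skew (s i y) + 2 * L i) / (4 * L i) <= 1.
  move=> Py; have h : `|skew (s i y)| <= 2 * L i.
    by apply: le_trans (norm_skew_le _) _; rewrite ler_pM2l ?ltr0n // PL.
  rewrite real_ler_norml ?skew_real // in h; case/andP: h => h1 h2.
  rewrite ler_pdivrMr // mul1r divr_ge0 ?(ltW (L4 _)) //=.
    by rewrite (_ : 4 * L i = 2 * L i + 2 * L i) ?lerD2r //; ring.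
  by rewrite -(lerBlDr) sub0r.
apply: (bounded_family 0%N (Q := fun _ v => (v < q.+1)%N) (R := fun i y v => cell i y = v)).
- exact: enum_uniq.
- move=> i y _ Py; exists (cell i y) => //; have /andP[b0 b1] := box y i Py.
  rewrite /cell truncn_lt_nat; last by rewrite mulr_ge0 // ltW.
  apply: le_lt_trans (_ : q%:R < _); last by rewrite ltr_nat.
  by rewrite -[leRHS]mul1r ler_pM2r.
- by move=> i _; exact: bounded_ltn.
move=> v _; apply: bounded1 => y z [Py yv] [Pz zv]; apply/eqP; apply: contraTT isT => yz.
have /andP[] := conj (sep Py Pz yz) isT.
have close i : `|skew (s i y) - skew (s i z)| <= 4 * L i / q%:R.
  rewrite -(Lr i) -(Pr i Py) -(Pr i Pz).
  have iV : r i \in enum V by rewrite mem_enum.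
  have := truncn_eq_dist _ _ (etrans (yv _ iV) (esym (zv _ iV))).
  have /andP[by0 _] := box y (r i) Py; have /andP[bz0 _] := box z (r i) Pz.
  move=> /(_ (mulr_ge0 by0 (ltW q0)) (mulr_ge0 bz0 (ltW q0))).
  rewrite -mulrBl -mulrBl opprD addrACA subrr addr0 normrM (gtr0_norm q0).
  rewrite normrM normfV (gtr0_norm (L4 _)).
  by rewrite -ltr_pdivlMr // div1r ltr_pdivrMr // mulrC => /ltW.
(* [skew] is close at [i] and at the conjugate index [c i], each contributing [4 L / q]: this is the
   origin of 8. *)
have small i : `|s i (y - z)| <= 8 * L i / q%:R.
  apply: le_trans (norm_le_skew _) _.
  rewrite !rmorphB /= -(Pc i Py) -(Pc i Pz) !skewB.
  rewrite (_ : 8 * L i / q%:R = 4 * L i / q%:R + 4 * L i / q%:R); last by field; rewrite gt_eqF.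
  by apply: lerD; first exact: close; rewrite -(Lc i); exact: close.
have lt1 : A * \prod_(i in V) `|s i (y - z)| < 1.
  apply: (@le_lt_trans _ _ (A * \prod_(i in V) (L i * (8 / q%:R)))).
    apply: ler_wpM2l => //; apply: ler_prod => i _; rewrite normr_ge0 /=.
    by rewrite mulrA [L i * 8]mulrC.
  rewrite big_split /= prodr_const -/n mulrA.
  apply: (@le_lt_trans _ _ (N%:R * (8 / q%:R) ^+ n)).
    by rewrite ler_wpM2r // exprn_ge0 // divr_ge0 // ltW.
  rewrite expr_div_n mulrA ltr_pdivrMr ?exprn_gt0 // mul1r mulrC.
  by rewrite -!natrX -natrM ltr_nat.
by have := lt_le_trans lt1 (sep Py Pz yz); rewrite ltxx.
Qed.
End Packing.

(** * The Galois closure of Q(M) *)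

Definition autM (s t : autC) : autC := s \o t.
Definition autV (s : autC) : autC := algC_invaut s.

Lemma autVK (s : autC) x : autV s (s x) = x. Proof. exact: algC_autK. Qed.
Lemma autKV (s : autC) x : s (autV s x) = x. Proof. exact: algC_invautK. Qed.

Lemma aut_poly_int (P : {poly algC}) : P != 0 -> (forall s : autC, map_poly s P = P) ->
  exists Q : {poly int}, [/\ Q != 0, size Q = size P &
    exists2 a : algC, a != 0 & P = a *: map_poly (intr : int -> algC) Q].
Proof.
move=> P0 fixP; have ratP i : P`_i \in Crat.
  by apply: aut_fixed_rat => s; rewrite -{2}(fixP s) coef_map.
have Ep : P = map_poly ratr (map_poly getCrat P).
  by apply/polyP => i; rewrite coef_map coef_map_id0 /= ?(getCratK (ratP i)) // -[X in getCrat X](rmorph0 (ratr : rat -> algC)) ratCK.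
have [Q [a a0 EQ]] := rat_poly_scale (map_poly getCrat P).
have a0' : (a%:~R : algC)^-1 != 0 by rewrite invr_eq0 intr_eq0.
have EP : P = (a%:~R : algC)^-1 *: map_poly (intr : int -> algC) Q.
  rewrite {1}Ep EQ map_polyZ fmorphV /= ratr_int; congr (_ *: _).
  by rewrite -map_poly_comp; apply: eq_map_poly => z /=; rewrite ratr_int.
have Q0 : Q != 0 by apply: contraNneq P0 => Q0; rewrite EP Q0 rmorph0 scaler0.
exists Q; split=> //; last by exists (a%:~R : algC)^-1.
rewrite [in RHS]EP size_scale // size_map_inj_poly //; exact: intr_inj.
Qed.

Lemma orbit_exists (x : algC) : exists2 s : seq algC, uniq s & forall y, y \in s <-> exists t : autC, y = t x.
Proof.
have [r Dr] := closed_field_poly_normal (minCpoly x).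
rewrite (monicP (minCpoly_monic x)) scale1r in Dr.
exists (undup [seq y <- r | `[< exists t : autC, y = t x >]]); first exact: undup_uniq.
move=> y; rewrite mem_undup mem_filter; split=> [/andP[/asboolP]//|h].
apply/andP; split; first exact/asboolP.
by have [t ->] := h; rewrite -root_prod_XsubC -Dr -(minCpoly_aut t) root_minCpoly.
Qed.

Section Representatives.
Variable M : algC.

Definition fixes_orbit (s : autC) : Prop := forall t : autC, s (t M) = t M.

(* [inK z]: [z] lies in the Galois closure of Q(M). *)
Definition inK (z : algC) : Prop := forall s : autC, fixes_orbit s -> s z = z.

Lemma inK_orbit (t : autC) : inK (t M). Proof. by move=> s; apply. Qed.

Lemma inKB x y : inK x -> inK y -> inK (x - y).
Proof. by move=> Kx Ky s fs; rewrite rmorphB /= Kx ?Ky. Qed.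

Lemma aut_eq_inK (s t : autC) : (forall u : autC, s (u M) = t (u M)) -> forall z, inK z -> s z = t z.
Proof.
move=> st z Kz; rewrite -[in RHS](Kz (autM (autV t) s)) /= ?autKV // => u.
by rewrite /= st autVK.
Qed.

(* The [I i] represent the automorphisms modulo those that are trivial on the Galois closure of Q(M). *)
Definition representatives n (I : 'I_n -> autC) : Prop :=
  (forall t : autC, exists i, forall z, inK z -> t z = I i z) /\
  (forall i j, (forall z, inK z -> I i z = I j z) -> i = j).

(** On [K] an automorphism is determined by its action on the conjugates of [M], so one automorphism
    is chosen for each self-map [f] of the list [T] that is realised. *)
Lemma representatives_exist (T : seq algC) : uniq T -> (forall t : autC, t M \in T) -> (forall y, y \in T -> exists t : autC, y = t M) ->
  exists n (I : 'I_n -> autC), (n <= size T ^ size T)%N /\ representatives I.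
Proof.
move=> uT hT hT'; pose k := size T.
pose acts (f : {ffun 'I_k -> 'I_k}) (t : autC) := forall i : 'I_k, t T`_i = T`_(f i).
pose F := [set f | `[< exists t, acts f t >]]%SET.
have ex (f : {f | f \in F}) : exists t, acts (val f) t by case: f => f /=; rewrite inE => /asboolP.
have /choice[a ha] := ex.
have memT i : (i < k)%N -> T`_i \in T by exact: mem_nth.
have orb (t u : autC) : t (u M) \in T by exact: (hT (autM t u)).
have actE (t : autC) : exists f, acts f t.
  have h (i : 'I_k) : exists j : 'I_k, t T`_i = T`_j.
    have /hT'[u ->] := memT i (ltn_ord i).
    have hi := orb t u; rewrite -index_mem in hi.
    by exists (Ordinal hi); rewrite /= nth_index // orb.
  have /choice[f hf] := h; exists [ffun i => f i] => i; by rewrite ffunE.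
have onT (s t : autC) f : acts f s -> acts f t -> forall u : autC, s (u M) = t (u M).
  move=> fs ft u; have hu := hT u; have hi := hu; rewrite -index_mem in hi.
  by have := fs (Ordinal hi); rewrite /= nth_index // => ->; rewrite -ft /= nth_index.
pose n := #|{: {f | f \in F}}|.
exists n, (fun i => a (enum_val i)); split; last split.
- rewrite /n card_sig; apply: leq_trans (max_card _) _.
  by rewrite card_ffun !card_ord.
- move=> t; have [f ft] := actE t.
  have fF : f \in F by rewrite inE; apply/asboolP; exists t.
  exists (enum_rank (exist _ f fF)); rewrite enum_rankK; apply: aut_eq_inK.
  by apply: onT ft _; exact: (ha (exist _ f fF)).
- move=> i j hij; apply: enum_val_inj; apply: val_inj; apply/ffunP => l.
  have [u Eu] := hT' _ (memT l (ltn_ord l)).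
  have := hij _ (inK_orbit u); rewrite -Eu !ha => /eqP.
  by rewrite nth_uniq ?ltn_ord // => /eqP /val_inj.
Qed.

Section Given.
Variables (n : nat) (I : 'I_n -> autC).
Hypothesis repI : representatives I.

Lemma representatives_perm (t : autC) : exists2 f : 'I_n -> 'I_n, injective f &
  forall i z, inK z -> t (I i z) = I (f i) z.
Proof.
have /choice[f hf] : forall i, exists j, forall z, inK z -> t (I i z) = I j z.
  by move=> i; have [j hj] := repI.1 (autM t (I i)); exists j.
exists f => // i j ij; apply: (repI.2 i j) => z Kz; apply: (fmorph_inj t).
by rewrite !hf // ij.
Qed.

(** The product of the [X - I i z] is permuted into itself by automorphisms, hence rational. Its
    degree [n] is the same for all [z], which bounds the denominators of valuations uniformly. *)
Lemma inK_poly z : inK z -> exists Q : {poly int}, [/\ Q != 0, (size Q <= n.+1)%N &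
  forall i, root (map_poly (intr : int -> algC) Q) (I i z)].
Proof.
move=> Kz; pose P := \prod_i ('X - (I i z)%:P).
have monP : P \is monic by exact: monic_prod_XsubC.
have [||Q [Q0 sQ [a a0 EP]]] := @aut_poly_int P; first exact: monic_neq0.
  move=> t; have [f injf hf] := representatives_perm t.
  rewrite rmorph_prod [RHS](reindex_inj injf); apply: eq_bigr => i _ /=.
  by rewrite map_polyXsubC hf.
exists Q; split=> //; first by rewrite sQ size_prod_XsubC /index_enum -enumT size_enum_ord.
move=> i; rewrite -(rootZ _ _ a0) -EP.
by rewrite /P -(big_map (fun i => I i z) xpredT (fun r => 'X - r%:P)) root_prod_XsubC; apply/mapP; exists i; rewrite ?mem_index_enum.
Qed.

End Given.
End Representatives.

(** * Blocks of conjugates *)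

Notation polyZ := (map_poly (intr : int -> algC)).

Definition minimalZ (x : algC) (p : {poly int}) : Prop :=
  [/\ p != 0, root (polyZ p) x,
      (forall q : {poly int}, q != 0 -> root (polyZ q) x -> (size p <= size q)%N),
      zcontents p = 1 & 0 < lead_coef p].

Definition factorization (k d : nat) (M x : algC) (p : {poly int}) (rs : seq algC) : Prop :=
  [/\ minimalZ x p, polyZ p = (lead_coef p)%:~R *: \prod_(r <- rs) ('X - r%:P), size rs = d,
      count (fun r => `|r| < 1) rs = k & M = (lead_coef p)%:~R * \prod_(r <- rs) Num.max 1 `|r|].

(* [M] is the Mahler measure, that is the [d]-th power of the height of [x]. *)
Definition height_class (k d : nat) (M x : algC) : Prop := exists p rs, factorization k d M x p rs.

Lemma max1_ge1 (x : algC) : 1 <= Num.max 1 `|x|.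
Proof. by rewrite /Order.max; case: ifP => [/ltW|]. Qed.

Lemma norm_le_max1 (x : algC) : `|x| <= Num.max 1 `|x|.
Proof. by rewrite /Order.max; case: ifP => // /negbT; rewrite -real_leNgt ?real1 ?normr_real. Qed.

Lemma max1_in (x : algC) : `|x| < 1 -> Num.max 1 `|x| = 1.
Proof. by rewrite /Order.max => /lt_gtF ->. Qed.

Lemma max1_out (x : algC) : ~~ (`|x| < 1) -> Num.max 1 `|x| = `|x|.
Proof.
by rewrite -real_leNgt ?real1 ?normr_real // le_eqVlt /Order.max => /orP[/eqP <-|->] //; rewrite ltxx.
Qed.

Lemma norm_coef_prod_XsubC (s : seq algC) j :
  `|(\prod_(r <- s) ('X - r%:P))`_j| <= 2 ^+ size s * \prod_(r <- s) Num.max 1 `|r|.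
Proof.
elim: s j => [|r s IH] j; first by rewrite !big_nil coef1 expr0 mulr1; case: eqP; rewrite ?normr1 ?normr0 ?ler01.
rewrite !big_cons /= mulrBl coefB mulrC coefMX coefCM exprS.
set B := 2 ^+ _ * _ in IH; set m := Num.max 1 _.
have B0 : 0 <= B by apply: le_trans (IH 0%N).
have -> : 2 * 2 ^+ size s * (m * \prod_(j0 <- s) Num.max 1 `|j0|) = m * B + m * B by rewrite /B; ring.
apply: le_trans (ler_normB _ _) _; apply: lerD.
  apply: (@le_trans _ _ B); last by rewrite ler_peMl // max1_ge1.
  by case: eqP => // _; rewrite normr0.
by rewrite normrM ler_pM // norm_le_max1.
Qed.

Lemma zprimitive_content (p : {poly int}) q : prime q -> zcontents p = 1 -> is_content (vring q) (polyZ p) 1.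
Proof.
move=> q_pr cp; have vq := vringP q_pr; have hA : is_subring (vring q) by case: vq.
split; rewrite ?oner_eq0 //.
  by move=> i; rewrite divr1 coef_map; exact: subring_int.
have [i qi] : exists i, ~~ (q %| `|(p`_i)%R|)%N.
  apply: contrapT => nex; have : (q%:Z %| zcontents p)%Z.
    rewrite dvdz_contents; apply/polyOverP => i; rewrite -[_ \in _]/(q %| `|(p`_i)%R|)%N.
    by apply: contrapT => h; apply: nex; exists i; apply/negP.
  rewrite cp -[(_ %| _)%Z]/(q %| 1)%N dvdn1 => /eqP q1.
  by rewrite q1 in q_pr.
have pi0 : p`_i != 0 by apply: contraNneq qi => ->; rewrite absz0 dvdn0.
exists i; rewrite coef_map ?intr_eq0 // div1r.
have [] := associate_int vq q_pr pi0.
by rewrite lognE q_pr absz_gt0 pi0 (negPf qi) /= expr0 div1r.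
Qed.

(* Conjugates are grouped according to which automorphisms send them inside the unit disc. *)
Definition near (r z : algC) : bool := `[< forall t : autC, (`|t r| < 1) = (`|t z| < 1) >].

Lemma near_refl r : near r r. Proof. exact/asboolP. Qed.
Lemma near_sym r z : near r z = near z r.
Proof. by apply/asboolP/asboolP => h t; rewrite h. Qed.
Lemma near_trans y r z : near r y -> near y z -> near r z.
Proof. by move=> /asboolP h1 /asboolP h2; apply/asboolP => t; rewrite h1 h2. Qed.
Lemma near_inside r z : near r z -> (`|r| < 1) = (`|z| < 1).
Proof. by move=> /asboolP/(_ idfun). Qed.
Lemma near_aut (s : autC) r z : near (s r) (s z) = near r z.
Proof.
apply/asboolP/asboolP => h t; last exact: (h (autM t s)).
by have := h (autM t (autV s)); rewrite /= !autVK.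
Qed.

Definition block_poly (rs : seq algC) (r : algC) : {poly algC} := \prod_(z <- rs | near r z) ('X - z%:P).

Lemma block_poly_monic rs r : block_poly rs r \is monic.
Proof. exact: monic_prod_XsubC. Qed.

Lemma size_block_poly rs r : size (block_poly rs r) = (count (near r) rs).+1.
Proof. by rewrite /block_poly -big_filter size_prod_XsubC size_filter. Qed.

Lemma root_block_poly rs r z : root (block_poly rs r) z = (z \in rs) && near r z.
Proof. by rewrite /block_poly -big_filter root_prod_XsubC mem_filter andbC. Qed.

Lemma norm_coef0_block_poly rs r : `|(block_poly rs r)`_0| = \prod_(z <- rs | near r z) `|z|.
Proof.
rewrite -horner_coef0 horner_prod normr_prod; apply: eq_bigr => z _.
by rewrite hornerXsubC sub0r normrN.
Qed.

(** The roots of a block lie all inside or all outside the disc, so the Mahler measure of a block is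
    read off its constant coefficient. *)
Lemma max1_block_poly rs r :
  Num.max 1 `|(block_poly rs r)`_0| = \prod_(z <- rs | near r z) Num.max 1 `|z|.
Proof.
rewrite norm_coef0_block_poly; have [rin|rout] := boolP (`|r| < 1).
  rewrite [RHS]big1 => [|z /near_inside]; last by rewrite rin => /esym/max1_in.
  have : \prod_(z <- rs | near r z) `|z| <= 1.
    apply: prodr_ile1 => z /near_inside; rewrite rin normr_ge0 => /esym/ltW ->.
    by [].
  by rewrite /Order.max => /le_gtF ->.
have -> : \prod_(z <- rs | near r z) `|z| = `|\prod_(z <- rs | near r z) `|z| |.
  by rewrite ger0_norm // prodr_ge0.
rewrite max1_out; last first.
  rewrite -real_leNgt ?real1 ?normr_real // ger0_norm ?prodr_ge0 //.
  apply: (big_ind (fun u : algC => 1 <= u)) => // [u v|z /near_inside]; first exact: mulr_ege1.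
  by rewrite (negPf rout) => /esym/negbT; rewrite -real_leNgt ?real1 ?normr_real.
rewrite ger0_norm ?prodr_ge0 //; apply: eq_bigr => z /near_inside.
by rewrite (negPf rout) => /esym/negbT/max1_out.
Qed.

(** Indices with equal blocks are merged through a canonical member, so that comparing the
    partitions attached to two elements amounts to comparing two maps on indices. *)
Definition first_index n (T : eqType) (f : 'I_n -> T) (i : 'I_n) : 'I_n :=
  [arg min_(j < i | f j == f i) nat_of_ord j].

Lemma first_index_eq n (T : eqType) (f : 'I_n -> T) i : f (first_index f i) = f i.
Proof. by rewrite /first_index; case: arg_minnP => // j /eqP. Qed.

Lemma first_indexP n (T : eqType) (f : 'I_n -> T) i j :
  first_index f i = first_index f j <-> f i = f j.
Proof.
split=> [E|E]; first by rewrite -[LHS]first_index_eq E first_index_eq.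
rewrite {1}/first_index; case: arg_minnP => // u /eqP fu minu.
rewrite /first_index; case: arg_minnP => // v /eqP fv minv; apply/val_inj/eqP.
by rewrite /= eqn_leq minu ?minv ?fu ?fv ?E.
Qed.

Definition first_indices n (T : eqType) (f : 'I_n -> T) : {set 'I_n} := [set i | first_index f i == i].

Lemma first_index_in n (T : eqType) (f : 'I_n -> T) i : first_index f i \in first_indices f.
Proof. by rewrite inE; apply/eqP/first_indexP; exact: first_index_eq. Qed.

Section Blocks.
Variables (k d : nat) (M x : algC) (p : {poly int}) (rs : seq algC).
Hypotheses (k0 : (0 < k)%N) (kd : (k < d)%N) (hf : factorization k d M x p rs).

Let a : algC := (lead_coef p)%:~R.

Let a_gt0 : 0 < a.
Proof. by case: hf => [[_ _ _ _ h] _ _ _ _]; rewrite /a ltr0z. Qed.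

Let pE : polyZ p = a *: \prod_(r <- rs) ('X - r%:P). Proof. by case: hf. Qed.

Let size_p : size p = d.+1.
Proof.
have <- : size (polyZ p) = size p by rewrite size_map_inj_poly //; exact: intr_inj.
by rewrite pE size_scale ?gt_eqF // size_prod_XsubC; case: hf => _ _ -> _ _.
Qed.

Let root_aut (s : autC) y : y \in rs -> s y \in rs.
Proof.
rewrite -!root_prod_XsubC -(rootZ y _ (lt0r_neq0 a_gt0)) -(rootZ (s y) _ (lt0r_neq0 a_gt0)) -pE => h.
have -> : polyZ p = map_poly s (polyZ p); last by rewrite fmorph_root.
by rewrite -map_poly_comp; apply: eq_map_poly => z /=; rewrite rmorph_int.
Qed.

(** The polynomial with the orbit of [x] as roots is rational, so minimality of [p] gives it at
    least [d] roots; these already exhaust [rs]. *)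
Lemma roots_orbit : uniq rs /\ forall y, y \in rs <-> exists s : autC, y = s x.
Proof.
have [T uT hT] := orbit_exists x.
have xrs : x \in rs.
  rewrite -root_prod_XsubC -(rootZ _ _ (lt0r_neq0 a_gt0)) -pE.
  by case: hf => [[]].
have sub : {subset T <= rs} by move=> y /hT[s ->]; exact: root_aut.
pose P := \prod_(r <- T) ('X - r%:P).
have [||Q [Q0 sQ [b b0 EP]]] := @aut_poly_int P.
- by rewrite monic_neq0 // monic_prod_XsubC.
- move=> s; rewrite rmorph_prod /=.
  have pT : perm_eq T (map s T).
    have us : uniq (map s T) by rewrite map_inj_uniq //; exact: fmorph_inj.
    apply: uniq_perm => // y.
    have sT : {subset map s T <= T}.
      by move=> _ /mapP[y' /hT[t ->] ->]; apply/hT; exists (autM s t).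
    by have [_ ->] := uniq_min_size us sT (eq_leq (esym (size_map s T))).
  by rewrite [RHS](perm_big _ pT) /= big_map; apply: eq_bigr => y _; rewrite map_polyXsubC.
have xT : x \in T by apply/hT; exists idfun.
have : (size p <= size Q)%N.
  case: hf => [[_ _ h _ _] _ _ _ _]; apply: h => //.
  by rewrite -(rootZ _ _ b0) -EP root_prod_XsubC.
rewrite sQ size_prod_XsubC size_p ltnS => dT.
have sz : size rs = d by case: hf.
rewrite -sz in dT.
have [_ ET] := uniq_min_size uT sub dT.
split; first exact: (leq_size_uniq uT sub dT).
by move=> y; rewrite -ET; exact: hT.
Qed.

Let uniq_rs : uniq rs. Proof. by case: roots_orbit. Qed.
Let rsP y : y \in rs <-> exists s : autC, y = s x. Proof. by case: roots_orbit. Qed.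
Let x_rs : x \in rs. Proof. by apply/rsP; exists idfun. Qed.

Lemma perm_roots (s : autC) : perm_eq rs (map s rs).
Proof.
have us : uniq (map s rs) by rewrite map_inj_uniq //; exact: fmorph_inj.
apply: uniq_perm => // y.
have sT : {subset map s rs <= rs} by move=> _ /mapP[y' yr ->]; exact: root_aut.
by have [_ ->] := uniq_min_size us sT (eq_leq (esym (size_map s rs))).
Qed.

Lemma roots_neq0 y : y \in rs -> y != 0.
Proof.
move=> /rsP[s ->]; rewrite fmorph_eq0; apply: contraTneq kd => x0.
have : (size rs <= size [:: 0%R : algC])%N.
  by apply: uniq_leq_size => // z /rsP[t ->]; rewrite x0 rmorph0 mem_head.
have -> : size rs = d by case: hf.
by rewrite -leqNgt => d1; apply: leq_trans d1 k0.
Qed.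

Let m : algC := a * \prod_(r <- rs | ~~ (`|r| < 1)) r.

Let big_aut (R : Type) (idx : R) (op : Monoid.com_law idx) (s : autC) (Q : pred algC) F :
  \big[op/idx]_(r <- rs | Q r) F r = \big[op/idx]_(r <- rs | Q (s r)) F (s r).
Proof. by rewrite (perm_big _ (perm_roots s)) /= big_map. Qed.

Lemma mahler_outside : M = a * \prod_(r <- rs | ~~ (`|r| < 1)) `|r|.
Proof.
have -> : M = a * \prod_(r <- rs) Num.max 1 `|r| by case: hf.
congr (_ * _); rewrite (bigID (fun r : algC => `|r| < 1)) /= big1 ?mul1r.
  by apply: eq_bigr => r; exact: max1_out.
by move=> r; exact: max1_in.
Qed.

(** Complex conjugation permutes the roots outside the disc, so [m] is real with absolute value [M].
    Automorphisms are computed on the product [m], not on the absolute value [M]. *)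
Let m_sign : m = M \/ m = - M.
Proof.
have nm : `|m| = M by rewrite mahler_outside normrM normr_prod gtr0_norm.
have mR : m^* = m.
  rewrite /m rmorphM /= conj_intr ?intr_int //; congr (_ * _); rewrite rmorph_prod /= [RHS](big_aut _ (Num.conj : autC)) /=.
  by apply: eq_bigl => r; rewrite norm_conjC.
have /CrealP/real_normrEsign E := mR.
by move: E; rewrite nm; case: (m < 0) => ->; rewrite ?expr0 ?expr1 ?mul1r ?mulN1r ?opprK; [right|left].
Qed.

(** If [t] moved an outside root [z] inside, the product of [|t r|] over the outside roots would be
    strictly below that of [max(1, |t r|)] over all roots, so [|t m| < M = |m|], against [t m = m].
    The inverse of [s] gives the other implication. *)
Lemma fix_inside (s : autC) y : s m = m -> y \in rs -> (`|s y| < 1) = (`|y| < 1).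
Proof.
have half (t : autC) z : t m = m -> z \in rs -> ~~ (`|z| < 1) -> ~~ (`|t z| < 1).
  move=> tm zr zo; apply/negP => tz.
  have : `|m| < M; last first.
    by have : `|m| = M; [rewrite mahler_outside normrM normr_prod gtr0_norm | move=> ->; rewrite ltxx].
  rewrite -{1}tm rmorphM /= rmorph_int normrM (gtr0_norm a_gt0).
  have -> : M = a * \prod_(r <- rs) Num.max 1 `|t r|.
    have -> : M = a * \prod_(r <- rs) Num.max 1 `|r| by case: hf.
    by rewrite (big_aut _ t).
  rewrite ltr_pM2l // rmorph_prod normr_prod.
  apply: (@lt_le_trans _ _ (\prod_(r <- rs | ~~ (`|r| < 1)) Num.max 1 `|t r|)); last first.
    rewrite [leRHS](bigID (fun r : algC => ~~ (`|r| < 1))) /= ler_peMr //.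
      by apply: prodr_ge0 => r _; apply: le_trans (max1_ge1 _).
    apply: (big_ind (fun u : algC => 1 <= u)) => // [u v|r _]; [exact: mulr_ege1 | exact: max1_ge1].
  rewrite -[ltLHS]big_filter -[ltRHS]big_filter; set S := [seq _ <- _ | _].
  have zS : z \in S by rewrite mem_filter zo.
  have uS : uniq S by rewrite filter_uniq.
  rewrite (bigD1_seq z) // [ltRHS](bigD1_seq z) //=.
  apply: (@lt_le_trans _ _ (1 * \prod_(r <- S | r != z) `|t r|)).
    rewrite ltr_pM2r // big_seq_cond; apply: prodr_gt0 => r /andP[].
    rewrite mem_filter => /andP[_ rr] _; by rewrite normr_gt0 fmorph_eq0 roots_neq0.
  apply: ler_pM; rewrite ?max1_ge1 ?prodr_ge0 //.
  by apply: ler_prod => r _; rewrite normr_ge0 norm_le_max1.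
move=> sm yr; apply/idP/idP; last first.
  apply: contraTT => h; rewrite -(autVK s y).
  apply: (half (autV s)) h; last exact: root_aut.
  by rewrite -{1}sm autVK.
by apply: contraTT; exact: half.
Qed.


Lemma block_poly_aut (s : autC) y : map_poly s (block_poly rs y) = block_poly rs (s y).
Proof.
rewrite rmorph_prod [RHS](big_aut _ s) /=.
by apply: eq_big => [z|z _]; rewrite ?near_aut ?map_polyXsubC.
Qed.

Lemma block_poly_eq y z : y \in rs -> z \in rs -> block_poly rs y = block_poly rs z <-> near y z.
Proof.
move=> yr zr; split=> [E|yz].
  by have := root_block_poly rs z z; rewrite -E root_block_poly near_refl zr.
apply: eq_bigl => u; apply/idP/idP => [|h]; last exact: near_trans yz h.
by apply: near_trans; rewrite near_sym.
Qed.

Lemma near_fix (s : autC) y : fixes_orbit M s -> y \in rs -> near (s y) y.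
Proof.
move=> fs yr; apply/asboolP => t.
have tm u : u = M \/ u = - M -> s (autV t u) = autV t u.
  by case=> ->; rewrite ?rmorphN /= ?fs.
(* The conjugate [t s t^-1] fixes [m], because [s] fixes [t^-1 m], which is a conjugate of [M] up to
   sign. *)
have := @fix_inside (autM t (autM s (autV t))) (t y) _ (root_aut t yr).
by rewrite /= autVK; apply; rewrite tm ?autKV.
Qed.

Lemma block_poly_inK y j : y \in rs -> inK M (block_poly rs y)`_j.
Proof.
move=> yr s fs; rewrite -coef_map block_poly_aut.
by rewrite ((block_poly_eq (root_aut s yr) yr).2 (near_fix fs yr)).
Qed.

Section Cover.
Variables (n : nat) (I : 'I_n -> autC).
Hypothesis repI : representatives M I.

Let c i := block_poly rs (I i x).
Let V := first_indices c.

Lemma conj_root i : I i x \in rs. Proof. exact: root_aut. Qed.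

Lemma coef_block_poly i j : (c i)`_j = I i (block_poly rs x)`_j.
Proof. by rewrite /c -block_poly_aut coef_map. Qed.

(** Once [s] and [I i] agree on [K], where the coefficients of blocks lie, [s x] and [I i x] have
    the same block. *)
Lemma near_cover y : y \in rs -> exists i, near y (I i x).
Proof.
move=> /rsP[s ->]; have [i hi] := repI.1 s; exists i.
apply/(block_poly_eq (root_aut s x_rs) (conj_root i)).
rewrite -!block_poly_aut; apply/polyP => j; rewrite !coef_map /=.
by apply: hi; exact: block_poly_inK.
Qed.

Lemma big_blocks (R : Type) (idx : R) (op : Monoid.com_law idx) F :
  \big[op/idx]_(r <- rs) F r = \big[op/idx]_(i in V) \big[op/idx]_(r <- rs | near (I i x) r) F r.
Proof.
rewrite (exchange_big_dep xpredT) //=; apply: eq_big_seq => r rr.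
have [i0 hi0] := near_cover rr.
rewrite (big_pred1 (first_index c i0)) // => i /=.
apply/andP/eqP => [[+ h]|->].
  rewrite inE => /eqP <-; apply/first_indexP/(block_poly_eq (conj_root _) (conj_root _)).
  exact: near_trans h hi0.
split; first exact: first_index_in.
have /(block_poly_eq (conj_root _) (conj_root _)) h := first_index_eq c i0.
by apply: near_trans h _; rewrite near_sym.
Qed.

Lemma prod_blocks : polyZ p = a *: \prod_(i in V) c i.
Proof. by rewrite pE big_blocks. Qed.

Lemma mahler_blocks : M = a * \prod_(i in V) Num.max 1 `|(c i)`_0|.
Proof.
have -> : M = a * \prod_(r <- rs) Num.max 1 `|r| by case: hf.
by rewrite big_blocks; congr (_ * _); apply: eq_bigr => i _; rewrite max1_block_poly.
Qed.

Let b := count (near x) rs.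

Lemma count_near (s : autC) : count (near (s x)) rs = b.
Proof.
rewrite -sum1_count /b -sum1_count (big_aut _ s).
by apply: eq_bigl => z; rewrite near_aut.
Qed.

Lemma block_size_gt0 : (0 < b)%N.
Proof. by rewrite -has_count; apply/hasP; exists x; rewrite ?near_refl. Qed.

Lemma card_blocks : (#|V| * b = d)%N.
Proof.
have <- : size rs = d by case: hf.
rewrite -sum1_size big_blocks -sum_nat_const; apply: eq_bigr => i _.
by rewrite sum1_count count_near.
Qed.

(** The open disc contains whole blocks only, and all blocks have size [b]. *)
Lemma block_size_dvd_gcd : (b %| gcdn k d)%N.
Proof.
rewrite dvdn_gcd -card_blocks dvdn_mull // andbT.
have <- : count (fun r => `|r| < 1) rs = k by case: hf.
rewrite -sum1_count big_mkcond big_blocks; apply: (big_ind (fun u => b %| u)%N) => //.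
  by move=> u v; exact: dvdn_add.
move=> i _; case: (boolP (`|I i x| < 1)) => h.
  rewrite (eq_bigr (fun=> 1%N)) ?sum1_count ?count_near //.
  by move=> z /near_inside; rewrite h => <-.
by rewrite big1 ?dvdn0 // => z /near_inside; rewrite (negPf h) => <-.
Qed.

Lemma conjugates_gt0 : (0 < n)%N.
Proof. by have [[i ni] _] := repI.1 idfun; apply: leq_ltn_trans ni. Qed.

Lemma coef0_blocks : (p`_0)%:~R = a * \prod_(i in V) (c i)`_0.
Proof.
rewrite -(coef_map (intr : int -> algC)) prod_blocks -horner_coef0 hornerZ horner_prod.
by congr (_ * _); apply: eq_bigr => i _; rewrite horner_coef0.
Qed.

Lemma coef0_block_neq0 i : (c i)`_0 != 0.
Proof.
rewrite -horner_coef0 -[_ == 0]/(root _ _) root_block_poly negb_and.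
by apply/orP; left; apply/negP => /roots_neq0; rewrite eqxx.
Qed.

Lemma coef0_neq0 : p`_0 != 0.
Proof.
rewrite -(@intr_eq0 algC) coef0_blocks mulf_neq0 // ?(gt_eqF a_gt0) //.
by apply/prodf_neq0 => i _; exact: coef0_block_neq0.
Qed.

Lemma block_first i : c (first_index c i) = c i.
Proof. exact: first_index_eq. Qed.

(** Gauss's lemma for the primitive polynomial [p]: the contents of the blocks multiply to [a^-1] up
    to a unit. Each inverse content is integral because blocks are monic, so [a * kappa i], a unit
    times inverses of other contents, is integral. *)
Lemma block_contents q : prime q -> exists kappa : 'I_n -> algC,
  [/\ forall i, is_content (vring q) (c i) (kappa i),
      associate (vring q) (a * \prod_(i in V) kappa i) 1,
      forall i, kappa (first_index c i) = kappa i &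
      forall i, vring q (a * kappa i)].
Proof.
move=> q_pr; have vq := vringP q_pr; have hA : is_subring (vring q) by case: vq.
have c0 i : c i != 0 by rewrite monic_neq0 // block_poly_monic.
have /choice[u hu] : forall i, exists j, is_content (vring q) (c i) (c i)`_j.
  move=> i; have [e he] := content_exists vq (c0 i); have [e0 h1 [j cj h2]] := he.
  by exists j; apply: (content_assoc vq he); split.
(* Reading [u] at the first index gives equal blocks the same generator. *)
pose kappa i := (c i)`_(u (first_index c i)).
have hk i : is_content (vring q) (c i) (kappa i).
  by rewrite /kappa -block_first; exact: hu.
have kf i : kappa (first_index c i) = kappa i.
  by rewrite /kappa (_ : first_index c (first_index c i) = first_index c i) ?block_first //; apply/first_indexP; exact: block_first.
have ass : associate (vring q) (a * \prod_(i in V) kappa i) 1.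
  apply: (content_uniq vq (P := polyZ p)); last by apply: zprimitive_content => //; case: hf => [[]].
  rewrite prod_blocks -mul_polyC; apply: (content_mul vq); first by apply: (contentC vq); rewrite gt_eqF.
  by apply: (content_prod vq) => i _; exact: hk.
exists kappa; split=> // i.
have k0' j : kappa j != 0 by case: (hk j).
rewrite -kf.
have -> : a * kappa (first_index c i) = (a * \prod_(j in V) kappa j) *
    \prod_(j in V | j != first_index c i) (kappa j)^-1.
  rewrite (bigD1 (first_index c i)) ?first_index_in //= -!mulrA -big_split /=.
  by rewrite [X in _ * (_ * X)]big1 ?mulr1 // => j _; rewrite divff.
apply: subringM => //; first by case: ass => _ _; rewrite divr1.
by apply: subring_prod => // j _; exact: (content_monic (block_poly_monic _ _) (hk j)).
Qed.

Lemma coef_block_algebraic i j D : (n <= D)%N -> exists Q : {poly int}, [/\ Q != 0, (size Q <= D.+1)%N &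
  root (polyZ Q) ((c i)`_j)^-1].
Proof.
move=> nD; have Kz : inK M ((block_poly rs x)`_j)^-1.
  by move=> s fs; rewrite fmorphV /= (block_poly_inK j x_rs).
have [Q [Q0 sQ Qz]] := inK_poly repI Kz; exists Q; split=> //; first exact: leq_trans sQ _.
by have := Qz i; rewrite fmorphV /= -coef_block_poly.
Qed.

(** [family_associate] applies with [N] the leading coefficient, since [e^-1] and [a e] are
    integral. The generator [e] is taken among the coefficients of the block, which lie in [K] and
    so have degree at most [D]. *)
Lemma content_class i D : (n <= D)%N -> exists2 E, (E %| `|lead_coef p| ^ D`!)%N &
  forall q, prime q -> exists2 e, is_content (vring q) (c i) e & associate (vring q) (e^-1 ^+ D`!) E%:R.
Proof.
move=> nD.
have a0 : (0 < `|lead_coef p|)%N by rewrite absz_gt0 -(@intr_eq0 algC) gt_eqF.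
have aE : (`|lead_coef p|%N)%:R = a.
  by rewrite /a -{2}(@gtz0_abs (lead_coef p)) //; case: hf => [[]].
have /choice[e he] : forall q, exists e, prime q -> [/\ is_content (vring q) (c i) e, vring q (a * e) &
    exists j, e = (c i)`_j].
  move=> q; case: (boolP (prime q)) => [q_pr|]; last by exists 0.
  have vq := vringP q_pr; have hA : is_subring (vring q) by case: vq.
  have [kappa [hk _ _ /(_ i) hak]] := block_contents q_pr.
  have [e0 h1 [j cj h2]] := hk i.
  have ass : associate (vring q) (kappa i) (c i)`_j by split.
  exists (c i)`_j => _; split; [exact: (content_assoc vq (hk i)) | | by exists j].
  rewrite -[X in _ * X](divfK e0) mulrCA; apply: subringM => //.
have [|q q_pr|q q_pr|E EN hE] := @family_associate (fun q => (e q)^-1) D `|lead_coef p|%N.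
- exact: a0.
- by have [_ _ [j ->]] := he q q_pr; exact: coef_block_algebraic.
- have [hc hae _] := he q q_pr; have [e0 _ _] := hc; split.
  + by rewrite invr_eq0.
  + exact: (content_monic (block_poly_monic _ _) hc).
  + by rewrite invrK aE.
exists E => // q q_pr; have [hc _ _] := he q q_pr; exists (e q) => //; exact: hE.
Qed.

(** Both [a c_i(0)] and its cofactor in [a p_0], which is [a] times the other constant coefficients,
    are integral by [block_contents]. *)
Lemma coef0_class i D : (n <= D)%N -> exists2 F, (F %| (`|lead_coef p| * `|(p`_0)%R|) ^ D`!)%N &
  forall q, prime q -> associate (vring q) ((a * (c i)`_0) ^+ D`!) F%:R.
Proof.
move=> nD.
have a0 : (0 < `|lead_coef p|)%N by rewrite absz_gt0 -(@intr_eq0 algC) gt_eqF.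
have f0 : (0 < `|(p`_0)%R|)%N by rewrite absz_gt0 coef0_neq0.
have x0 : a * (c i)`_0 != 0 by rewrite mulf_neq0 ?coef0_block_neq0 // gt_eqF.
have [|q q_pr|q q_pr|F FN hF] := @family_associate (fun=> a * (c i)`_0) D (`|lead_coef p| * `|(p`_0)%R|)%N.
- by rewrite muln_gt0 a0.
- have Kz : inK M (a * (block_poly rs x)`_0).
    by move=> s fs; rewrite rmorphM /= rmorph_int (block_poly_inK 0 x_rs).
  have [Q [Q0 sQ Qz]] := inK_poly repI Kz; exists Q; split=> //; first exact: leq_trans sQ _.
  by have := Qz i; rewrite rmorphM /= rmorph_int -coef_block_poly.
- have vq := vringP q_pr; have hA : is_subring (vring q) by case: vq.
  have [kappa [hk ass kf hak]] := block_contents q_pr.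
  have k0' j : kappa j != 0 by case: (hk j).
  split=> //.
    rewrite -[X in _ * X](divfK (k0' i)) mulrCA; apply: subringM => //; by case: (hk i).
  have -> : (`|lead_coef p| * `|(p`_0)%R|)%N%:R = (-1) ^+ (p`_0 < 0)%R * (a * (p`_0)%:~R) :> algC.
    rewrite natrM mulrCA; congr (_ * _).
      by rewrite /a -{2}(@gtz0_abs (lead_coef p)) //; case: hf => [[]].
    by rewrite {3}[p`_0]intEsign rmorphM rmorphXn rmorphN1 mulrA -expr2 sqrr_sign mul1r.
  rewrite -mulrA; apply: subringM => //; first by apply: subringX => //; apply: subringN => //; exact: subring1.
  rewrite coef0_blocks -block_first (bigD1 (first_index c i)) ?first_index_in //=.
  set P := \prod_(j in V | _) _; set ci := (c (first_index c i))`_0.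
  have ci0 : ci != 0 by exact: coef0_block_neq0.
  have -> : a * (a * (ci * P)) / (a * ci) = a * P by field; rewrite ci0 gt_eqF.
  have -> : a * P = (a * \prod_(j in V) kappa j) * ((kappa (first_index c i))^-1 *
     \prod_(j in V | j != first_index c i) ((c j)`_0 / kappa j)).
    rewrite [\prod_(j in V) _](bigD1 (first_index c i)) ?first_index_in //=.
    rewrite big_split /= -/P prodfV; field; rewrite k0' andbT.
    by apply/prodf_neq0 => j _.
  apply: subringM => //; first by case: ass => _ _; rewrite divr1.
  apply: subringM => //; first exact: (content_monic (block_poly_monic _ _) (hk _)).
  by apply: subring_prod => // j _; case: (hk j).
by exists F.
Qed.

Lemma norm_aut_mahler_le (s : autC) : `|s M| <= M.
Proof.
have -> : `|s M| = `|s m|.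
  by case: m_sign => ->; rewrite // rmorphN normrN.
rewrite rmorphM /= rmorph_int normrM (gtr0_norm a_gt0).
have -> : M = a * \prod_(r <- rs) Num.max 1 `|s r|.
  have -> : M = a * \prod_(r <- rs) Num.max 1 `|r| by case: hf.
  by rewrite (big_aut _ s).
rewrite ler_pM2l // rmorph_prod normr_prod.
rewrite [leRHS](bigID (fun r : algC => ~~ (`|r| < 1))) /=.
apply: (@le_trans _ _ (\prod_(r <- rs | ~~ (`|r| < 1)) Num.max 1 `|s r| * 1)).
  by rewrite mulr1; apply: ler_prod => r _; rewrite normr_ge0 norm_le_max1.
apply: ler_wpM2l; first by apply: prodr_ge0 => r _; apply: le_trans (max1_ge1 _).
by apply: (big_ind (fun u : algC => 1 <= u)) => // [u v|r _]; [exact: mulr_ege1 | exact: max1_ge1].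
Qed.

(** The exponent of [|y|] in the absolute value of the product of all [I i m]: the root [y] occurs
    in [I i m] exactly when its preimage lies outside the disc. *)
Let weight y := #|[set i | ~~ (`|autV (I i) y| < 1)]|.

Let weight_aut (t : autC) y : y \in rs -> weight (t y) = weight y.
Proof.
move=> yr; have [f injf hf'] := representatives_perm repI (autV t).
rewrite /weight -!sum1dep_card [RHS](reindex_inj injf); apply: eq_bigl => i; congr (~~ _).
(* (t^-1 I_i)^-1 and (I_(f i))^-1 differ by an automorphism that is trivial on the conjugates of M. *)
pose rho : autC := autM (autV (I i)) (autM t (I (f i))).
have frho : fixes_orbit M rho.
  move=> u; rewrite /rho /= -hf' ?autKV ?autVK //; exact: inK_orbit.
have zr : autV (I (f i)) y \in rs by exact: root_aut.
by have /near_inside := near_fix frho zr; rewrite /rho /= autKV.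
Qed.

(* The left-hand side depends on [M] only, and is divisible by the leading and constant coefficients. *)
Lemma conjugates_prod : exists w, [/\ (0 < w)%N, (w < n)%N &
  `|\prod_i I i M| = (`|lead_coef p| ^ (n - w) * `|(p`_0)%R| ^ w)%N%:R].
Proof.
pose w := weight x.
have wE y : y \in rs -> weight y = w by move=> /rsP[s ->]; exact: weight_aut.
have countk : count (fun r => `|r| < 1) rs = k by case: hf.
have sz : size rs = d by case: hf.
(* Double counting of pairs of a root and an index. With [0 < k < d] it gives [0 < w < n], so both
   [a] and [p_0] occur with a positive exponent. *)
have wd : (w * d = n * (d - k))%N.
  transitivity (\sum_(r <- rs) weight r)%N.
    rewrite (eq_big_seq (fun=> w)) ?big_const_seq ?count_predT ?sz //=.
    by rewrite iter_addn_0 mulnC.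
  transitivity (\sum_(r <- rs) \sum_(i < n | ~~ (`|autV (I i) r| < 1)%R) 1)%N.
    by apply: eq_bigr => r _; rewrite sum1dep_card.
  rewrite (exchange_big_dep xpredT) //= -[n in RHS]card_ord -sum_nat_const; apply: eq_bigr => i _.
  rewrite (big_aut _ (I i)) /=.
  rewrite (eq_bigl (fun r => ~~ (`|r| < 1))) => [|r]; last by rewrite autVK.
  by rewrite sum1_count -sz -countk -(count_predC (fun r => `|r| < 1) rs) addKn.
have n0 := conjugates_gt0.
have d0 : (0 < d)%N by exact: leq_trans kd.
have w0 : (0 < w)%N.
  by rewrite lt0n; apply: contraPneq wd => ->; rewrite mul0n => /esym/eqP; rewrite muln_eq0 subn_eq0 leqNgt kd gtn_eqF.
have wn : (w < n)%N.
  by rewrite -(ltn_pmul2r d0) wd ltn_pmul2l // ltn_subrL k0 d0.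
exists w; split=> //.
have prodr : `|\prod_(r <- rs) r| = `|(p`_0)%R|%N%:R / a.
  have : `|(p`_0)%:~R : algC| = a * `|\prod_(r <- rs) r|.
    rewrite -(coef_map (intr : int -> algC)) pE -horner_coef0 hornerZ horner_prod normrM (gtr0_norm a_gt0) !normr_prod.
    by congr (_ * _); apply: eq_bigr => i _; rewrite hornerXsubC sub0r normrN.
  by rewrite -intr_norm -abszE -pmulrn => ->; rewrite mulrC mulKf // gt_eqF.
have -> : `|\prod_i I i M| = \prod_(i < n) (a * \prod_(r <- rs | ~~ (`|autV (I i) r| < 1)) `|r|).
  rewrite normr_prod; apply: eq_bigr => i _.
  have -> : `|I i M| = `|I i m| by case: m_sign => ->; rewrite // rmorphN normrN.
  rewrite rmorphM /= rmorph_int normrM (gtr0_norm a_gt0) rmorph_prod normr_prod.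
  congr (_ * _); rewrite [RHS](big_aut _ (I i)) /=.
  by apply: eq_bigl => r; rewrite autVK.
rewrite big_split /= prodr_const card_ord (exchange_big_dep xpredT) //=.
have -> : \prod_(r <- rs) \prod_(i < n | ~~ (`|autV (I i) r| < 1)) `|r| = `|\prod_(r <- rs) r| ^+ w.
  rewrite normr_prod -prodrXl; apply: eq_big_seq => r rr.
  by rewrite prodr_const -(wE _ rr) /weight cardsE.
have aE : (`|lead_coef p|%N)%:R = a.
  by rewrite /a -{2}(@gtz0_abs (lead_coef p)) //; case: hf => [[]].
rewrite prodr natrM !natrX aE expr_div_n mulrCA mulrC; congr (_ * _).
by rewrite -{1}(subnK (ltnW wn)) exprD mulfK // expf_neq0 // gt_eqF.
Qed.

Lemma lead_coef_le_mahler : a <= M.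
Proof.
rewrite mahler_blocks; apply: ler_peMr; first exact: ltW.
by apply: (big_ind (fun u : algC => 1 <= u)) => // [u v|r _]; [exact: mulr_ege1 | exact: max1_ge1].
Qed.

Lemma coef0_le_mahler : `|(p`_0)%R|%N%:R <= M.
Proof.
rewrite mahler_blocks.
have -> : `|(p`_0)%R|%N%:R = `|(p`_0)%:~R| :> algC by rewrite -intr_norm -abszE -pmulrn.
rewrite coef0_blocks normrM (gtr0_norm a_gt0) ler_pM2l // normr_prod.
by apply: ler_prod => i _; rewrite normr_ge0 norm_le_max1.
Qed.

Lemma max1_block_le i : a * Num.max 1 `|(c i)`_0| <= M.
Proof.
rewrite mahler_blocks ler_pM2l // -block_first (bigD1 (first_index c i)) ?first_index_in //=.
rewrite ler_peMr ?(le_trans ler01 (max1_ge1 _)) //.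
by apply: (big_ind (fun u : algC => 1 <= u)) => // [u v|r _]; [exact: mulr_ege1 | exact: max1_ge1].
Qed.

Lemma a_ge1 : 1 <= a.
Proof. by rewrite /a ler1z; case: hf => [[]]. Qed.

Lemma coef0_block_le i : `|(c i)`_0| <= M.
Proof.
apply: le_trans (max1_block_le i); apply: le_trans (norm_le_max1 _) _.
by rewrite ler_peMl ?a_ge1 // (le_trans _ (max1_ge1 _)).
Qed.

(** The nonzero integer [p_0] has absolute value at least 1, and the factors other than [|c_i(0)|]
    contribute at most [M]. This keeps the number of dyadic sizes logarithmic. *)
Lemma coef0_block_ge i : 1 <= M * `|(c i)`_0|.
Proof.
have f1 : 1 <= `|(p`_0)%:~R : algC|.
  by rewrite norm_intr_ge1 ?intr_int // intr_eq0 coef0_neq0.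
apply: le_trans f1 _; rewrite coef0_blocks normrM gtr0_norm // mahler_blocks -mulrA ler_pM2l //.
rewrite -block_first (bigD1 (first_index c i)) ?first_index_in //= normrM normr_prod mulrC.
apply: ler_wpM2r; first exact: normr_ge0.
rewrite [leRHS](bigD1 (first_index c i)) ?first_index_in //=.
apply: (@le_trans _ _ (1 * \prod_(j in V | j != first_index c i) Num.max 1 `|(c j)`_0|)).
  by rewrite mul1r; apply: ler_prod => j _; rewrite normr_ge0 norm_le_max1.
apply: ler_wpM2r; last exact: max1_ge1.
by apply: prodr_ge0 => j _; apply: le_trans (max1_ge1 _).
Qed.

Lemma norm_coef_block_le i j : `|(c i)`_j| <= 2 ^+ d * Num.max 1 `|(c i)`_0|.
Proof.
rewrite max1_block_poly /c /block_poly -[\prod_(_ <- _ | _) _]big_filter -[X in _ <= _ * X]big_filter; apply: le_trans (norm_coef_prod_XsubC _ _) _.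
apply: ler_wpM2r; first by apply: prodr_ge0 => z _; apply: le_trans (max1_ge1 _).
rewrite ler_eXn2l ?ltr1n //; have <- : size rs = d by case: hf.
by rewrite size_filter count_size.
Qed.

(** An automorphism permutes the blocks, hence the factors, since [z] takes equal values at indices
    with equal blocks. Taking each block once, and not all of [I], matches the box whose volume is
    governed by [M] itself. *)
Lemma prod_blocks_rat z : inK M z -> (forall i, I (first_index c i) z = I i z) ->
  \prod_(i in V) I i z \in Crat.
Proof.
move=> Kz fz; apply: aut_fixed_rat => t; have [f injf ff] := representatives_perm repI t.
pose h i := first_index c (f i).
have cf i : c (f i) = map_poly t (c i).
  apply/polyP => j; rewrite coef_map !coef_block_poly /= ff //; exact: block_poly_inK.
have injh : {in V &, injective h}.
  move=> i j; rewrite !inE => /eqP iV /eqP jV /first_indexP; rewrite !cf => /map_poly_inj E.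
  by rewrite -iV -jV; apply/first_indexP.
have hV : h @: V = V.
  apply/eqP; rewrite eqEcard card_in_imset // leqnn andbT.
  by apply/fintype.subsetP => _ /imsetP[i _ ->]; exact: first_index_in.
rewrite rmorph_prod -[in RHS]hV big_imset //=; apply: eq_bigr => i _.
by rewrite ff // fz.
Qed.

End Cover.

(** A conjugate of [m] is [a] times the product of a subset of the roots. The count [2^d] bounds the
    degree of [K] in terms of [d] alone. *)
Lemma mahler_conjugates : exists2 l : seq algC, size l = (2 ^ d)%N & forall s : autC, s M \in l.
Proof.
have [e eE] : exists e : int, M = e%:~R * m.
  by case: m_sign => ->; [exists 1 | exists (-1)]; rewrite ?rmorphN1 ?mul1r ?mulN1r ?opprK.
pose val (b : d.-tuple bool) : algC := e%:~R * (a * \prod_(r <- mask b rs) r).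
exists (map val (enum {: d.-tuple bool})).
  by rewrite size_map -cardE card_tuple card_bool.
move=> s; have sz : size (map (fun r => ~~ (`|autV s r| < 1)) rs) == d.
  by rewrite size_map; case: hf => _ _ -> _ _.
apply/mapP; exists (Tuple sz); rewrite ?mem_enum //.
rewrite eE !rmorphM /= !rmorph_int rmorph_prod /val /= -filter_mask big_filter.
congr (_ * (_ * _)); rewrite [RHS](big_aut _ s) /=.
by apply: eq_bigl => r; rewrite autVK.
Qed.

End Blocks.

(** * The upper bound *)

Lemma vring_ge1 (z : algC) : z != 0 -> z \in Crat -> (forall q, prime q -> vring q z) -> 1 <= `|z|.
Proof. by move=> z0 rz hz; apply: norm_intr_ge1 => //; exact: Crat_vring_int. Qed.

(** * Separation of the coefficients of two blocks *)

Section Separation.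
Variables (k d : nat) (M x x' : algC) (p p' : {poly int}) (rs rs' : seq algC).
Hypotheses (k0 : (0 < k)%N) (kd : (k < d)%N).
Hypotheses (hf : factorization k d M x p rs) (hf' : factorization k d M x' p' rs').
Variables (n : nat) (I : 'I_n -> autC).
Hypothesis repI : representatives M I.
Let c i := block_poly rs (I i x).
Let c' i := block_poly rs' (I i x').
Let V := first_indices c.
Let a : algC := (lead_coef p)%:~R.
Hypothesis eq_index : forall i, first_index c' i = first_index c i.
Variable D : nat.

Variable j : nat.
Let z := (block_poly rs x)`_j - (block_poly rs' x')`_j.
Hypothesis z0 : z != 0.

Let zE i : I i z = (c i)`_j - (c' i)`_j.
Proof. by rewrite /z rmorphB /= -(coef_block_poly hf I) -(coef_block_poly hf' I). Qed.

Let x_rs : x \in rs.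
Proof. by case: (roots_orbit hf) => _ h; apply/h; exists idfun. Qed.
Let x_rs' : x' \in rs'.
Proof. by case: (roots_orbit hf') => _ h; apply/h; exists idfun. Qed.

Let Kz : inK M z.
Proof. by apply: inKB; [exact: (block_poly_inK k0 kd hf) | exact: (block_poly_inK k0 kd hf')]. Qed.

Let fz i : I (first_index c i) z = I i z.
Proof. by rewrite !zE -{2}eq_index /c' /c !(first_index_eq (fun i => block_poly _ (I i _))). Qed.

Let ratz : \prod_(i in V) I i z \in Crat.
Proof. exact: (prod_blocks_rat k0 kd hf repI Kz fz). Qed.

Let prodz0 : \prod_(i in V) I i z != 0.
Proof. by apply/prodf_neq0 => i _; rewrite fmorph_eq0. Qed.

Let a_gt0 : 0 < a.
Proof. by case: hf => [[_ _ _ _ h] _ _ _ _]; rewrite /a ltr0z. Qed.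

(** Both coefficients are integral multiples of the common content [kappa i], and [a] times the
    product of these contents is a unit at each prime; so [a] times the product of the [I i z] is a
    nonzero integer. *)
Lemma coef_separation (E : 'I_n -> nat) :
  (forall i q, prime q -> exists2 e, is_content (vring q) (c i) e & associate (vring q) (e^-1 ^+ D`!) (E i)%:R) ->
  (forall i q, prime q -> exists2 e, is_content (vring q) (c' i) e & associate (vring q) (e^-1 ^+ D`!) (E i)%:R) ->
  1 <= a * \prod_(i in V) `|I i z|.
Proof.
move=> hE hE'; rewrite -(gtr0_norm a_gt0) -normr_prod -normrM; apply: vring_ge1.
- by rewrite mulf_neq0 // gt_eqF.
- by rewrite rpredM // /a rpred_int.
move=> q q_pr; have vq := vringP q_pr; have hA : is_subring (vring q) by case: vq.
have [kappa [hk ass kf _]] := block_contents k0 kd hf repI q_pr.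
have k0' i : kappa i != 0 by case: (hk i).
(* The [D!]-th powers of the two contents are both recorded by [E i]; a value group has no torsion,
   so the contents are associate. *)
have hk' i : is_content (vring q) (c' i) (kappa i).
  have [e he1 he2] := hE i q q_pr; have [e' he1' he2'] := hE' i q q_pr.
  have [e0 _ _] := he1; have [e0' _ _] := he1'.
  apply: (content_assoc vq he1'); apply: (associate_trans vq _ (content_uniq vq he1 (hk i))).
  rewrite -[e']invrK -[e]invrK; apply: associateV.
  apply: (associateX_inv vq (fact_gt0 D)); rewrite ?invr_eq0 //.
  by apply: (associate_trans vq he2'); apply: associate_sym.
have -> : a * \prod_(i in V) I i z = (a * \prod_(i in V) kappa i) * \prod_(i in V) (I i z / kappa i).
  rewrite -mulrA -big_split /=; congr (_ * _); apply: eq_bigr => i _.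
  by rewrite mulrCA divff // mulr1.
apply: subringM => //; first by case: ass => _ _; rewrite divr1.
apply: subring_prod => // i _; rewrite zE mulrBl; apply: subringB => //.
  by case: (hk i) => _ + _; apply.
by case: (hk' i) => _ + _; apply.
Qed.

(** [c'_i(0) / c_i(0)] is a unit at every prime, so [I i z / c_i(0)] is integral; the product of the
    [c_i(0)] is [p_0 / a]. *)
Lemma coef0_separation (F : 'I_n -> nat) : j = 0%N ->
  (forall i q, prime q -> associate (vring q) ((a * (c i)`_0) ^+ D`!) (F i)%:R) ->
  (forall i q, prime q -> associate (vring q) ((a * (c' i)`_0) ^+ D`!) (F i)%:R) ->
  1 <= a / (`|(p`_0)%R|%N)%:R * \prod_(i in V) `|I i z|.
Proof.
move=> j0 hF hF'.
have c0 i : (c i)`_0 != 0 by exact: (coef0_block_neq0 k0 kd hf).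
have c0' i : (c' i)`_0 != 0 by exact: (coef0_block_neq0 k0 kd hf').
have p0 : (p`_0)%:~R != 0 :> algC by rewrite intr_eq0 (coef0_neq0 k0 kd hf repI).
have -> : (`|(p`_0)%R|%N)%:R = `|(p`_0)%:~R| :> algC by rewrite -intr_norm -abszE -pmulrn.
rewrite -{1}(gtr0_norm a_gt0) -normr_prod -normfV -!normrM; apply: vring_ge1.
- by rewrite !mulf_neq0 ?invr_eq0 // gt_eqF.
- by rewrite rpredM // rpred_div // /a rpred_int.
move=> q q_pr; have vq := vringP q_pr; have hA : is_subring (vring q) by case: vq.
have -> : a / (p`_0)%:~R * \prod_(i in V) I i z = \prod_(i in V) (I i z / (c i)`_0).
  rewrite big_split /= prodfV (coef0_blocks k0 kd hf repI) -/a -/V -/c mulrC; congr (_ * _).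
  by rewrite invfM mulrA divff ?mul1r // gt_eqF.
apply: subring_prod => // i _; rewrite zE j0 mulrBl divff //; apply: subringB => //; first exact: subring1.
have : associate (vring q) (a * (c' i)`_0) (a * (c i)`_0).
  apply: (associateX_inv vq (fact_gt0 D)); rewrite ?mulf_neq0 ?c0 ?c0' ?gt_eqF //.
  by apply: (associate_trans vq (hF' i q q_pr)); apply: associate_sym; exact: hF.
by case=> _ _ + _; rewrite -mulf_div divff ?gt_eqF // mul1r.
Qed.
End Separation.

(** * Counting the elements of a given Mahler measure *)

Section Count.
Variables (k d : nat) (M : algC) (N : nat).
Hypotheses (k0 : (0 < k)%N) (kd : (k < d)%N) (N0 : (0 < N)%N) (MN : M <= N%:R).
Variables (n : nat) (I : 'I_n -> autC).
Hypothesis repI : representatives M I.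
Variables (D : nat) (nD : (n <= D)%N).
Variables (p : algC -> {poly int}) (rs : algC -> seq algC).
Hypothesis hpr : forall y, height_class k d M y -> factorization k d M y (p y) (rs y).

Let base y := block_poly (rs y) y.
Let c y i := block_poly (rs y) (I i y).
Let phi y : {ffun 'I_n -> 'I_n} := [ffun i => first_index (c y) i].
Let classE i y (E : nat) := forall q, prime q ->
  exists2 e, is_content (vring q) (c y i) e & associate (vring q) (e^-1 ^+ D`!) E%:R.
Let classF i y (F : nat) := forall q, prime q ->
  associate (vring q) (((lead_coef (p y))%:~R * (c y i)`_0) ^+ D`!) F%:R.
(** The dyadic size of [|c_i(0)|], scaled by [N] so that the logarithm is taken of a number at least
    1. *)
Let level i y := trunc_log 2 (Num.truncn (N%:R * `|(c y i)`_0|)).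

Let d0 : (0 < d)%N. Proof. exact: leq_trans kd. Qed.
Let NR0 : 0 < N%:R :> algC. Proof. by rewrite ltr0n. Qed.

Section Signature.
Variables (al be : nat) (ph : {ffun 'I_n -> 'I_n}) (E F L : 'I_n -> nat).

(** The discrete data, few in number by the divisor bound, are fixed at once; what remains is
    geometry of numbers. *)
Let sig y := [/\ height_class k d M y, `|lead_coef (p y)|%N = al, `|((p y)`_0)%R|%N = be, phi y = ph
  & [/\ forall i, classE i y (E i), forall i, classF i y (F i) & forall i, level i y = L i]].

Let sig_lead y z : sig y -> sig z -> lead_coef (p y) = lead_coef (p z).
Proof.
move=> [/hpr[[_ _ _ _ py] _ _ _ _] Ey _ _ _] [/hpr[[_ _ _ _ pz] _ _ _ _] Ez _ _ _].
by rewrite -(gtz0_abs py) -(gtz0_abs pz) Ey Ez.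
Qed.

Let sig_index y z i : sig y -> sig z -> first_index (c y) i = first_index (c z) i.
Proof. by move=> [_ _ _ Ey _] [_ _ _ Ez _]; move: Ey; rewrite -Ez => /ffunP/(_ i); rewrite !ffunE. Qed.

Let sig_indices y z : sig y -> sig z -> first_indices (c y) = first_indices (c z).
Proof. by move=> sy sz; apply/setP => i; rewrite !inE (sig_index i sy sz). Qed.

Let sig_fact y : sig y -> factorization k d M y (p y) (rs y).
Proof. by case=> /hpr. Qed.

Let base_inK y j : sig y -> inK M (base y)`_j.
Proof.
move=> /sig_fact hy; apply: (block_poly_inK k0 kd hy).
by case: (roots_orbit hy) => _ h; apply/h; exists idfun.
Qed.

Let base_coef y i j : sig y -> I i (base y)`_j = (c y i)`_j.
Proof. by move=> /sig_fact hy; rewrite -(coef_block_poly hy I). Qed.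

Let indices_card y : sig y -> (0 < #|first_indices (c y)| <= d)%N.
Proof.
move=> /sig_fact hy; have E1 := card_blocks k0 kd hy repI; have b0 := block_size_gt0 hy.
rewrite -/(c y) in E1; apply/andP; split.
  by rewrite lt0n; apply: contraTneq d0 => V0; rewrite -E1 V0.
by rewrite -[leqRHS]E1 leq_pmulr.
Qed.

Let level_bounds i y : sig y -> (2 ^ level i y)%:R / N%:R <= `|(c y i)`_0| < (2 ^ (level i y).+1)%:R / N%:R.
Proof.
move=> /sig_fact hy; have h1 := coef0_block_ge k0 kd hy repI i; rewrite -/(c y i) in h1.
have h2 : 1 <= N%:R * `|(c y i)`_0|.
  by apply: le_trans h1 _; apply: ler_wpM2r.
have /andP[t1 t2] := truncn_itv (le_trans ler01 h2).
have tr1 : (0 < Num.truncn (N%:R * `|(c y i)`_0|)%R)%N by rewrite truncn_gt0.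
have /andP[l1 l2] := trunc_log_bounds (isT : (1 < 2)%N) tr1; rewrite -/(level i y) in l1 l2.
rewrite ler_pdivrMr // ltr_pdivlMr // mulrC; apply/andP; split.
  by apply: le_trans t1; rewrite ler_nat.
by apply: lt_le_trans t2 _; rewrite ler_nat.
Qed.

Let conj_perm : exists f : 'I_n -> 'I_n, forall i z, inK M z -> (I i z)^* = I (f i) z.
Proof. by have [f _ hf] := representatives_perm repI (Num.conj : autC); exists f. Qed.

(** The sides [2^(L i + 1) / N] are at most twice [|c_i(0)|], and the product of the [|c_i(0)|] is
    [|p_0| / a]; with the separation constant [a / |p_0|] the volume is at most [2^d]. *)
Lemma count_coef0 : bounded (fun v => exists2 y, sig y & v = (base y)`_0) (24 ^ d * 2 ^ d).
Proof.
apply: bounded_empty => -[_ [y0 s0 _]].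
have [f hconj] := conj_perm.
have /andP[V0 Vd] := indices_card s0.
have hy0 := sig_fact s0.
pose V := first_indices (c y0).
pose Li i : algC := (2 ^ (L i).+1)%:R / N%:R.
have LE i : level i y0 = L i by case: s0 => _ _ _ _ [].
have be0 : (0 < be)%N by case: s0 => _ _ <- _ _; rewrite absz_gt0 (coef0_neq0 k0 kd hy0 repI).
apply: (@bounded_le _ _ (24 ^ #|V| * 2 ^ d)); first by rewrite leq_mul2r leq_pexp2l ?orbT.
apply: (@packing _ I V (first_index (c y0)) f Li (al%:R / be%:R)) => //.
- by rewrite expn_gt0.
- by move=> i; rewrite divr_gt0 // ltr0n expn_gt0.
- exact: first_index_in.
- move=> i; rewrite /Li -!LE (_ : level (first_index (c y0) i) y0 = level i y0) //.
  by rewrite /level (first_index_eq (c y0)).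
- move=> i; rewrite /Li -!LE /level -!(base_coef _ _ s0) -hconj ?norm_conjC //; exact: base_inK.
- move=> _ i [y sy ->]; rewrite !(base_coef _ _ sy) -(sig_index i sy s0).
  by rewrite (first_index_eq (c y)).
- by move=> _ i [y sy ->]; rewrite hconj //; exact: base_inK.
- move=> _ i [y sy ->]; rewrite (base_coef _ _ sy) /Li.
  have <- : level i y = L i by case: sy => _ _ _ _ [].
  by have /andP[_ /ltW] := level_bounds i sy.
- apply: (@le_trans _ _ (al%:R / be%:R * \prod_(i in V) (2 * `|(c y0 i)`_0|))).
    apply: ler_wpM2l; first by rewrite divr_ge0.
    apply: ler_prod => i _; rewrite divr_ge0 //=.
    have /andP[+ _] := level_bounds i s0; rewrite LE /Li expnS natrM -mulrA => h.
    by rewrite ler_pM2l ?ltr0n.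
  have -> : be%:R = `|((p y0)`_0)%:~R| :> algC.
    by case: s0 => _ _ <- _ _; rewrite -intr_norm -abszE -pmulrn.
  have aE : al%:R = (lead_coef (p y0))%:~R :> algC.
    case: s0 => _ <- _ _ _; rewrite -{2}(@gtz0_abs (lead_coef (p y0))) //.
    by case: hy0 => [[]].
  have al0 : 0 < al%:R :> algC.
    by rewrite aE ltr0z; case: hy0 => [[]].
  rewrite (coef0_blocks k0 kd hy0 repI) -aE normrM (gtr0_norm al0) normr_prod -/(c y0) -/V.
  rewrite big_split /= prodr_const -natrX.
  have P0 : \prod_(i in V) `|(c y0 i)`_0| != 0.
    by apply/prodf_neq0 => i _; rewrite normr_eq0 (coef0_block_neq0 k0 kd hy0).
  rewrite [leLHS](_ : _ = (2 ^ #|V|)%:R); last by rewrite invfM; field; rewrite P0 gt_eqF.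
  by rewrite ler_nat leq_pexp2l.
move=> _ _ [y sy ->] [y' sy' ->] neq.
have := coef0_separation k0 kd (sig_fact sy) (sig_fact sy') repI
  (fun i => sig_index i sy' sy) (D := D) (j := 0%N).
rewrite subr_eq0 => /(_ neq F erefl); rewrite /V (sig_indices s0 sy).
have el := sig_lead sy' sy; have [_ _ _ _ [_ hF' _]] := sy'; rewrite /classF el in hF'.
have [_ _ _ _ [_ hF _]] := sy; rewrite /classF in hF.
have aE : (lead_coef (p y))%:~R = al%:R :> algC.
  case: (sy) => _ <- _ _ _; rewrite -{1}(@gtz0_abs (lead_coef (p y))) //.
  by case: (sig_fact sy) => [[]].
have -> : `|((p y)`_0)%R|%N = be by case: sy.
by rewrite -aE; apply.
Qed.

(** With the constant coefficient fixed, [2^d max(1, |c_i(0)|)] bounds the other coefficients, and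
    these maxima times [a] multiply to [M]. With the separation constant [a] the volume is at most
    [2^(d d) N]. *)
Lemma count_coef v0 j : bounded (fun v => exists2 y, sig y & (base y)`_0 = v0 /\ v = (base y)`_j)
  (24 ^ d * (2 ^ (d * d) * N)).
Proof.
apply: bounded_empty => -[_ [y0 s0 [v0E _]]].
have [f hconj] := conj_perm.
have /andP[V0 Vd] := indices_card s0.
have hy0 := sig_fact s0.
pose V := first_indices (c y0).
have aE y : sig y -> (lead_coef (p y))%:~R = al%:R :> algC.
  move=> sy; case: (sy) => _ <- _ _ _; rewrite -{1}(@gtz0_abs (lead_coef (p y))) //.
  by case: (sig_fact sy) => [[]].
pose Li i : algC := 2 ^+ d * Num.max 1 `|I i v0|.
apply: (@bounded_le _ _ (24 ^ #|V| * (2 ^ (d * d) * N))).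
  by rewrite leq_mul2r leq_pexp2l ?orbT.
apply: (@packing _ I V (first_index (c y0)) f Li al%:R) => //.
- by rewrite muln_gt0 expn_gt0.
- by move=> i; rewrite mulr_gt0 ?exprn_gt0 ?ltr0n // (lt_le_trans _ (max1_ge1 _)) ?ltr01.
- exact: first_index_in.
- move=> i; rewrite /Li -v0E !(base_coef _ _ s0).
  by rewrite (first_index_eq (c y0)).
- move=> i; rewrite /Li -v0E -hconj ?norm_conjC //; exact: base_inK.
- move=> _ i [y sy [_ ->]]; rewrite !(base_coef _ _ sy) -(sig_index i sy s0).
  by rewrite (first_index_eq (c y)).
- by move=> _ i [y sy [_ ->]]; rewrite hconj //; exact: base_inK.
- move=> _ i [y sy [E0 ->]]; rewrite /Li -E0 !(base_coef _ _ sy).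
  exact: (norm_coef_block_le (sig_fact sy)).
- rewrite /Li big_split /= prodr_const -exprM mulrCA natrM natrX.
  have -> : al%:R * \prod_(i in V) Num.max 1 `|I i v0| = M.
    rewrite [RHS](mahler_blocks k0 kd hy0 repI) aE //; congr (_ * _).
    by apply: eq_bigr => i _; rewrite -v0E (base_coef _ _ s0).
  have M0 : 0 <= M.
    by apply: le_trans (le_trans ler01 (a_ge1 hy0)) (lead_coef_le_mahler k0 kd hy0 repI).
  apply: ler_pM => //; by rewrite ler_eXn2l ?ltr1n // leq_mul2l Vd orbT.
move=> _ _ [y sy [_ ->]] [y' sy' [_ ->]] neq.
have := coef_separation k0 kd (sig_fact sy) (sig_fact sy') repI
  (fun i => sig_index i sy' sy) (D := D) (j := j).
rewrite subr_eq0 => /(_ neq E); rewrite /V (sig_indices s0 sy) aE //; apply.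
  by case: sy => _ _ _ _ [].
by case: sy' => _ _ _ _ [].
Qed.

Let g := gcdn k d.

(** The block of [y] is monic of degree at most [g], so its coefficients at 0 and at [1, ..., g - 1]
    determine it; the last factor [d] counts the conjugates among which [y] lies. *)
Lemma count_signature :
  bounded sig ((24 ^ d * 2 ^ d) * ((24 ^ d * (2 ^ (d * d) * N)) ^ (g - 1) * d)).
Proof.
apply: (bounded_fiber (Q := fun v => exists2 y, sig y & v = (base y)`_0) (R := fun y v => (base y)`_0 = v)).
- by move=> y sy; exists (base y)`_0 => //; exists y.
- exact: count_coef0.
move=> v0 _; rewrite -[(g - 1)%N](size_iota 1).
apply: (bounded_family (0 : algC) (Q := fun j v => exists2 y, sig y & (base y)`_0 = v0 /\ v = (base y)`_j)
   (R := fun j y v => (base y)`_j = v)).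
- exact: iota_uniq.
- by move=> j y _ [sy E0]; exists (base y)`_j => //; exists y.
- by move=> j _; exact: count_coef.
move=> v _; apply: bounded_empty => -[y0 [[s0 e0] h0]].
have hy0 := sig_fact s0; have sz0 : size (rs y0) = d by case: hy0.
rewrite -sz0; apply: bounded_seq => y [[sy ey] hy].
have hfy := sig_fact sy.
have g0 : (0 < g)%N by rewrite gcdn_gt0 k0.
(* The signature fixes the number of blocks, which times the block size is [d]. *)
have bE : size (base y) = size (base y0).
  rewrite /base !size_block_poly; congr _.+1; apply/eqP.
  have /andP[V0 _] := indices_card s0; rewrite -(eqn_pmul2l V0).
  rewrite -{1}(sig_indices sy s0).
  by rewrite (card_blocks k0 kd hfy repI) (card_blocks k0 kd hy0 repI).
have bg : (size (base y) <= g.+1)%N.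
  rewrite /base size_block_poly ltnS; apply: dvdn_leq => //.
  exact: (block_size_dvd_gcd k0 kd hfy repI).
have E1 : base y = base y0.
  apply/polyP => j; case: (posnP j) => [->|j0]; first by rewrite ey e0.
  have [jg|gj] := ltnP j g.
    have ji : j \in iota 1 (g - 1) by rewrite mem_iota j0 subnKC.
    by rewrite hy // h0.
  have [jb|bj] := ltnP j (size (base y)); last by rewrite !nth_default // -bE.
  (* As the degree is at most [g], an index [j >= g] in range is the degree itself, where both
     blocks have coefficient 1. *)
  have jE : j = (size (base y)).-1 by lia.
  rewrite {1}jE jE -/(lead_coef (base y)) bE -/(lead_coef (base y0)).
  by rewrite !(monicP (block_poly_monic _ _)).
have yr : y \in rs y by case: (roots_orbit hfy) => _ h; apply/h; exists idfun.
have : root (base y) y by rewrite root_block_poly yr near_refl.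
by rewrite E1 root_block_poly => /andP[].
Qed.

End Signature.
(** The exponent covers all the integers whose divisors are counted: the norm of [M], at most [N^n],
    the powers [al^D!] and [(al be)^D!], and [2^level <= N^2]. *)
Let X := max_divisors (D + 2 * D`!) N.

Lemma count_height_class_aux : bounded (height_class k d M)
  (X * (X * (n ^ n * (X ^ n * (X ^ n * (X ^ n *
    ((24 ^ d * 2 ^ d) * ((24 ^ d * (2 ^ (d * d) * N)) ^ (gcdn k d - 1) * d)))))))).
Proof.
apply: bounded_empty => -[y0 hy0].
have f0 := hpr hy0.
(* The norm of [M] up to sign. It depends on [M] only, so its divisors contain the leading and
   constant coefficients of all candidates. *)
pose K := Num.truncn `|\prod_i I i M|.
have KE y : height_class k d M y -> exists w, [/\ (0 < w)%N, (w < n)%N &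
    K = (`|lead_coef (p y)| ^ (n - w) * `|((p y)`_0)%R| ^ w)%N].
  move=> /hpr hy; have [w [w0 wn E]] := conjugates_prod k0 kd hy repI.
  by exists w; split=> //; rewrite /K E natrK.
have M0 : 0 <= M.
  by apply: le_trans (le_trans ler01 (a_ge1 f0)) (lead_coef_le_mahler k0 kd f0 repI).
have leadN y : height_class k d M y -> (0 < `|lead_coef (p y)| <= N)%N.
  move=> /hpr hy; have h1 := a_ge1 hy; have h2 := le_trans (lead_coef_le_mahler k0 kd hy repI) MN.
  have l0 : 0 < lead_coef (p y) by case: hy => [[]].
  move: h2; rewrite -{1}(gtz0_abs l0) -pmulrn ler_nat => ->.
  by rewrite absz_gt0 gt_eqF.
have coefN y : height_class k d M y -> (0 < `|((p y)`_0)%R| <= N)%N.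
  move=> /hpr hy; rewrite absz_gt0 (coef0_neq0 k0 kd hy repI).
  by have := le_trans (coef0_le_mahler k0 kd hy repI) MN; rewrite ler_nat.
have K0 : (0 < K)%N.
  have [w [_ _ ->]] := KE y0 hy0; have /andP[l0 _] := leadN _ hy0; have /andP[c0 _] := coefN _ hy0.
  by rewrite muln_gt0 !expn_gt0 l0 c0.
have KN : (K <= N ^ n)%N.
  rewrite -(ler_nat algC) natrX; apply: (@le_trans _ _ `|\prod_i I i M|).
    by rewrite truncn_le normr_ge0.
  rewrite normr_prod -[n in leRHS]card_ord -prodr_const; apply: ler_prod => i _.
  by rewrite normr_ge0 (le_trans (norm_aut_mahler_le f0 (I i))).
have fact1 : (0 < D`!)%N := fact_gt0 D.
have divX m : (0 < m)%N -> (m <= N ^ (D + 2 * D`!))%N -> (size (divisors m) <= X)%N.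
  exact: leq_max_divisors.
have powN u v : (u <= N ^ v)%N -> (v <= D + 2 * D`!)%N -> (u <= N ^ (D + 2 * D`!))%N.
  by move=> uv vD; apply: leq_trans uv _; rewrite leq_pexp2l.
have bdiv m : (0 < m)%N -> (m <= N ^ (D + 2 * D`!))%N -> bounded (fun u => (u %| m)%N) X.
  by move=> m0 mN; apply: bounded_le (divX m m0 mN) _; exact: dvdn_bounded.
have bK : bounded (fun u => (u %| K)%N) X.
  by apply: bdiv => //; apply: powN KN _; apply: leq_trans nD (leq_addr _ _).
apply: (bounded_fiber (Q := fun u => (u %| K)%N) (R := fun y u => `|lead_coef (p y)|%N = u)) => //.
  move=> y hy; exists `|lead_coef (p y)|%N => //; have [w [_ wn ->]] := KE y hy.
  by rewrite dvdn_mulr // dvdn_exp // subn_gt0.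
move=> al _; apply: (bounded_fiber (Q := fun u => (u %| K)%N) (R := fun y u => `|((p y)`_0)%R|%N = u)) => //.
  move=> y [hy _]; exists `|((p y)`_0)%R|%N => //; have [w [w0 _ ->]] := KE y hy.
  by rewrite dvdn_mull // dvdn_exp.
move=> be _; apply: bounded_empty => -[y1 [[hy1 alE] beE]].
have /andP[al0 alN] : (0 < al <= N)%N by rewrite -alE; exact: leadN.
have /andP[be0 beN] : (0 < be <= N)%N by rewrite -beE; exact: coefN.
apply: (bounded_fiber (Q := fun _ : {ffun 'I_n -> 'I_n} => True) (R := fun y u => phi y = u)).
- by move=> y _; exists (phi y).
- by rewrite -[X in bounded _ X](_ : #|{ffun 'I_n -> 'I_n}| = n ^ n)%N; [exact: bounded_fin | rewrite card_ffun !card_ord].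
move=> ph _.
apply: (bounded_ord_family 0%N (Q := fun _ u => (u %| al ^ D`!)%N) (R := classE)).
- move=> i y [[[hy yal] _] _].
  by have [E EN hE] := content_class k0 kd (hpr hy) repI i nD; exists E; rewrite -?yal.
- move=> i; apply: bdiv; first by rewrite expn_gt0 al0.
  by apply: (@powN _ D`!); [exact: leq_pow2r | lia].
move=> E.
apply: (bounded_ord_family 0%N (Q := fun _ u => (u %| (al * be) ^ D`!)%N) (R := classF)).
- move=> i y [[[[hy yal] ybe] _] _].
  by have [F FN hF] := coef0_class k0 kd (hpr hy) repI i nD; exists F; rewrite -?yal -?ybe.
- move=> i; apply: bdiv; first by rewrite expn_gt0 muln_gt0 al0 be0.
  apply: (@powN _ (2 * D`!)); last by lia.
  by rewrite expnM; apply: leq_pow2r; rewrite expnS expn1 leq_mul.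
move=> F.
apply: (bounded_ord_family 0%N (Q := fun _ u => (u < X)%N) (R := fun i y u => level i y = u)).
- move=> i y [[[[[hy _] _] _] _] _]; exists (level i y) => //.
  have t0 : (0 < Num.truncn (N%:R * `|(c y i)`_0|)%R)%N.
    rewrite truncn_gt0; apply: le_trans (coef0_block_ge k0 kd (hpr hy) repI i) _.
    by apply: ler_wpM2r.
  have /andP[lv _] := trunc_log_bounds (isT : (1 < 2)%N) t0; rewrite -/(level i y) in lv.
  have lvN : (2 ^ level i y <= N ^ 2)%N.
    apply: leq_trans lv _; rewrite -(ler_nat algC); apply: le_trans (_ : _ <= N%:R * `|(c y i)`_0|) _.
      by rewrite truncn_le mulr_ge0.
    rewrite natrX expr2; apply: ler_wpM2l => //.
    exact: le_trans (coef0_block_le k0 kd (hpr hy) repI i) MN.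
  (* The powers [2^0, ..., 2^level] divide [2^level], so the divisor bound also limits the level. *)
  have : (size (divisors (2 ^ level i y)) <= X)%N.
    by apply: divX; [rewrite expn_gt0 | apply: powN lvN _; lia].
  apply: leq_trans; rewrite -[X in (X <= _)%N](size_iota 0) -(size_map (expn 2)).
  apply: uniq_leq_size; first by rewrite map_inj_uniq ?iota_uniq //; apply: expnI.
  move=> z /mapP[u]; rewrite mem_iota => /= ul ->.
  by rewrite -dvdn_divisors ?expn_gt0 // dvdn_exp2l.
- by move=> i; exact: bounded_ltn.
move=> L; apply: bounded_sub (count_signature (al := al) (be := be) (ph := ph) (E := E) (F := F) (L := L)).
by move=> y [[[[[[hy hal] hbe] hph] hE] hF] hL].
Qed.

End Count.

Lemma count_height_class (k d : nat) : (0 < k)%N -> (k < d)%N ->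
  exists m j C, forall (M : algC) N, (0 < N)%N -> M <= N%:R ->
  bounded (height_class k d M) (C * max_divisors m N ^ j * N ^ (gcdn k d - 1)).
Proof.
(* [M] has at most [2^d] conjugates, so this [D], which depends on [d] alone, bounds the number of
   representatives. *)
move=> k0 kd; pose D := ((2 ^ d) ^ (2 ^ d))%N; pose g := (gcdn k d - 1)%N.
exists (D + 2 * D`!)%N, (2 + 3 * D)%N, (D ^ D * ((24 ^ d * 2 ^ d) * ((24 ^ d * 2 ^ (d * d)) ^ g * d)))%N.
move=> M N N0 MN; apply: bounded_empty => -[y0 [p0 [rs0 hy0]]].
have /choice[p] : forall y, exists p, height_class k d M y -> exists rs, factorization k d M y p rs.
  move=> y; have [[p hp]|h] := pselect (height_class k d M y); first by exists p.
  by exists 0 => /h.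
move=> hp; have /choice[rs hpr] : forall y, exists rs, height_class k d M y -> factorization k d M y (p y) rs.
  move=> y; have [/hp[rs h]|h] := pselect (height_class k d M y); first by exists rs.
  by exists [::] => /h.
have [T uT hT] := orbit_exists M.
have [l sl hl] := mahler_conjugates hy0.
have sT : (size T <= 2 ^ d)%N.
  by rewrite -sl; apply: uniq_leq_size => // _ /hT[t ->].
have [||n [I [nT repI]]] := @representatives_exist M T uT.
- by move=> t; apply/hT; exists t.
- by move=> y /hT.
have nD : (n <= D)%N.
  apply: leq_trans nT _; apply: leq_trans (leq_pow2r _ sT) _.
  by rewrite leq_pexp2l // expn_gt0.
apply: bounded_le (count_height_class_aux k0 kd N0 MN repI nD hpr).
set X := max_divisors _ _; have X0 : (0 < X)%N by exact: max_divisors_gt0.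
rewrite -/g.
have -> : (X * (X * (n ^ n * (X ^ n * (X ^ n * (X ^ n *
    (24 ^ d * 2 ^ d * ((24 ^ d * (2 ^ (d * d) * N)) ^ g * d))))))) =
  n ^ n * (24 ^ d * 2 ^ d * ((24 ^ d * 2 ^ (d * d)) ^ g * d)) * X ^ (2 + 3 * n) * N ^ g)%N.
  have -> : (X ^ (2 + 3 * n) = X * X * (X ^ n * X ^ n * X ^ n))%N.
    rewrite expnD [(3 * n)%N]mulnC expnM; move: (X ^ n)%N => u.
    by rewrite !expnS !expn0 !muln1 !mulnA.
  have -> : ((24 ^ d * (2 ^ (d * d) * N)) ^ g = (24 ^ d * 2 ^ (d * d)) ^ g * N ^ g)%N.
    by rewrite mulnA expnMn.
  move: (X ^ n)%N (n ^ n)%N (24 ^ d * 2 ^ d)%N ((24 ^ d * 2 ^ (d * d)) ^ g)%N (N ^ g)%N => u v w z t.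
  by ring.
rewrite leq_mul2r; apply/orP; right; apply: leq_mul; last by rewrite leq_pexp2l //; lia.
rewrite leq_mul2r; apply/orP; right; apply: leq_trans (leq_pow2r n nD) _.
by rewrite leq_pexp2l // expn_gt0 expn_gt0.
Qed.

(** In the [e]-th power the divisor factor costs a single [N], whatever [e] is; this is the form in
    which [M^o(1)] reaches the limit. *)
Lemma card_height_class_le (k d : nat) : (0 < k)%N -> (k < d)%N -> forall e, exists C, forall (M : algC) N,
  (0 < N)%N -> M <= N%:R -> forall s : seq algC, uniq s -> (forall y, y \in s -> height_class k d M y) ->
  (size s ^ e <= C * N ^ (e * (gcdn k d - 1) + 1))%N.
Proof.
move=> k0 kd e; have [m [j [C hC]]] := count_height_class k0 kd.
have [C' hC'] := subpolynomialX j (max_divisors_subpolynomial m) e.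
exists (C ^ e * C')%N => M N N0 MN s us hs.
apply: leq_trans (leq_pow2r e (hC M N N0 MN s us hs)) _.
rewrite !expnMn -!mulnA leq_mul2l; apply/orP; right.
rewrite expnD expn1 [(e * _)%N]mulnC expnM [X in (_ <= C' * X)%N]mulnC mulnA leq_mul2r; apply/orP; right.
exact: hC'.
Qed.

(** * The lower bound *)

Section Independence.
Variables (p : nat) (A : set algC) (vA : valuation_ring p A) (p_pr : prime p).
Let hA : is_subring A. Proof. by case: vA. Qed.

Lemma valuation_max (s : seq algC) : s != [::] -> {in s, forall y, y != 0} ->
  exists2 x, x \in s & {in s, forall y, A (y / x)}.
Proof.
elim: s => // x [|y s] IH _ s0.
  by exists x; rewrite ?mem_head // => z; rewrite inE => /eqP ->; rewrite divff ?s0 ?mem_head //; exact: (subring1 hA).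
have [||z zs hz] := IH; [by []|by move=> w ws; apply: s0; rewrite in_cons ws orbT|].
have x0 : x != 0 by rewrite s0 ?mem_head.
have z0 : z != 0 by rewrite s0 // in_cons zs orbT.
have [h|h] := valuation_total vA x0 z0.
  by exists z; [rewrite in_cons zs orbT | move=> w; rewrite in_cons => /orP[/eqP->|/hz]].
exists x; rewrite ?mem_head // => w; rewrite in_cons => /orP[/eqP->|/hz hw].
  by rewrite divff //; exact: (subring1 hA).
rewrite (_ : w / x = (w / z) * (z / x)); first exact: (subringM hA).
by rewrite mulrA divfK.
Qed.

(* Terms whose valuations are distinct modulo 1 cannot cancel. *)
Lemma valuation_independent (J : finType) (z : J -> int) (y : J -> algC) (m : J -> nat) d :
  (0 < d)%N -> (forall j, associate A (y j ^+ d) (p%:R ^+ m j)) ->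
  (forall i j, m i = m j %[mod d] -> i = j) ->
  \sum_j (z j)%:~R * y j = 0 -> forall j, z j = 0.
Proof.
move=> d0 hy hm s0 j; apply/eqP; apply: contraT => zj.
pose w i := (z i)%:~R * y i.
have y0 i : y i != 0 by have [] := hy i; rewrite expf_eq0 d0.
have w0 i : (w i == 0) = (z i == 0) by rewrite mulf_eq0 intr_eq0 (negPf (y0 i)) orbF.
have [||x] := @valuation_max [seq w i | i <- enum J & z i != 0].
- have : j \in [seq i <- enum J | z i != 0] by rewrite mem_filter zj mem_enum.
  by case: [seq i <- enum J | _].
- by move=> _ /mapP[i + ->]; rewrite mem_filter w0 => /andP[].
case/mapP=> i; rewrite mem_filter => /andP[zi _] -> hmax.
have wi0 : w i != 0 by rewrite w0.
have Aw l : A (w l / w i).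
  have [zl|zl] := eqVneq (z l) 0; first by rewrite /w zl !mul0r; exact: (subring0 hA).
  by apply: hmax; apply: map_f; rewrite mem_filter zl mem_enum.
have sum1 : \sum_l w l / w i = 0 by rewrite -mulr_suml s0 mul0r.
have [l li [wl Al]] : exists2 l, l != i & w l / w i != 0 /\ A (w l / w i)^-1.
  apply: contrapT => nex; apply: (nonunit1 vA).
  have -> : 1 = - \sum_(l | l != i) w l / w i.
    by have := sum1; rewrite (bigD1 i) //= divff // => /eqP; rewrite addr_eq0 => /eqP.
  apply: (nonunitN1 vA); apply: (nonunit_sum vA) => l li; apply: contrapT => /nonunitN h.
  by apply: nex; exists l.
have {}wl : w l != 0 by move: wl; rewrite mulf_eq0 negb_or => /andP[].
have zl : z l != 0 by rewrite -w0.
have ass : associate A (w l) (w i) by split=> //; rewrite -invf_div.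
have expw u : z u != 0 -> associate A (w u ^+ d) (p%:R ^+ (logn p `|z u| * d + m u)).
  move=> zu; rewrite /w exprMn exprD exprM; apply: (associateM vA) (hy u).
  by apply: (associateX vA); exact: (associate_int vA p_pr).
have E : (logn p `|z l| * d + m l = logn p `|z i| * d + m i)%N.
  apply: (powp_inj vA p_pr); apply: (associate_trans vA) (expw i zi).
  by apply: (associate_trans vA) (associateX vA d ass); apply: associate_sym; exact: expw.
by move: li; rewrite (hm l i) ?eqxx // -(modnMDl (logn p `|z l|)) E modnMDl.
Qed.
End Independence.

(* [al] has valuation [1 / d], hence degree at least [d]. *)
Lemma eisenstein_minimal (p : nat) (al : algC) d (Q : {poly int}) : prime p -> (0 < d)%N ->
  associate (vring p) (al ^+ d) p%:R -> Q != 0 -> root (polyZ Q) al -> (d < size Q)%N.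
Proof.
move=> p_pr d0 hal Q0 /eqP Qal; rewrite ltnNge; apply/negP => sQ.
have vp := vringP p_pr.
case/eqP: Q0; apply/polyP => i; rewrite coef0; case: (ltnP i d) => [id|di]; last first.
  by rewrite nth_default // (leq_trans sQ).
have := @valuation_independent p (vring p) vp p_pr _ (fun j : 'I_d => Q`_j) (fun j => al ^+ j) (fun j => j) d d0.
move=> h; apply: (h _ _ _ (Ordinal id)).
- by move=> j; rewrite exprAC; apply: (associateX vp).
- by move=> u v; rewrite !modn_small // => /val_inj.
rewrite -[RHS]Qal (horner_coef_wide _ (n := d)) ?size_map_inj_poly //; last exact: intr_inj.
by apply: eq_bigr => j _; rewrite coef_map.
Qed.

(** * Trinomials with prescribed numbers of tiny and huge roots *)

Section Dominance.
Variables (delta : algC) (delta0 : 0 < delta).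

(** An archimedean Newton polygon: a tiny root acts as [X] and a huge one as the constant [- r], so
    the coefficient whose index is the number of tiny roots dominates. Each root costs a factor 4.
    This lets roots in the disc be counted from coefficients. *)
Lemma coef_dominance (s : seq algC) : {in s, forall r, `|r| <= delta \/ delta^-1 <= `|r|} ->
  4 ^+ size s * delta <= 1 ->
  let P := \prod_(r <- s) ('X - r%:P) in let j := count (fun r => `|r| < 1) s in
  P`_j != 0 /\ forall i, i != j -> `|P`_i| <= 4 ^+ size s * delta * `|P`_j|.
Proof.
elim: s => [_ _|r s IH hs small] /=.
  rewrite big_nil coef1 oner_eq0; split=> // i i0.
  by rewrite !coef1 (negPf i0) normr0 mulr_ge0 // ltW // mulr_gt0 ?exprn_gt0 ?ltr0n.
set e := 4 ^+ size s * delta in IH.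
have e0 : 0 < e by rewrite mulr_gt0 ?exprn_gt0 ?ltr0n.
have e4 : 4 * e <= 1 by rewrite /e mulrA -exprS.
have e1 : e <= 1 by apply: le_trans e4; rewrite ler_peMl ?ler1n // ltW.
have de : delta <= e by rewrite ler_peMl ?(ltW delta0) // exprn_ege1 // ler1n.
have [|//|Pj hP] := IH; first by move=> z zs; apply: hs; rewrite inE zs orbT.
rewrite !big_cons (_ : 4 ^+ (size s).+1 * delta = 4 * e); last by rewrite /e mulrA -exprS.
set P := \prod_(z <- s) _ in Pj hP *; set j := count _ s in Pj hP *.
have nPj : 0 < `|P`_j| by rewrite normr_gt0.
have coefP i : (('X - r%:P) * P)`_i = (if i is i'.+1 then P`_i' else 0) - r * P`_i.
  by rewrite mulrBl coefB coefXM coefCM; case: i.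
have le1 i : `|P`_i| <= `|P`_j|.
  have [->//|/hP h] := eqVneq i j; apply: le_trans h _.
  by rewrite ler_piMl // ltW.
have shift i : i != j.+1 -> `|if i is i'.+1 then P`_i' else 0| <= e * `|P`_j|.
  case: i => [|i] ij; last by apply: hP; apply: contraNneq ij => ->.
  by rewrite normr0 mulr_ge0 // ltW.
have shift1 i : `|if i is i'.+1 then P`_i' else 0| <= `|P`_j|.
  by case: i => [|i]; [rewrite normr0 ltW | exact: le1].
have [rd|rd] := hs r (mem_head _ _).
  have r1 : `|r| < 1.
    apply: le_lt_trans rd _; apply: le_lt_trans de _; apply: lt_le_trans e4.
    by rewrite ltr_pMl // ltr1n.
  rewrite r1 add1n.
  (* The dominant coefficient keeps at least 3/4 of its size, and any other is at most [2 e] times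
     the old dominant one: the ratio [8 e / 3] is below [4 e]. *)
  have big : 3 * `|P`_j| <= 4 * `|(('X - r%:P) * P)`_j.+1|.
    rewrite coefP; have h : `|P`_j| - `|r * P`_j.+1| <= `|P`_j - r * P`_j.+1| by exact: lerB_dist.
    have h2 : `|r * P`_j.+1| <= delta * `|P`_j|.
      by rewrite normrM; apply: ler_pM.
    have h3 : 4 * `|r * P`_j.+1| <= `|P`_j|.
      apply: le_trans (_ : _ <= 4 * (delta * `|P`_j|)) _; first by rewrite ler_pM2l ?ltr0n.
      rewrite mulrA ler_piMl ?(ltW nPj) //; apply: le_trans e4; by rewrite ler_pM2l ?ltr0n.
    apply: le_trans (_ : _ <= 4 * (`|P`_j| - `|r * P`_j.+1|)) _; last by rewrite ler_pM2l ?ltr0n.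
    rewrite mulrBr -subr_ge0; have -> : 4 * `|P`_j| - 4 * `|r * P`_j.+1| - 3 * `|P`_j| = `|P`_j| - 4 * `|r * P`_j.+1| by ring.
    by rewrite subr_ge0.
  split.
    by rewrite -normr_gt0 -(pmulr_rgt0 _ (ltr0n algC 4)); apply: lt_le_trans big; rewrite mulr_gt0 ?ltr0n.
  move=> i ij; rewrite coefP; apply: le_trans (ler_normB _ _) _.
  apply: le_trans (_ : _ <= e * `|P`_j| + e * `|P`_j|) _.
    apply: lerD; first exact: shift.
    by rewrite normrM; apply: ler_pM => //; exact: le_trans rd de.
  have -> : e * `|P`_j| + e * `|P`_j| = e * (2 * `|P`_j|) by ring.
  rewrite [4 * e]mulrC -[leRHS]mulrA; apply: ler_wpM2l; first exact: ltW.
  by apply: le_trans big; rewrite ler_pM2r // ler_nat.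
have r1 : 1 <= `|r|.
  by apply: le_trans rd; rewrite invr_ge1 ?unitf_gt0 // (le_trans de).
have r0 : 0 < `|r| by apply: lt_le_trans r1.
rewrite (le_gtF r1) add0n.
have inv1 : 1 <= e * `|r|.
  rewrite -(mulfV (lt0r_neq0 delta0)); apply: ler_pM => //; first exact: ltW.
  by rewrite invr_ge0 ltW.
have big : 3 * (`|r| * `|P`_j|) <= 4 * `|(('X - r%:P) * P)`_j|.
  rewrite coefP; set u := (if j is _.+1 then _ else _).
  have h : `|r * P`_j| - `|u| <= `|u - r * P`_j| by rewrite distrC; exact: lerB_dist.
  have h3 : 4 * `|u| <= `|r| * `|P`_j|.
    apply: le_trans (_ : _ <= 4 * (e * `|P`_j|)) _.
      by rewrite ler_pM2l ?ltr0n //; apply: shift; rewrite neq_ltn ltnSn.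
    rewrite mulrA; apply: ler_pM => //; first by rewrite mulr_ge0 // ltW.
    exact: le_trans r1.
  rewrite normrM in h; apply: le_trans (_ : _ <= 4 * (`|r| * `|P`_j| - `|u|)) _; last by rewrite ler_pM2l ?ltr0n.
  rewrite mulrBr -subr_ge0; have -> : 4 * (`|r| * `|P`_j|) - 4 * `|u| - 3 * (`|r| * `|P`_j|) = `|r| * `|P`_j| - 4 * `|u| by ring.
  by rewrite subr_ge0.
split.
  by rewrite -normr_gt0 -(pmulr_rgt0 _ (ltr0n algC 4)); apply: lt_le_trans big; rewrite !mulr_gt0 ?ltr0n.
move=> i ij; rewrite coefP; apply: le_trans (ler_normB _ _) _.
apply: le_trans (_ : _ <= e * (`|r| * `|P`_j|) + e * (`|r| * `|P`_j|)) _.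
  apply: lerD.
    apply: le_trans (shift1 i) _; by rewrite mulrA ler_peMl ?(ltW nPj).
  by rewrite normrM mulrCA ler_pM2l // hP.
have -> : e * (`|r| * `|P`_j|) + e * (`|r| * `|P`_j|) = e * (2 * (`|r| * `|P`_j|)) by ring.
rewrite [4 * e]mulrC -[leRHS]mulrA; apply: ler_wpM2l; first exact: ltW.
by apply: le_trans big; rewrite ler_pM2r ?mulr_gt0 // ler_nat.
Qed.
End Dominance.

(* The roots of [y^n + 3 N y^k + 3] for large [N]. *)
Lemma trinomial_roots (n k : nat) : (0 < k)%N -> (k < n)%N -> exists ts : seq algC,
  [/\ size ts = n, count (fun r => `|r| < 1) ts = k, forall s : autC, perm_eq (map s ts) ts,
      \prod_(r <- ts) r = (-1) ^+ n * 3 &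
      {in ts, forall r, [/\ r \in Aint, associate (vring 3) (r ^+ n) 3%:R & `|r| <= 4^-1 \/ 4 <= `|r|]}].
Proof.
move=> k0 kn; have n0 : (0 < n)%N := leq_trans k0 (ltnW kn).
(* [W] gives [4^n / W = 1/4] in the dominance lemma. [N] excludes moduli between [1/W] and [W]:
   there [|3 N r^k|] is at least [3 (W^n + 3)] whereas [|r^n + 3|] is at most [W^n + 3]. *)
pose W := (4 ^ n.+1)%N; pose N := (W ^ n * (W ^ n + 3))%N.
have [L LE] : exists L, L = (3 * N)%N by exists (3 * N)%N.
pose q : {poly int} := 'X^n + L%:Z *: 'X^k + (3%:Z)%:P.
have qE i : q`_i = (i == n)%:R + L%:Z * (i == k)%:R + (if i == 0%N then 3%:Z else 0).
  by rewrite !coefD coefZ !coefXn coefC.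
have sq : size q = n.+1.
  rewrite /q -addrA size_polyDl size_polyXn //.
  apply: leq_ltn_trans (size_polyD _ _) _; rewrite gtn_max; apply/andP; split.
    by apply: leq_ltn_trans (size_scale_leq _ _) _; rewrite size_polyXn.
  by apply: leq_ltn_trans (size_polyC_leq1 _) _.
have lq : lead_coef q = 1.
  by rewrite lead_coefE sq qE /= eqxx (gtn_eqF kn) (gtn_eqF n0) mulr0 !addr0.
have [ts Ets] := closed_field_poly_normal (polyZ q).
have inj : injective (intr : int -> algC) by exact: intr_inj.
rewrite lead_coef_map_inj // lq scale1r in Ets.
have sts : size ts = n.
  by have := congr1 (fun P : {poly algC} => size P) Ets; rewrite size_map_inj_poly // sq size_prod_XsubC => -[].
have EqC : polyZ q = 'X^n + L%:R *: 'X^k + 3%:R%:P.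
  by rewrite [in LHS]rmorphD [in LHS]rmorphD /= map_polyZ /= !map_polyXn map_polyC -!pmulrn.
have tsP r : r \in ts -> r ^+ n = - (3 * (N%:R * r ^+ k + 1)).
  rewrite -root_prod_XsubC -Ets EqC => /rootP.
  rewrite !hornerD hornerZ !hornerXn hornerC => h.
  by apply/eqP; rewrite -subr_eq0 opprK -h LE natrM; apply/eqP; ring.
have W0 : 0 < W%:R :> algC by rewrite ltr0n expn_gt0.
have Wi0 : 0 < W%:R^-1 :> algC by rewrite invr_gt0.
have W1 : 1 <= W%:R :> algC by rewrite ler1n expn_gt0.
have N0 : (0 < N)%N by rewrite muln_gt0 !expn_gt0 /= addnS.
have dich : {in ts, forall r, `|r| <= W%:R^-1 \/ (W%:R^-1)^-1 <= `|r|}.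
  move=> r /tsP rE; rewrite invrK.
  case: (real_leP (normr_real r) (ger0_real (ltW Wi0))) => [|r1]; first by left.
  case: (real_leP (ger0_real (ltW W0)) (normr_real r)) => [|r2]; first by right.
  exfalso; have r0 : 0 <= `|r| by [].
  have h1 : `|3 * N%:R * r ^+ k| <= W%:R ^+ n + 3.
    have -> : 3 * N%:R * r ^+ k = - (r ^+ n + 3) by rewrite rE; ring.
    rewrite normrN; apply: le_trans (ler_normD _ _) _; rewrite [ `|3|]ger0_norm ?ler0n // lerD2r normrX.
    by apply: lerXn2r; rewrite ?nnegrE // ltW.
  have h2 : (W%:R ^+ n)^-1 <= `|r| ^+ k.
    apply: (@le_trans _ _ (W%:R^-1 ^+ k)).
      rewrite exprVn lef_pV2 ?posrE ?exprn_gt0 //; exact: ler_weXn2l (ltnW kn).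
    by apply: lerXn2r; rewrite ?nnegrE ?invr_ge0 // ltW.
  have pos : 0 < W%:R ^+ n + 3 :> algC by rewrite addr_gt0 ?exprn_gt0 // ltr0n.
  have h3 : 3 * (W%:R ^+ n + 3) <= W%:R ^+ n + 3 :> algC.
    apply: le_trans h1; rewrite !normrM normrX !normr_nat /N natrM natrD natrX.
    rewrite -!mulrA ler_pM2l ?ltr0n // mulrCA.
    rewrite -[leLHS]mulr1 ler_pM2l //.
    by rewrite -[leLHS](mulfV (lt0r_neq0 (exprn_gt0 n W0))) ler_pM2l ?exprn_gt0.
  by move: h3; rewrite -{2}[_ + 3]mul1r ler_pM2r // -[3]/(3%:R) -[1]/(1%:R) ler_nat.
have domn : 4 ^+ size ts * W%:R^-1 = 4^-1 :> algC.
  by rewrite sts /W natrX exprSr invfM mulrA mulfV ?mul1r // expf_neq0 // pnatr_eq0.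
(* The coefficients other than that of [X^k] are at most 4 in absolute value, so a dominant index
   [j != k] would give [3 N <= 1]. *)
have cE : count (fun r => `|r| < 1) ts = k.
  have [||Pj hP] := @coef_dominance W%:R^-1 _ ts dich; first by rewrite invr_gt0.
    by rewrite domn invf_le1 ?ler1n ?ltr0n.
  apply/eqP; apply: contraT => jk; have := hP k; rewrite eq_sym => /(_ jk).
  rewrite -Ets domn !coef_map; move: jk; set j := count _ _ => jk.
  have -> : q`_k = L%:Z by rewrite qE eqxx (ltn_eqF kn) (gtn_eqF k0) mulr1 add0r addr0.
  have qj : `|q`_j| <= 4.
    by rewrite qE (negPf jk) mulr0; case: (j == n); case: (j == 0%N).
  move=> /= h; have : L%:R <= 1 :> algC.
    rewrite pmulrn -[leLHS]ger0_norm ?ler0z //; apply: le_trans h _.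
    rewrite -intr_norm -ler_pdivlMl ?invr_gt0 ?ltr0n // invrK mulr1.
    by rewrite -[4]/(4%:Z%:~R) ler_int.
  by rewrite -[1]/(1%:R) ler_nat LE; move: N0; case: (N) => // m; lia.
exists ts; split=> //.
- move=> s; apply: prod_XsubC_eq; rewrite big_map -Ets.
  rewrite -[LHS](map_prod_XsubC s) -Ets -map_poly_comp.
  by apply: eq_map_poly => z /=; rewrite rmorph_int.
- have := congr1 (fun P : {poly algC} => P`_0) Ets; rewrite coef_map qE coef0_prod_XsubC sts.
  by rewrite (ltn_eqF n0) (ltn_eqF k0) mulr0 !add0r /= => E; rewrite -[3]/(3%:Z%:~R) E signrMK.
move=> r rts; have rE := tsP r rts; split.
- apply: (root_monic_Aint (p := polyZ q)); first by rewrite Ets root_prod_XsubC.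
    by rewrite monicE lead_coef_map_inj ?lq ?rmorph1.
  by apply/polyOverP => i; rewrite coef_map intr_int.
- have v3 := vringP (isT : prime 3); have hA : is_subring (vring 3) by case: v3.
  have n3 := char_nonunit v3.
  have r0 : r != 0.
    apply: contraPneq rE => ->; rewrite !expr0n (gtn_eqF n0) (gtn_eqF k0) mulr0 add0r mulr1 => /esym/eqP.
    by rewrite oppr_eq0 pnatr_eq0.
  (* If [r^-1] were integral at 3, dividing the equation by [r^n] would exhibit 1 as a multiple of
     3. *)
  have rnu : nonunit (vring 3) r.
    apply: contrapT => /nonunitN[_ ri]; apply: (nonunit1 v3).
    have -> : 1 = - (3 * (N%:R * r^-1 ^+ (n - k) + r^-1 ^+ n)).
      have -> : r^-1 ^+ (n - k) = r ^+ k / r ^+ n.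
        by rewrite -[in RHS](subnK (ltnW kn)) exprD invfM mulrCA mulfV ?mulr1 ?expf_neq0 // exprVn.
      by rewrite exprVn -[LHS](mulfV (expf_neq0 n r0)) {1}rE; ring.
    apply: (nonunitN1 v3); apply: (nonunitM v3) => //; apply: (subringD hA); last exact: (subringX hA).
    by apply: (subringM hA); [exact: (subring_nat hA) | exact: (subringX hA)].
  have rk : nonunit (vring 3) (N%:R * r ^+ k).
    rewrite -(prednK k0) exprS mulrCA; apply: (nonunitM v3) => //.
    by apply: (subringM hA); [exact: (subring_nat hA) | apply: (subringX hA); exact: (nonunit_mem v3)].
  have v1 : vring 3 1^-1 by rewrite invr1; exact: (subring1 hA).
  have [u0 ui] := unitD_nonunit v3 (oner_neq0 _) v1 rk.
  have uA : vring 3 (1 + N%:R * r ^+ k).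
    by apply: (subringD hA); [exact: (subring1 hA) | exact: (nonunit_mem v3)].
  have t0 : 3%:R != 0 :> algC by rewrite pnatr_eq0.
  rewrite rE addrC; split; rewrite ?oppr_eq0 ?mulf_neq0 //.
    by rewrite mulNr mulrAC divff // mul1r; exact: (subringN hA).
  by rewrite invrN invfM mulrN mulrA divff // mul1r; exact: (subringN hA).
have := dich r rts; rewrite invrK.
have W4 : 4 <= W%:R :> algC by rewrite (ler_nat _ 4) /W -{1}(expn1 4) leq_exp2l.
case=> [h|h]; [left|right].
  by apply: le_trans h _; rewrite lef_pV2 // posrE ?W0 // ltr0n.
exact: le_trans h.
Qed.

(** * A family of numbers with a common height *)

Section Family.
Variables (n k g : nat) (ts : seq algC) (t : nat) (eps : 'I_(g - 1) -> {poly int}).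
Hypotheses (k0 : (0 < k)%N) (kn : (k < n)%N) (g0 : (0 < g)%N) (t1 : t = 1 %[mod 3]).
Hypotheses (sts : size ts = n) (cts : count (fun r => `|r| < 1) ts = k).
Hypothesis pts : forall s : autC, perm_eq (map s ts) ts.
Hypothesis prodts : \prod_(r <- ts) r = (-1) ^+ n * 3.
Hypothesis tsP : {in ts, forall r, [/\ r \in Aint, associate (vring 3) (r ^+ n) 3%:R & `|r| <= 4^-1 \/ 4 <= `|r|]}.

Let ev i (th : algC) := (polyZ (eps i)).[th].

(** The leading and constant coefficients ignore [eps], which fixes the Mahler measure, while the
    size of [th] sends all the roots of the factor to one side of the unit circle. *)
Definition family_factor (th : algC) : {poly algC} :=
  t%:R *: 'X^g + th *: ((t%:R + 1)%:P + \sum_i (polyZ (eps i)).[th] *: 'X^(i.+1)).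
Let c := family_factor.

Hypothesis small : {in ts, forall th, \sum_i `|(polyZ (eps i)).[th]| <= t%:R / 2}.

Let t0 : (0 < t)%N. Proof. by case: t t1. Qed.
Let tR0 : 0 < t%:R :> algC. Proof. by rewrite ltr0n. Qed.
Let n0 : (0 < n)%N. Proof. exact: leq_trans kn. Qed.

Let coefc th i : (c th)`_i = t%:R * (i == g)%:R + th * ((t%:R + 1) *+ (i == 0%N) + \sum_j ev j th * (i == j.+1)%:R).
Proof.
rewrite coefD !coefZ coefXn coefD coefC coef_sum; congr (_ + _ * (_ + _)).
  by case: eqP.
by apply: eq_bigr => j _; rewrite coefZ coefXn.
Qed.

Let coefc_ge th i : (g <= i)%N -> (c th)`_i = (t%:R * (i == g)%:R).
Proof.
move=> gi; rewrite coefc (gtn_eqF (leq_trans g0 gi)) mulr0n add0r big1 ?mulr0 ?addr0 // => j _.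
by rewrite gtn_eqF ?mulr0 // (leq_trans _ gi) //; have := ltn_ord j; lia.
Qed.

Let sizec th : size (c th) = g.+1.
Proof.
apply/eqP; rewrite eqn_leq; apply/andP; split.
  apply/leq_sizeP => i gi; rewrite coefc_ge ?(ltnW gi) // gtn_eqF // mulr0 //.
rewrite ltnNge; apply/negP => /leq_sizeP/(_ g (leqnn g)) /eqP.
by rewrite coefc_ge // eqxx mulr1 gt_eqF.
Qed.

Let leadc th : lead_coef (c th) = t%:R.
Proof. by rewrite lead_coefE sizec coefc_ge // eqxx mulr1. Qed.

Let rho th : seq algC := sval (closed_field_poly_normal (c th)).

Let rhoE th : c th = t%:R *: \prod_(r <- rho th) ('X - r%:P).
Proof. by rewrite -{1}(leadc th) /rho; case: closed_field_poly_normal. Qed.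

Let size_rho th : size (rho th) = g.
Proof.
have := congr1 (fun P : {poly algC} => size P) (rhoE th).
by rewrite sizec size_scale ?gt_eqF // size_prod_XsubC => -[].
Qed.

Let root_rho th r : (r \in rho th) = root (c th) r.
Proof. by rewrite rhoE rootZ ?gt_eqF // root_prod_XsubC. Qed.

Lemma family_root_eq th r : root (c th) r -> t%:R * r ^+ g = - (th * (t%:R + 1 + \sum_i ev i th * r ^+ i.+1)).
Proof.
rewrite /c /family_factor => /rootP; rewrite hornerD !hornerZ hornerXn hornerD hornerC horner_sum => h.
apply/eqP; rewrite -addr_eq0 -[X in _ == X]h; apply/eqP; congr (_ + _ * (_ + _)).
by apply: eq_bigr => i _; rewrite hornerZ hornerXn.
Qed.

(** In [t r^g = - th (...)], a tiny [th] with [|r| >= 1] makes the right side at most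
    [(3/4) t |r|^g], and a huge [th] with [|r| < 1] makes it at least [2 t]. The thresholds 1/4 and
    4 of the trinomial serve here. *)
Lemma family_root_inside th r : th \in ts -> root (c th) r -> (`|r| < 1) = (`|th| < 1).
Proof.
move=> tts /family_root_eq E; have sm := small tts.
have nE : t%:R * `|r| ^+ g = `|th| * `|t%:R + 1 + \sum_i ev i th * r ^+ i.+1|.
  by rewrite -normrM -[RHS]normrN -E normrM normrX gtr0_norm.
have t1' : 1 <= t%:R :> algC by rewrite ler1n.
have [_ _ [h|h]] := tsP tts.
  have -> : `|th| < 1 by apply: le_lt_trans h _; rewrite invf_lt1 ?ltr0n ?ltr1n.
  rewrite real_ltNge ?normr_real ?real1 //; apply/negP => r1.
  have : t%:R * `|r| ^+ g <= 4^-1 * (3 * t%:R * `|r| ^+ g).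
    rewrite nE; apply: ler_pM => //; apply: le_trans (ler_normD _ _) _.
    have -> : 3 * t%:R * `|r| ^+ g = 2 * t%:R * `|r| ^+ g + t%:R * `|r| ^+ g by ring.
    apply: lerD.
      rewrite ger0_norm ?addr_ge0 // -[leLHS]mulr1; apply: ler_pM; rewrite ?addr_ge0 ?exprn_ege1 //.
      by rewrite mulr2n mulrDl mul1r lerD2l.
    apply: le_trans (ler_norm_sum _ _ _) _.
    apply: (@le_trans _ _ (\sum_i `|ev i th| * `|r| ^+ g)).
      apply: ler_sum => i _; rewrite normrM normrX ler_wpM2l // ler_weXn2l //.
      by have := ltn_ord i; lia.
    rewrite -mulr_suml ler_wpM2r ?exprn_ge0 //; apply: le_trans sm _.
    by rewrite ler_pdivrMr ?ltr0n // ler_peMr ?ler1n // ltW.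
  have pos : 0 < t%:R * `|r| ^+ g by rewrite mulr_gt0 // exprn_gt0 // (lt_le_trans ltr01).
  have -> : 4^-1 * (3 * t%:R * `|r| ^+ g) = 3 / 4 * (t%:R * `|r| ^+ g) by ring.
  rewrite -[X in X <= _]mul1r ler_pM2r // ler_pdivlMr ?ltr0n // mul1r.
  by rewrite -[4]/(4%:R) -[3]/(3%:R) ler_nat.
rewrite [RHS]lt_gtF; last by apply: lt_le_trans h; rewrite ltr1n.
apply/negP => r1.
have : 4 * (t%:R / 2) <= t%:R :> algC.
  apply: (@le_trans _ _ (t%:R * `|r| ^+ g)); last first.
    by rewrite ler_piMr ?(ltW tR0) // exprn_ile1 // ltW.
  rewrite nE; apply: ler_pM => //.
  apply: le_trans (lerB_normD _ _); rewrite lerBrDr.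
  apply: (@le_trans _ _ (t%:R / 2 + t%:R / 2)).
    rewrite lerD2l; apply: le_trans (ler_norm_sum _ _ _) _; apply: le_trans sm.
    apply: ler_sum => i _; rewrite normrM normrX ler_piMr // exprn_ile1 // ltW //.
  rewrite -splitr ger0_norm ?addr_ge0 //; by rewrite lerDl.
rewrite [4 * _](_ : _ = t%:R * 2); last by field.
by rewrite -{2}[t%:R]mulr1 ler_pM2l // -[2]/(2%:R) -[1]/(1%:R) ler_nat.
Qed.

Let v3 : valuation_ring 3 (vring 3). Proof. exact: vringP. Qed.
Let hA : is_subring (vring 3). Proof. by case: v3. Qed.

(** At 3 the numbers [t] and [t + 1] are units and the sum over [i] is a nonunit, so [r^g] is [th]
    times a unit. As [th^n] is associate to 3, [r] has valuation [1 / (n g)]. *)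
Lemma family_root_associate th r : th \in ts -> root (c th) r -> associate (vring 3) (r ^+ g) th.
Proof.
move=> tts /family_root_eq E; have [_ th3 _] := tsP tts.
have th0 : th != 0 by case: th3; rewrite expf_eq0 n0.
have n3 := char_nonunit v3.
have thnu : nonunit (vring 3) th.
  apply: contrapT => /nonunitN[_ thi]; case: v3 => _ n3' _; apply: n3'.
  by apply: (associate_mem v3 (associateV th3)); rewrite -exprVn; exact: (subringX hA).
have Ath := nonunit_mem v3 thnu.
have Aev i : vring 3 (ev i th).
  rewrite /ev horner_coef; apply: (subring_sum hA) => j _; rewrite coef_map.
  by apply: (subringM hA); [exact: (subring_int hA) | exact: (subringX hA)].
have At := subring_nat hA t.
have At1 : vring 3 (t%:R + 1) by apply: (subringD hA) => //; exact: (subring1 hA).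
have Ati : vring 3 t%:R^-1.
  by apply: (coprime_unit v3) => //; rewrite /coprime -gcdn_modr t1.
have At1i : vring 3 (t%:R + 1)^-1.
  rewrite natr1; apply: (coprime_unit v3) => //.
  have t2 : (t.+1 %% 3 = 2)%N by move: t1; lia.
  by rewrite /coprime -gcdn_modr t2.
have rnu : nonunit (vring 3) r.
  apply: contrapT => /nonunitN[r0 ri]; apply: (nonunit1 v3).
  have -> : 1 = - (th * ((t%:R + 1) * r^-1 ^+ g + \sum_i ev i th * r^-1 ^+ (g - i.+1)) / t%:R).
    apply: (mulIf (expf_neq0 g r0)); apply: (mulfI (lt0r_neq0 tR0)); rewrite mul1r E.
    have -> : \sum_i ev i th * r ^+ i.+1 = (\sum_i ev i th * r^-1 ^+ (g - i.+1)) * r ^+ g.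
      rewrite mulr_suml; apply: eq_bigr => i _; have ig : (i.+1 <= g)%N by have := ltn_ord i; lia.
      have -> : r ^+ g = r ^+ (g - i.+1) * r ^+ i.+1 by rewrite -exprD subnK.
      by rewrite mulrA; congr (_ * _); rewrite -mulrA -exprMn mulVf // expr1n mulr1.
    by rewrite exprVn; field; rewrite expf_neq0 // gt_eqF.
  apply: (nonunitN1 v3); rewrite -mulrA; apply: (nonunitM v3) => //; apply: (subringM hA) => //.
  apply: (subringD hA); first by apply: (subringM hA) => //; exact: (subringX hA).
  by apply: (subring_sum hA) => i _; apply: (subringM hA) => //; exact: (subringX hA).
have Ar := nonunit_mem v3 rnu.
have snu : nonunit (vring 3) (\sum_i ev i th * r ^+ i.+1).
  apply: (nonunit_sum v3) => i _; rewrite exprS mulrCA; apply: (nonunitM v3) => //.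
  by apply: (subringM hA) => //; exact: (subringX hA).
have t10 : t%:R + 1 != 0 :> algC by rewrite natr1 pnatr_eq0.
have [u0 ui] := unitD_nonunit v3 t10 At1i snu.
have uA : vring 3 (t%:R + 1 + \sum_i ev i th * r ^+ i.+1) by apply: (subringD hA) => //; exact: (nonunit_mem v3).
have rg : r ^+ g = - (th * (t%:R + 1 + \sum_i ev i th * r ^+ i.+1) / t%:R).
  by apply: (mulfI (lt0r_neq0 tR0)); rewrite E; field; rewrite gt_eqF.
move: rg u0 ui uA; set u := t%:R + 1 + _ => -> u0 ui uA.
split=> //; first by rewrite oppr_eq0 !mulf_neq0 // invr_eq0 gt_eqF.
  rewrite (_ : _ / th = - (u / t%:R)); last by field; rewrite th0 gt_eqF.
  by apply: (subringN hA); apply: (subringM hA).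
rewrite (_ : th / _ = - (t%:R / u)); last by field; rewrite th0 u0 gt_eqF.
by apply: (subringN hA); apply: (subringM hA).
Qed.

(** A factor with huge [th] contributes the ratio of its constant to its leading coefficient, one
    with tiny [th] only its leading coefficient. The absence of [eps] gives the whole family one
    height. *)
Definition family_measure : algC :=
  t%:R ^+ n * \prod_(th <- ts) (if `|th| < 1 then 1 else `|th| * (t%:R + 1) / t%:R).

Let polyZ_aut (s : autC) (P : {poly int}) : map_poly s (polyZ P) = polyZ P.
Proof. by rewrite -map_poly_comp; apply: eq_map_poly => z /=; rewrite rmorph_int. Qed.

Let factor_aut (s : autC) th : map_poly s (c th) = c (s th).
Proof.
apply/polyP => i; rewrite coef_map !coefc /= !(rmorphD, rmorphM, rmorphMn, rmorph_nat, rmorph1) rmorph_sum /=.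
congr (_ + _ * (_ + _)); apply: eq_bigr => j _.
by rewrite rmorphM rmorph_nat /ev -(horner_map s) polyZ_aut.
Qed.

Let coef_Aint th i : th \in ts -> (c th)`_i \in Aint.
Proof.
move=> /tsP[Ath _ _]; have Anat m : m%:R \in Aint by exact: rpred_nat.
have Aev j : ev j th \in Aint.
  rewrite /ev horner_coef; apply: rpred_sum => l _; rewrite coef_map /=.
  by rewrite rpredM ?rpredX ?Aint_int.
rewrite coefc rpredD ?rpredM ?Anat // rpredD ?rpredMn ?rpredD ?Anat ?rpred1 //.
by apply: rpred_sum => j _; rewrite rpredM.
Qed.

(** The product over [ts] is fixed by all automorphisms and has algebraic integers as coefficients,
    hence is integral. Valuations at 3 give its roots degree at least [n g], and coprimality of
    [t^n] and [3 (t + 1)^n] makes it primitive. *)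
Lemma family_height_class th0 : th0 \in ts ->
  exists2 x, root (c th0) x & height_class (k * g) (n * g) family_measure x.
Proof.
move=> th0ts; pose rs := flatten (map rho ts).
pose F := \prod_(th <- ts) c th.
have FE : F = t%:R ^+ n *: \prod_(r <- rs) ('X - r%:P).
  rewrite /F (eq_bigr _ (fun th _ => rhoE th)) scaler_prod big_flatten big_map; congr (_ *: _).
  by rewrite big_const_seq count_predT sts iter_mulr_1.
have memrs r : r \in rs -> exists2 th, th \in ts & root (c th) r.
  by move=> /flatten_mapP[th tts]; rewrite root_rho; exists th.
have [x xr] : exists x, x \in rho th0.
  by have := size_rho th0; case: (rho th0) => [/= g00|x l _]; [by move: g0; rewrite -g00 | exists x; rewrite mem_head].
have xrs : x \in rs by apply/flatten_mapP; exists th0.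
exists x; first by rewrite -root_rho.
have fixF (s : autC) : map_poly s F = F.
  rewrite /F rmorph_prod /= -[RHS](perm_big _ (pts s)) /= big_map.
  by apply: eq_bigr => th _; exact: factor_aut.
have intF : F \is a polyOver Num.int.
  apply/polyOverP => i; apply: Cint_rat_Aint.
    by apply: aut_fixed_rat => s; rewrite -{2}(fixF s) coef_map.
  suff /polyOverP : F \is a polyOver Aint by exact.
  rewrite /F big_seq; apply: rpred_prod => th tts; apply/polyOverP => j; exact: coef_Aint.
have [f Ef] := floorpP intF.
have inj : injective (intr : int -> algC) by exact: intr_inj.
have tn0 : 0 < t%:R ^+ n :> algC by rewrite exprn_gt0.
have szrs : size rs = (n * g)%N.
  rewrite size_flatten /shape -map_comp (eq_map size_rho) sumnE big_map big_const_seq count_predT sts.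
  by rewrite iter_addn_0 mulnC.
have szf : size f = (n * g).+1.
  have <- : size F = size f by rewrite Ef size_map_inj_poly.
  by rewrite FE size_scale ?gt_eqF // size_prod_XsubC szrs.
have lf : lead_coef f = (t ^ n)%N.
  apply: (inj); rewrite -(lead_coef_map_inj inj) // -Ef FE lead_coefZ.
  by rewrite (monicP (monic_prod_XsubC _ _ _)) mulr1 -natrX pmulrn.
have lf0 : 0 < lead_coef f by rewrite lf ltz_nat expn_gt0 t0.
have f0 : `|f`_0|%R = (3 * t.+1 ^ n)%N.
  apply: (inj); rewrite intr_norm -(coef_map (intr : int -> algC)) -Ef -horner_coef0 horner_prod normr_prod.
  rewrite (eq_bigr (fun th => `|th| * (t%:R + 1))) => [|th _].
    rewrite big_split /= -normr_prod prodts normrMsign [ `|3|]ger0_norm //.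
    by rewrite big_const_seq count_predT sts iter_mulr_1 natr1 -natrX -natrM pmulrn.
  rewrite horner_coef0 coefc (ltn_eqF g0) mulr0 add0r big1 ?addr0 => [|j _]; last by rewrite mulr0.
  by rewrite normrM [ `|_ + 1|]ger0_norm // addr_ge0.
have d0 : (0 < n * g)%N by rewrite muln_gt0 n0.
exists f, rs; split.
- split=> //.
  + by rewrite -size_poly_gt0 szf.
  + by rewrite -Ef FE rootZ ?gt_eqF // root_prod_XsubC.
  + move=> Q Q0 Qx; rewrite szf.
    apply: (eisenstein_minimal (p := 3) _ d0 _ Q0 Qx) => //.
    rewrite mulnC exprM; have [_ th3 _] := tsP th0ts.
    apply: (associate_trans v3) th3; apply: (associateX v3).
    by apply: family_root_associate th0ts _; rewrite -root_rho.
  + pose z := zcontents f.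
    have z0 : 0 < z by rewrite -sgz_gt0 sgz_contents sgz_gt0.
    have zdvd i : (z %| f`_i)%Z.
      by have := dvdz_contents z f; rewrite dvdzz => /esym/polyOverP/(_ i).
    have cop : coprime (t ^ n) (3 * t.+1 ^ n).
      rewrite coprimeMr; apply/andP; split.
        by rewrite coprimeXl // coprime_sym /coprime -gcdn_modr t1.
      by rewrite coprimeXl // coprimeXr // coprimenS.
    have : (`|z| %| 1)%N.
      rewrite -(eqP cop) dvdn_gcd; apply/andP; split.
        by have := zdvd (size f).-1; rewrite -lead_coefE lf.
      have <- : `|(f`_0)%R|%N = (3 * t.+1 ^ n)%N by move: f0; rewrite -abszE => -[].
      exact: zdvd 0%N.
    by rewrite dvdn1 => /eqP z1; rewrite -/z -(gtz0_abs z0) z1.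
- by rewrite -Ef FE lf -natrX pmulrn.
- exact: szrs.
- rewrite count_flatten -map_comp sumnE big_map.
  transitivity (\sum_(th <- ts) (`|th| < 1)%R * g)%N.
    apply: eq_big_seq => th tts /=; rewrite -(size_rho th).
    rewrite (@eq_in_count _ _ (fun=> (`|th| < 1)%R)); last first.
      by move=> r; rewrite root_rho; exact: family_root_inside.
    by case: (`|th| < 1)%R; rewrite ?count_predT ?mul1n // count_pred0 mul0n.
  by rewrite -big_distrl -cts -sum1_count [in RHS]big_mkcond /=; congr (_ * _)%N; apply: eq_bigr => th _; case: ifP.
rewrite lf -pmulrn natrX /family_measure big_flatten big_map; congr (_ * _).
apply: eq_big_seq => th tts /=.
have inside r : r \in rho th -> (`|r| < 1) = (`|th| < 1).
  by rewrite root_rho; exact: family_root_inside.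
have [thin|thout] := ifPn (`|th| < 1).
  by rewrite big_seq big1 // => r /inside; rewrite thin; exact: max1_in.
transitivity (\prod_(r <- rho th) `|r|); last first.
  by apply: eq_big_seq => r /inside; rewrite (negPf thout) => /negbT/max1_out.
have := congr1 (fun P : {poly algC} => `|P`_0|) (rhoE th).
rewrite coefc (ltn_eqF g0) mulr0 add0r big1 ?addr0 => [|j _]; last by rewrite mulr0.
rewrite coefZ coef0_prod_XsubC !normrM normrX normrN1 expr1n mul1r [ `|t%:R|]gtr0_norm // normr_prod.
rewrite [ `|_ + 1|]ger0_norm ?addr_ge0 // => ->.
by rewrite mulrC mulKf // gt_eqF.
Qed.
End Family.

Lemma height_class_lower (k d : nat) : (0 < k)%N -> (k < d)%N ->
  exists C : nat, forall X : nat, exists (M : algC) (s : seq algC),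
  [/\ X%:R <= M, s != [::], uniq s, forall y, y \in s -> height_class k d M y &
      M ^+ (gcdn k d - 1) <= (C * size s)%N%:R].
Proof.
move=> k0 kd; set g := gcdn k d; pose n := (d %/ g)%N; pose k' := (k %/ g)%N.
have g0 : (0 < g)%N by rewrite gcdn_gt0 k0.
have kE : k = (k' * g)%N by rewrite divnK // dvdn_gcdl.
have dE : d = (n * g)%N by rewrite divnK // dvdn_gcdr.
have k'0 : (0 < k')%N by move: k0; rewrite {1}kE muln_gt0 => /andP[].
have kn : (k' < n)%N by move: kd; rewrite {1}kE dE ltn_pmul2r.
have n0 : (0 < n)%N := leq_trans k'0 (ltnW kn).
have [ts [sts cts pts prodts tsP]] := trinomial_roots k'0 kn.
have [Th Th1 ThP] : exists2 Th : nat, (0 < Th)%N & {in ts, forall th : algC, `|th| <= Th%:R}.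
  exists (\max_(th <- ts) (Num.truncn `|th|).+1).+1 => // th tts.
  have /andP[_ /ltW h] := truncn_itv (normr_ge0 th); apply: le_trans h _.
  rewrite ler_nat; apply: leqW.
  exact: (leq_bigmax_seq (F := fun th : algC => (Num.truncn `|th|).+1)).
(* With the coefficients of [eps] below [B = t %/ K], the sum in [small] is at most
   [(g - 1) n B Th^n <= t / 2]. *)
pose K := (2 * (g * (n * Th ^ n)))%N.
have K0 : (0 < K)%N by rewrite !muln_gt0 g0 n0 expn_gt0 Th1.
(* From [M <= (2 t Th)^n] and [t <= 2 K B], compared with the [B^(n (g - 1))] members of the
   family. *)
exists ((4 * K * Th) ^ (n * (g - 1)))%N => X.
(* Congruent to 1 modulo 3, large enough for [X <= M], and at least [K] so that [B > 0]. *)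
pose t := (3 * (X + K) + 1)%N; pose B := (t %/ K)%N.
have t1 : t = 1 %[mod 3] by rewrite /t mulnC modnMDl.
have Kt : (K <= t)%N by rewrite /t; lia.
have B0 : (0 < B)%N by rewrite divn_gt0.
have tB : (t <= 2 * K * B)%N.
  have := ltn_ceil t K0; rewrite -/B => h; nia.
have BK : (B * K <= t)%N by exact: leq_trunc_div.
have tR0 : 0 < t%:R :> algC by rewrite ltr0n; lia.
pose eps (u : {ffun 'I_(g - 1) * 'I_n -> 'I_B}) (i : 'I_(g - 1)) : {poly int} :=
  \poly_(l < n) (if insub l is Some l' then (u (i, l') : nat)%:Z else 0).
have evE u i th : (polyZ (eps u i)).[th] = \sum_l (u (i, l))%:R * th ^+ l.
  rewrite (horner_coef_wide _ (n := n)); last first.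
    by rewrite size_map_inj_poly ?size_poly //; exact: intr_inj.
  apply: eq_bigr => l _; rewrite coef_map coef_poly ltn_ord insubT ?ltn_ord // => ll /=.
  by rewrite -pmulrn (_ : Sub _ _ = l) //; apply: val_inj.
have small u : {in ts, forall th, \sum_i `|(polyZ (eps u i)).[th]| <= t%:R / 2}.
  move=> th tts; apply: (@le_trans _ _ (\sum_(i < g - 1) (n * (B * Th ^ n))%:R)).
    apply: ler_sum => i _; rewrite evE; apply: le_trans (ler_norm_sum _ _ _) _.
    apply: (@le_trans _ _ (\sum_(l < n) (B * Th ^ n)%:R)).
      apply: ler_sum => l _; rewrite normrM normr_nat normrX natrM natrX; apply: ler_pM; [exact: ler0n | exact: exprn_ge0 | by rewrite ler_nat ltnW |].
      apply: (@le_trans _ _ (Th%:R ^+ l)); first by apply: lerXn2r; rewrite ?nnegrE ?ler0n // ThP.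
      by rewrite ler_weXn2l ?ler1n // ltnW.
    by rewrite sumr_const card_ord -[X in X <= _]mulr_natr -natrM ler_nat mulnC.
  rewrite sumr_const card_ord -[X in X <= _]mulr_natr -natrM ler_pdivlMr ?ltr0n // -natrM ler_nat.
  apply: leq_trans BK; rewrite /K; nia.
have [th0 th0ts] : exists th, th \in ts.
  by case: ts sts {cts pts prodts tsP ThP small} => [/= E|th l _]; [rewrite -E in n0 | exists th; rewrite mem_head].
have /choice[al hal] : forall u, exists x, root (family_factor t (eps u) th0) x /\
    height_class k d (family_measure n ts t) x.
  move=> u; have [x h1 h2] := family_height_class k'0 kn g0 t1 sts cts pts prodts tsP (small u) th0ts.
  by exists x; rewrite {1}kE {1}dE.
have M1 : forall th : algC, 1 <= (if `|th| < 1 then 1 else `|th| * (t%:R + 1) / t%:R).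
  move=> th; case: ifPn => // h; rewrite -mulrA mulr_ege1 //.
    by move: h; rewrite -real_leNgt ?real1 ?normr_real.
  by rewrite ler_pdivlMr // mul1r lerDl.
exists (family_measure n ts t), [seq al u | u in {: {ffun 'I_(g - 1) * 'I_n -> 'I_B}}]; split.
- rewrite /family_measure -[leLHS]mulr1; apply: ler_pM => //.
    by rewrite -natrX ler_nat; apply: (@leq_trans t); [rewrite /t; nia | rewrite -{1}(expn1 t) leq_pexp2l //; lia].
  by apply: (big_ind (fun u : algC => 1 <= u)) => // u v; exact: mulr_ege1.
- by rewrite -size_eq0 size_map -cardE card_ffun card_ord -lt0n expn_gt0 B0.
- rewrite map_inj_uniq ?enum_uniq // => u v uv.
  have [hu _] := hal u; have [hv _] := hal v; rewrite -uv in hv.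
  set x := al u in hu hv.
  have hx := family_root_associate k'0 kn g0 t1 sts cts tsP th0ts hu.
  have [_ th3 _] := tsP th0 th0ts.
  have v3 := vringP (isT : prime 3).
  have th00 : th0 != 0 by case: th3; rewrite expf_eq0 n0.
  (* If two choices share the root [x], their equations differ by a relation between the
     [th0^l x^(i + 1)]. The valuations [(l g + i + 1) / (n g)] are distinct modulo 1, so all the
     differences vanish. *)
  have s0 : \sum_(il : 'I_(g - 1) * 'I_n) ((u il : nat)%:Z - (v il : nat)%:Z)%:~R * (th0 ^+ il.2 * x ^+ il.1.+1) = 0.
    have E1 : \sum_i (polyZ (eps u i)).[th0] * x ^+ i.+1 = \sum_i (polyZ (eps v i)).[th0] * x ^+ i.+1.
      have Eu := family_root_eq hu; have Ev := family_root_eq hv.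
      by move: Ev; rewrite Eu => /oppr_inj/(mulfI th00)/addrI.
    move/eqP: E1; rewrite -subr_eq0 -sumrB => /eqP E1; rewrite -[RHS]E1.
    pose term (i : 'I_(g - 1)) (l : 'I_n) := ((u (i, l) : nat)%:Z - (v (i, l) : nat)%:Z)%:~R * (th0 ^+ l * x ^+ i.+1).
    transitivity (\sum_p term p.1 p.2); first by apply: eq_bigr => -[i l] _.
    rewrite -pair_bigA /=.
    apply: eq_bigr => i _; rewrite -mulrBl !evE -sumrB mulr_suml; apply: eq_bigr => l _.
    by rewrite /term mulrA rmorphB /= -!pmulrn -mulrBl.
  have := valuation_independent v3 isT (d := (n * g)%N) (m := fun il : 'I_(g - 1) * 'I_n => (il.2 * g + il.1.+1)%N) _ _ _ s0.
  move=> h; apply/ffunP => il; apply: val_inj; apply/eqP; rewrite -eqz_nat -subr_eq0; apply/eqP.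
  apply: h => [|{}il|i j].
  + by rewrite muln_gt0 n0.
  + rewrite exprMn exprD; apply: (associateM v3).
      have -> : (th0 ^+ il.2) ^+ (n * g) = ((th0 ^+ n) ^+ g) ^+ il.2
        by rewrite -!exprM; congr (_ ^+ _); ring.
      have -> : 3%:R ^+ (il.2 * g) = (3%:R ^+ g) ^+ il.2 :> algC by rewrite -exprM mulnC.
      by do 2!apply: (associateX v3).
    rewrite exprAC; apply: (associateX v3); rewrite mulnC exprM.
    by apply: (associate_trans v3) th3; apply: (associateX v3).
  + have ilt (w : 'I_(g - 1) * 'I_n) : (w.2 * g + w.1.+1 < n * g)%N.
      have := ltn_ord w.1; have := ltn_ord w.2; nia.
    rewrite !modn_small // => E.
    have lt1 (w : 'I_(g - 1) * 'I_n) : (w.1.+1 < g)%N by have := ltn_ord w.1; lia.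
    have := congr1 (fun a => a %/ g)%N E; rewrite !divnMDl // !divn_small // !addn0 => E2.
    move: E; rewrite E2 => /addnI [E1].
    by apply/eqP; rewrite -pair_eqE /= -!val_eqE /= E1 E2 !eqxx.
- by move=> _ /mapP[u _ ->]; have [] := hal u.
rewrite size_map -cardE card_ffun card_prod !card_ord.
have Mle : family_measure n ts t <= (2 * t * Th)%N%:R ^+ n.
  rewrite /family_measure -mulnA mulnCA natrM exprMn; apply: ler_wpM2l; first by rewrite exprn_ge0.
  have -> : (2 * Th)%N%:R ^+ n = \prod_(th <- ts) (2 * Th)%N%:R :> algC.
    by rewrite big_const_seq count_predT sts iter_mulr_1.
  rewrite [leLHS]big_seq [leRHS]big_seq; apply: ler_prod => th tts; rewrite (le_trans ler01) //=.
  have Th2 : 1 <= (2 * Th)%N%:R :> algC by rewrite ler1n; lia.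
  case: ifP => // _; rewrite -mulrA mulnC natrM; apply: ler_pM => //.
  - exact: ThP.
  - rewrite ler_pdivrMr // mulr2n mulrDl mul1r lerD2l ler1n; lia.
apply: (@le_trans _ _ ((2 * t * Th)%N%:R ^+ n ^+ (g - 1))).
  apply: lerXn2r; rewrite ?nnegrE ?exprn_ge0 ?ler0n //.
  rewrite /family_measure mulr_ge0 ?exprn_ge0 //; apply: prodr_ge0 => th _; exact: le_trans (M1 th).
rewrite -exprM -natrX ler_nat [((g - 1) * n)%N]mulnC -expnMn.
by apply: leq_pow2r; nia.
Qed.


(** * Transfer to the complex numbers *)

Section RealEmbedding.
Local Open Scope classical_set_scope.
Variables (F : archiRealFieldType) (R : realType).

Definition lower_cut (x : F) : set R := [set ratr q | q in [set q : rat | ratr q < x]].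

(* The unique order-preserving map [F -> R]. *)
Definition real_embed (x : F) : R := sup (lower_cut x).

Let between (x y : F) : x < y -> exists q : rat, x < ratr q < y.
Proof. by move=> /rat_in_itvoo[q /itvP h]; exists q; rewrite !h. Qed.

Let rat_above (x : F) : exists q : rat, x < ratr q.
Proof. by have [q /andP[h _]] := between (ltr_pwDr ltr01 (lexx x)); exists q. Qed.

Let rat_below (x : F) : exists q : rat, ratr q < x.
Proof. by have [q /andP[_ h]] := between (ltr_pwDr ltr01 (lexx (x - 1))); exists q; move: h; rewrite subrK. Qed.

Lemma real_embed_ge (x : F) (q : rat) : ratr q < x -> ratr q <= real_embed x.
Proof.
move=> qx; apply: ub_le_sup; last by exists q.
have [u xu] := rat_above x; exists (ratr u) => _ [v vx <-].
by rewrite ler_rat -(ler_rat F) ltW // (lt_trans vx).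
Qed.

Lemma real_embed_le (x : F) (q : rat) : x < ratr q -> real_embed x <= ratr q.
Proof.
move=> xq; apply: ge_sup; first by have [u ux] := rat_below x; exists (ratr u); exists u.
by move=> _ [v vx <-]; rewrite ler_rat -(ler_rat F) ltW // (lt_trans vx).
Qed.

(** Additivity and multiplicativity both reduce to placing a sum or a product of values in the right
    cut. *)
Lemma real_embed_unique (x : F) (r : R) :
  (forall q, ratr q < x -> ratr q <= r) -> (forall q, x < ratr q -> r <= ratr q) -> r = real_embed x.
Proof.
move=> h1 h2; apply/eqP; rewrite eq_le !leNgt; apply/andP; split; apply/negP => /rat_in_itvoo[q /itvP hq].
  have xq : x <= ratr q.
    by rewrite leNgt; apply/negP => /real_embed_ge; rewrite leNgt hq.
  have /rat_in_itvoo[u /itvP hu] : ratr q < r by rewrite hq.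
  have : x < ratr u by apply: le_lt_trans xq _; rewrite ltr_rat -(ltr_rat R) hu.
  by move=> /h2; rewrite leNgt hu.
have xq : ratr q <= x.
  by rewrite leNgt; apply/negP => /real_embed_le; rewrite leNgt hq.
have /rat_in_itvoo[u /itvP hu] : r < ratr q by rewrite hq.
have : ratr u < x by apply: lt_le_trans xq; rewrite ltr_rat -(ltr_rat R) hu.
by move=> /h1; rewrite leNgt hu.
Qed.

Lemma real_embed_rat (q : rat) : real_embed (ratr q) = ratr q.
Proof.
by apply/esym/real_embed_unique => u; rewrite ltr_rat ler_rat => /ltW.
Qed.

Lemma real_embedD (x y : F) : real_embed (x + y) = real_embed x + real_embed y.
Proof.
apply/esym/real_embed_unique => q h.
  have /between[u /andP[h1 h2]] : ratr q - y < x by rewrite ltrBlDr.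
  have /between[v /andP[h3 h4]] : ratr q - ratr u < y by rewrite ltrBlDr addrC -ltrBlDr.
  apply: le_trans (lerD (real_embed_ge h2) (real_embed_ge h4)).
  by rewrite -rmorphD ler_rat -(ler_rat F) rmorphD /= addrC -lerBlDr ltW.
have /between[u /andP[h1 h2]] : x < ratr q - y by rewrite ltrBrDr.
have /between[v /andP[h3 h4]] : y < ratr q - ratr u by rewrite ltrBrDr addrC -ltrBrDr.
apply: le_trans (lerD (real_embed_le h1) (real_embed_le h3)) _.
by rewrite -rmorphD ler_rat -(ler_rat F) rmorphD /= addrC -lerBrDr ltW.
Qed.

Lemma real_embed0 : real_embed 0 = 0.
Proof. by rewrite -[0](rmorph0 (ratr : rat -> F)) real_embed_rat rmorph0. Qed.

Lemma real_embedN (x : F) : real_embed (- x) = - real_embed x.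
Proof. by apply/eqP; rewrite -addr_eq0 -real_embedD addNr real_embed0. Qed.

Lemma real_embed_gt0 (x : F) : 0 < x -> 0 < real_embed x.
Proof.
move=> /between[q /andP[q0 qx]]; apply: lt_le_trans (real_embed_ge qx).
by rewrite -(rmorph0 (ratr : rat -> R)) ltr_rat -(ltr_rat F) rmorph0.
Qed.

Let mul_pos (x y : F) : 0 < x -> 0 < y -> real_embed (x * y) = real_embed x * real_embed y.
Proof.
move=> x0 y0; have ex0 := real_embed_gt0 x0; have ey0 := real_embed_gt0 y0.
have rpos (q : rat) : (0 < ratr q :> F) -> 0 < ratr q :> R.
  by rewrite -(rmorph0 (ratr : rat -> F)) -(rmorph0 (ratr : rat -> R)) !ltr_rat.
apply/esym/real_embed_unique => q h.
  have [q0|q0] := leP (ratr q) (0 : R); first by apply: le_trans q0 _; rewrite mulr_ge0 // ltW.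
  have q0' : 0 < ratr q :> F.
    by move: q0; rewrite -(rmorph0 (ratr : rat -> F)) -(rmorph0 (ratr : rat -> R)) !ltr_rat.
  have /between[u /andP[h1 h2]] : ratr q / y < x by rewrite ltr_pdivrMr.
  have u0 : 0 < ratr u :> F by apply: lt_trans h1; rewrite divr_gt0.
  have /between[v /andP[h3 h4]] : ratr q / ratr u < y by rewrite ltr_pdivrMr // mulrC -ltr_pdivrMr.
  have v0 : 0 < ratr v :> F by apply: lt_trans h3; rewrite divr_gt0.
  apply: (@le_trans _ _ (ratr u * ratr v)); last first.
    by apply: ler_pM; rewrite ?real_embed_ge // ltW // rpos.
  by rewrite -rmorphM ler_rat -(ler_rat F) rmorphM /= mulrC -ler_pdivrMr // ltW.
have /between[u /andP[h1 h2]] : x < ratr q / y by rewrite ltr_pdivlMr.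
have u0 : 0 < ratr u :> F by apply: lt_trans h1.
have /between[v /andP[h3 h4]] : y < ratr q / ratr u by rewrite ltr_pdivlMr // mulrC -ltr_pdivlMr.
apply: (@le_trans _ _ (ratr u * ratr v)).
  by apply: ler_pM; rewrite ?real_embed_le // ltW.
by rewrite -rmorphM ler_rat -(ler_rat F) rmorphM /= mulrC -ler_pdivlMr // ltW.
Qed.

Lemma real_embedM (x y : F) : real_embed (x * y) = real_embed x * real_embed y.
Proof.
wlog x0 : x / 0 < x.
  move=> H; have [x0|x0|<-] := ltgtP 0 x; [exact: H| |by rewrite mul0r real_embed0 mul0r].
  by apply: oppr_inj; rewrite -real_embedN -!mulNr -real_embedN; apply: H; rewrite oppr_gt0.
have [y0|y0|<-] := ltgtP 0 y; [exact: mul_pos| |by rewrite mulr0 real_embed0 mulr0].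
by apply: oppr_inj; rewrite -real_embedN -!mulrN -real_embedN; apply: mul_pos; rewrite ?oppr_gt0.
Qed.

Lemma real_embed_lt (x y : F) : (real_embed x < real_embed y) = (x < y).
Proof.
have mono u v : u < v -> real_embed u < real_embed v.
  by rewrite -subr_gt0 => /real_embed_gt0; rewrite real_embedD real_embedN subr_gt0.
by have [/mono->|/mono h|->] := ltgtP x y; rewrite ?ltxx // lt_gtF.
Qed.

End RealEmbedding.

(** * The embedding of the algebraic numbers in [R[i]] *)

Section ComplexEmbedding.
Variable R : realType.

Let e (x : algR) : R := real_embed R x.

(** Taking the real part first makes the map total; it is meaningful on real numbers, whence the
    reality hypotheses on products and order. *)
Definition algC_to_real (z : algC) : R := e (in_algR (Creal_Re z)).

Let toR := algC_to_real.

Let ReE (x : algC) (hx : x \is Num.real) : in_algR (Creal_Re x) = in_algR hx.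
Proof. by apply: val_inj => /=; rewrite (Creal_ReP _ hx). Qed.

Lemma algC_to_realD x y : toR (x + y) = toR x + toR y.
Proof. by rewrite /toR /algC_to_real /e -real_embedD; congr real_embed; apply: val_inj; rewrite /= raddfD. Qed.

Lemma algC_to_realN x : toR (- x) = - toR x.
Proof. by rewrite /toR /algC_to_real /e -real_embedN; congr real_embed; apply: val_inj; rewrite /= raddfN. Qed.

Lemma algC_to_realM x y : x \is Num.real -> y \is Num.real -> toR (x * y) = toR x * toR y.
Proof.
move=> hx hy; rewrite /toR /algC_to_real /e -real_embedM; congr real_embed; apply: val_inj.
by rewrite /= (Creal_ReP _ hx) (Creal_ReP _ hy) (Creal_ReP _ (rpredM hx hy)).
Qed.

Lemma algC_to_real_nat n : toR n%:R = n%:R.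
Proof.
rewrite /toR /algC_to_real /e.
have -> : in_algR (Creal_Re n%:R) = ratr n%:R :> algR.
  by apply: val_inj; rewrite ratr_nat rmorph_nat /= (Creal_ReP _ (realn _ n)).
by rewrite real_embed_rat ratr_nat.
Qed.

Lemma algC_to_real_lt x y : x \is Num.real -> y \is Num.real -> (toR x < toR y) = (x < y).
Proof.
by move=> hx hy; rewrite /toR /algC_to_real /e real_embed_lt (ReE hx) (ReE hy).
Qed.

Definition algC_to_complex (z : algC) : R[i] := Complex (toR ('Re z)) (toR ('Im z)).

Let toC := algC_to_complex.

Lemma algC_to_complex_zmod : zmod_morphism toC.
Proof.
move=> x y; rewrite /toC /algC_to_complex !raddfB /= !(algC_to_realD, algC_to_realN).
by apply/eqP; rewrite eq_complex /= !eqxx.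
Qed.

Lemma algC_to_complex_monoid : monoid_morphism toC.
Proof.
split.
  rewrite /toC /algC_to_complex (Creal_ReP _ (real1 _)) (Creal_ImP _ (real1 _)).
  by rewrite (algC_to_real_nat 1) (algC_to_real_nat 0).
move=> x y; rewrite /toC /algC_to_complex ReM ImM !(algC_to_realD, algC_to_realN).
rewrite !algC_to_realM ?Creal_Re ?Creal_Im //; apply/eqP; rewrite eq_complex /= eqxx /=.
by apply/eqP; ring.
Qed.

HB.instance Definition _ := GRing.isZmodMorphism.Build algC R[i] algC_to_complex algC_to_complex_zmod.
HB.instance Definition _ := GRing.isMonoidMorphism.Build algC R[i] algC_to_complex algC_to_complex_monoid.

Lemma normc_algC_to_complex z : Normc.normc (toC z) = toR `|z|.
Proof.
have n0 : 0 <= toR `|z|.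
  have t0 : toR 0 = 0 by exact: (algC_to_real_nat 0).
  rewrite -t0 leNgt algC_to_real_lt ?normr_real ?real0 //.
  by rewrite -real_leNgt ?normr_real ?real0.
rewrite /Normc.normc /toC /algC_to_complex -[RHS]ger0_norm // -sqrtr_sqr; congr Num.sqrt.
rewrite !expr2 -!algC_to_realM ?Creal_Re ?Creal_Im ?normr_real //.
by rewrite -algC_to_realD -!expr2 normC2_Re_Im.
Qed.

End ComplexEmbedding.


(** * Heights and cardinalities in [R[i]] *)

Section Transfer.
Variables (R : realType) (k d : nat).
Hypotheses (k0 : (0 < k)%N) (kd : (k < d)%N).

Local Notation toC := (@algC_to_complex R).
Local Notation toR := (@algC_to_real R).

Let d0 : (0 < d)%N. Proof. exact: leq_trans kd. Qed.

Lemma algC_to_real_int (z : int) : toR z%:~R = z%:~R.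
Proof.
case: z => m; first exact: (algC_to_real_nat R m).
by rewrite NegzE !rmorphN /= algC_to_realN; congr (- _); exact: (algC_to_real_nat R m.+1).
Qed.

Lemma algC_to_real_ge0 x : 0 <= x -> 0 <= toR x.
Proof.
move=> x0; have -> : 0 = toR 0 :> R by rewrite (algC_to_real_nat R 0).
by rewrite leNgt algC_to_real_lt ?real0 ?ger0_real // le_gtF.
Qed.

Lemma algC_to_real_inj : {in Num.nneg &, injective toR}.
Proof.
move=> x y; rewrite !nnegrE => x0 y0 E; apply/eqP; rewrite eq_le.
rewrite !real_leNgt ?ger0_real // -!(algC_to_real_lt R) ?ger0_real //.
by rewrite E ltxx.
Qed.

Lemma algC_to_real_prod (s : seq algC) (F : algC -> algC) : (forall x, 0 <= F x) ->
  toR (\prod_(r <- s) F r) = \prod_(r <- s) toR (F r).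
Proof.
move=> F0; elim: s => [|r s IH]; first by rewrite !big_nil (algC_to_real_nat R 1).
by rewrite !big_cons algC_to_realM ?IH ?ger0_real // prodr_ge0.
Qed.

Lemma normc_lt1 r : (Normc.normc (toC r) < 1) = (`|r| < 1).
Proof.
rewrite normc_algC_to_complex -(algC_to_real_nat R 1 : toR 1 = 1).
by rewrite algC_to_real_lt ?normr_real ?real1.
Qed.

Lemma algC_to_real_mahler (a : int) (rs : seq algC) :
  toR (a%:~R * \prod_(r <- rs) Num.max 1 `|r|) =
  a%:~R * \prod_(r <- rs) Num.max 1 (Normc.normc (toC r)).
Proof.
have m0 (r : algC) : 0 <= Num.max 1 `|r| :> algC by exact: (le_trans ler01 (max1_ge1 r)).
rewrite algC_to_realM; last 2 first.
- by rewrite realz.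
- by apply: ger0_real; apply: prodr_ge0.
rewrite algC_to_real_int algC_to_real_prod //; congr (_ * _); apply: eq_bigr => r _.
have [h|h] := boolP (`|r| < 1); last first.
  rewrite max1_out // -normc_algC_to_complex; rewrite -normc_lt1 -leNgt in h.
  by rewrite max_r.
rewrite max1_in // max_l ?(algC_to_real_nat R 1) //.
by rewrite -normc_lt1 in h; exact: ltW.
Qed.

Let polyE (p : {poly int}) : polyZC R p = map_poly toC (polyZ p).
Proof. by rewrite -map_poly_comp; apply: eq_map_poly => z /=; rewrite rmorph_int. Qed.

Let rootE (p : {poly int}) x : root (polyZC R p) (toC x) = root (polyZ p) x.
Proof. by rewrite polyE fmorph_root. Qed.

Lemma minpolyZE (p : {poly int}) x : minpolyZ (toC x) p <-> minimalZ x p.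
Proof.
split=> -[p0 px hp cp lp]; split=> //.
- by rewrite -rootE.
- by move=> q q0 qx; apply: hp; rewrite ?rootE.
- by rewrite rootE.
- by move=> q q0; rewrite rootE; exact: hp.
Qed.

(** An integer polynomial already splits in [algC], so its roots in [R[i]] are the images of its
    roots there. *)
Lemma A_setP H z : @A_set R k d H z <->
  exists M x, [/\ z = toC x, height_class k d M x & H = toR M `^ (d%:R)^-1].
Proof.
split=> [[p [rs [hmin pE srs crs HE]]]|[M [x [-> [p [rs [hmin pE srs crs ME]]] HE]]]]; last first.
  exists p, (map toC rs); split; first exact/minpolyZE.
  - rewrite polyE pE map_polyZ rmorph_int rmorph_prod big_map; congr (_ *: _).
    by apply: eq_bigr => r _; rewrite /= map_polyXsubC.
  - by rewrite size_map.
  - by rewrite count_map -crs; apply: eq_count => r /=; rewrite normc_lt1.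
  - by rewrite HE ME algC_to_real_mahler big_map.
have lp : 0 < lead_coef p by case: hmin.
have lp0 : (lead_coef p)%:~R != 0 :> R[i] by rewrite intr_eq0 gt_eqF.
have [rs' Ers] := closed_field_poly_normal (polyZ p).
rewrite lead_coef_map_inj // in Ers; last exact: intr_inj.
have prs : perm_eq rs (map toC rs').
  apply: prod_XsubC_eq; apply: (scalerI lp0); rewrite -pE polyE Ers map_polyZ rmorph_int rmorph_prod big_map.
  by congr (_ *: _); apply: eq_bigr => r _; rewrite /= map_polyXsubC.
have zrs : z \in rs.
  by rewrite -root_prod_XsubC -(rootZ _ _ lp0) -pE; case: hmin.
have : z \in map toC rs' by rewrite -(perm_mem prs).
case/mapP=> x xrs' zE; rewrite zE in hmin.
exists ((lead_coef p)%:~R * \prod_(r <- rs') Num.max 1 `|r|), x; split=> //.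
  exists p, rs'; split=> //; first exact/minpolyZE.
  - by rewrite -srs (perm_size prs) size_map.
  - by rewrite -crs (seq.permP prs) count_map; apply: eq_count => r /=; rewrite normc_lt1.
by rewrite HE algC_to_real_mahler (perm_big _ prs) /= big_map.
Qed.

Lemma height_class_ge1 M x : height_class k d M x -> 1 <= M.
Proof.
case=> p [rs [[_ _ _ _ lp] _ _ _ ->]]; apply: mulr_ege1; first by rewrite ler1z.
by apply: (big_ind (fun u : algC => 1 <= u)) => // [u v|r _]; [exact: mulr_ege1 | exact: max1_ge1].
Qed.

Lemma algC_to_complex_inj : injective toC.
Proof. exact: (fmorph_inj (toC : {rmorphism algC -> R[i]})). Qed.

Lemma A_set_height M z : 1 <= M -> @A_set R k d (toR M `^ (d%:R)^-1) z <->
  exists2 x, z = toC x & height_class k d M x.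
Proof.
move=> M1; split=> [/A_setP[M' [x [-> hx E]]]|[x -> hx]]; last by apply/A_setP; exists M, x.
exists x => //; suff -> : M = M' by [].
have M'1 := height_class_ge1 hx.
have ge0 (u : algC) : 1 <= u -> 0 <= u by exact: le_trans.
apply: algC_to_real_inj; rewrite ?nnegrE ?ge0 //.
by apply: powR_injective E; rewrite ?nnegrE ?algC_to_real_ge0 ?ge0 // invr_gt0 ltr0n.
Qed.

Local Notation A_M M := (@A_set R k d (toR M `^ (d%:R)^-1)).

Lemma A_set_preimage M (t : seq R[i]) : 1 <= M -> (forall z, z \in t -> A_M M z) ->
  exists2 s, t = map toC s & forall y, y \in s -> height_class k d M y.
Proof.
move=> M1; elim: t => [|z t IH] ht; first by exists [::].
have [|s -> hs] := IH; first by move=> w wt; apply: ht; rewrite inE wt orbT.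
have /(A_set_height _ M1)[x -> hx] := ht z (mem_head _ _).
by exists (x :: s) => // y; rewrite inE => /orP[/eqP->|/hs].
Qed.

(** Needed for [ncard] to be a true count, as [fset_set] of an infinite set is empty; the upper
    bound with [e = 1] gives it. *)
Lemma A_set_finite M : 1 <= M -> finite_set (A_M M).
Proof.
move=> M1; apply: contrapT => /infinite_set_fset inf.
have [C hC] := card_height_class_le k0 kd 1.
pose N := (Num.truncn M).+1.
have MN : M <= N%:R by have /andP[_ /ltW] := truncn_itv (le_trans ler01 M1).
have [B BA] := inf (C * N ^ (1 * (gcdn k d - 1) + 1)).+1.
have [|s sE hs] := A_set_preimage (t := enum_fset B) M1; first by move=> z zB; apply: BA.
have us : uniq s by apply: (@map_uniq _ _ toC); rewrite -sE; exact: fset_uniq.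
have -> : #|` B|%fset = size s by rewrite /= sE size_map.
by rewrite ltnNge -[size s]expn1 (hC M N).
Qed.

Lemma ncard_A_set M : 1 <= M -> exists s, [/\ uniq s, size s = ncard (A_M M) &
  forall y, y \in s <-> height_class k d M y].
Proof.
move=> M1; have fA := A_set_finite M1.
have [|s sE hs] := A_set_preimage (t := enum_fset (fset_set (A_M M))) M1.
  by move=> z zA; have : z \in fset_set (A_M M) by []; rewrite in_fset_set // => /set_mem.
exists s; split.
- by apply: (@map_uniq _ _ toC); rewrite -sE; exact: fset_uniq.
- by rewrite /ncard /= sE size_map.
move=> y; split=> [/hs//|hy]; have : toC y \in fset_set (A_M M).
  by rewrite in_fset_set //; apply/mem_set/(A_set_height _ M1); exists y.
have -> : (toC y \in fset_set (A_M M)) = (toC y \in map toC s) by rewrite -sE.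
by rewrite mem_map //; exact: algC_to_complex_inj.
Qed.

Let g1 := (gcdn k d - 1)%N.

Lemma algC_to_real_le x y : x \is Num.real -> y \is Num.real -> (toR x <= toR y) = (x <= y).
Proof. by move=> hx hy; rewrite leNgt algC_to_real_lt // -real_leNgt. Qed.

Lemma ln_ncard_le (e : nat) : exists K : R, forall M x, height_class k d M x ->
  e%:R * ln (ncard (A_M M))%:R <= K + (e * g1 + 1)%:R * ln (toR M).
Proof.
have [C hC] := card_height_class_le k0 kd e.
exists (ln C%:R + (e * g1 + 1)%:R * ln 2) => M x hx.
have M1 := height_class_ge1 hx; have [s [us <- sP]] := ncard_A_set M1.
have s0 : (0 < size s)%N by move/sP: hx; case: (s).
(* Since [M >= 1], this integer satisfies [M <= N <= 2 M]; the 2 accounts for [ln 2] in the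
   constant. *)
pose N := (Num.truncn M).+1.
have [/= t1 t2] := andP (truncn_itv (le_trans ler01 M1)).
have h := hC M N isT (ltW t2) s us (fun y => (sP y).1).
have C0 : (0 < C)%N.
  by rewrite lt0n; apply: contraTneq h => ->; rewrite mul0n -ltnNge expn_gt0 s0.
have MR1 : 1 <= toR M.
  by rewrite -(algC_to_real_nat R 1 : toR 1 = 1) algC_to_real_le ?real1 ?ger0_real // (le_trans ler01).
have MR0 : 0 < toR M by apply: lt_le_trans MR1.
have NR : N%:R <= 2 * toR M.
  rewrite -(algC_to_real_nat R 2 : toR 2 = 2) -algC_to_realM ?realn ?ger0_real ?(le_trans ler01) //.
  rewrite -(algC_to_real_nat R N) algC_to_real_le ?realn //; last first.
    by rewrite ger0_real // mulr_ge0 // (le_trans ler01).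
  by rewrite /N -natr1 mulr2n mulrDl mul1r lerD.
rewrite mulr_natl -lnXn ?ltr0n //.
have -> : ln C%:R + (e * g1 + 1)%:R * ln 2 + (e * g1 + 1)%:R * ln (toR M) =
    ln (C%:R * (2 * toR M) ^+ (e * g1 + 1)).
  rewrite lnM ?posrE ?ltr0n ?exprn_gt0 ?mulr_gt0 // lnXn ?mulr_gt0 // lnM ?posrE //.
  by rewrite -[(ln 2 + _) *+ _]mulr_natl mulrDr addrA.
rewrite ler_ln ?posrE ?exprn_gt0 ?ltr0n // ?mulr_gt0 ?ltr0n ?exprn_gt0 ?mulr_gt0 //.
apply: (@le_trans _ _ (C * N ^ (e * g1 + 1))%N%:R); first by rewrite -natrX ler_nat.
rewrite natrM natrX ler_pM2l ?ltr0n //; apply: lerXn2r; rewrite ?nnegrE //.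
by rewrite mulr_ge0 // ltW.
Qed.

Lemma ln_ncard_ge : exists K : R, forall X : nat, exists M x, [/\ height_class k d M x, X%:R <= toR M &
  g1%:R * ln (toR M) - K <= ln (ncard (A_M M))%:R].
Proof.
have [C hC] := height_class_lower k0 kd.
exists (ln C%:R) => X; have [M [s0 [XM sn us hs Mle]]] := hC X.
have [x xs] : exists x, x \in s0 by case: s0 sn {us hs Mle} => // x l _; exists x; rewrite mem_head.
exists M, x; have hx := hs x xs; have M1 := height_class_ge1 hx.
have M0 : 0 <= M := le_trans ler01 M1.
split=> //.
  by rewrite -(algC_to_real_nat R X) algC_to_real_le ?realn ?ger0_real.
have [s [us' <- sP]] := ncard_A_set M1.
have ss : (size s0 <= size s)%N by apply: uniq_leq_size => // y /hs/sP.
have s00 : (0 < size s0)%N by case: (s0) sn.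
have MR1 : 1 <= toR M.
  by rewrite -(algC_to_real_nat R 1 : toR 1 = 1) algC_to_real_le ?real1 ?ger0_real.
have MR0 : 0 < toR M by apply: lt_le_trans MR1.
have toRX m : toR (M ^+ m) = toR M ^+ m.
  elim: m => [|m IH]; first by rewrite !expr0 (algC_to_real_nat R 1).
  by rewrite !exprS algC_to_realM ?IH ?ger0_real // exprn_ge0.
have hle : toR M ^+ g1 <= (C * size s0)%N%:R.
  by rewrite -toRX -algC_to_real_nat algC_to_real_le ?realn ?ger0_real ?exprn_ge0.
have C0 : (0 < C)%N.
  rewrite lt0n; apply: contraTneq hle => ->; rewrite mul0n -ltNge; exact: exprn_gt0.
rewrite lerBlDr mulr_natl -lnXn //.
rewrite -lnM ?posrE ?ltr0n //; last exact: leq_trans ss.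
rewrite ler_ln ?posrE ?exprn_gt0 //; last by rewrite mulr_gt0 ?ltr0n // (leq_trans s00).
by apply: le_trans hle _; rewrite -natrM ler_nat mulnC leq_mul2r ss orbT.
Qed.

End Transfer.

(** * The limit superior *)

Theorem theorem7p3 (R : realType) (k d : nat) :
  (0 < k)%N -> (k < d)%N ->
  limsup_along (@B_set R k d)
    (fun H => ln (ncard (@A_set R k d H))%:R / ln H)
  = ((d * (gcdn k d - 1))%N%:R)%:E.
Proof.
move=> k0 kd; set g1 := (gcdn k d - 1)%N; set c : R := (d * g1)%N%:R.
have d0 : (0 < d)%N := leq_trans k0 (ltnW kd).
have dR : 0 < d%:R :> R by rewrite ltr0n.
have BP H : @B_set R k d H -> exists M x, height_class k d M x /\ H = algC_to_real R M `^ (d%:R)^-1.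
  by case=> z /A_setP[M [x [_ hx ->]]]; exists M, x.
have lnH M x : height_class k d M x -> ln (algC_to_real R M) = d%:R * ln (algC_to_real R M `^ (d%:R)^-1).
  by move=> _; rewrite ln_powR mulVKf // gt_eqF.
have ln_large (K eps T : R) : 0 < eps -> expR (`|K| / eps) <= T -> 1 <= T -> forall h, T < h -> K / ln h <= eps.
  move=> eps0 hT T1 h Th; have h0 : 1 < h := le_lt_trans T1 Th.
  have lh : 0 < ln h by exact: ln_gt0.
  rewrite ler_pdivrMr //; apply: le_trans (ler_norm K) _.
  rewrite mulrC -ler_pdivrMr // -[leLHS]expRK ler_ln ?posrE ?expR_gt0 ?(lt_trans ltr01) //.
  exact: le_trans hT (ltW Th).
apply/eqP; rewrite eq_le; apply/andP; split.
  apply/lee_addgt0Pr => eps eps0.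
  (* After division by [e ln H], the surplus 1 in the exponent [e g1 + 1] costs [d / e]; this [e]
     keeps it below [eps / 2]. *)
  pose e := (Num.truncn (2 * d%:R / eps)).+1.
  have e0 : 0 < e%:R :> R by rewrite ltr0n.
  have he : d%:R / e%:R <= eps / 2.
    rewrite ler_pdivrMr // mulrC -ler_pdivrMr ?divr_gt0 //.
    have q0 : 0 <= 2 * d%:R / eps by rewrite divr_ge0 ?mulr_ge0 // ltW.
    have /andP[_ /ltW] := truncn_itv q0.
    by apply: le_trans; rewrite invf_div mulrA [d%:R * 2]mulrC.
  have [K hK] := ln_ncard_le R k0 kd e.
  (* Beyond [T] the constant [K] contributes at most the other [eps / 2]. *)
  pose T := Num.max 1 (expR (`|K / e%:R| / (eps / 2))).
  pose S : set \bar R := [set (ln (ncard (@A_set R k d h))%:R / ln h)%:E | h in @B_set R k d `&` [set h | T < h]]%classic.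
  apply: (@le_trans _ _ (ereal_sup S)).
    by apply: ereal_inf_lbound; exists T.
  apply: ge_ereal_sup => _ [H [/BP[M [x [hx HE]]] /= TH] <-].
  rewrite -EFinD lee_fin.
  have T1 : 1 <= T by rewrite /T le_max lexx.
  have lh : 0 < ln H by apply: ln_gt0; exact: le_lt_trans TH.
  have := hK M x hx; rewrite -HE (lnH M x hx) -HE => h.
  have h2 : ln (ncard (@A_set R k d H))%:R / ln H <= K / e%:R / ln H + (c + d%:R / e%:R).
    rewrite ler_pdivrMr // mulrDl mulfVK ?gt_eqF //.
    rewrite -(ler_pM2l e0); apply: le_trans h _.
    rewrite le_eqVlt; apply/orP; left; apply/eqP.
    by rewrite /c natrD !natrM; field; rewrite gt_eqF.
  apply: le_trans h2 _; rewrite addrC -addrA lerD2l.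
  have K2 := ln_large (K / e%:R) (eps / 2) T _ _ T1 H TH.
  rewrite [leRHS](splitr eps); apply: lerD => //; apply: K2; first by rewrite divr_gt0.
  by rewrite /T le_max lexx orbT.
apply: le_ereal_inf_tmp => _ [T _ <-].
apply/lee_subgt0Pr => eps eps0.
have [K hK] := ln_ncard_ge R k0 kd.
(* Beyond [T'] the constant [K] costs at most [eps] and [ln H] is positive; a Mahler measure above
   [T'^d] yields a height above [T']. *)
pose T' := Num.max (Num.max 1 T) (expR (`|K| / eps)).
have T'1 : 1 <= T' by rewrite /T' !le_max lexx.
have TT' : T <= T' by rewrite /T' !le_max lexx orbT.
have T'0 : 0 <= T' := le_trans ler01 T'1.
have [M [x [hx XM hM]]] := hK (Num.truncn (T' ^+ d)).+1.
pose H := algC_to_real R M `^ (d%:R)^-1.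
have T'H : T' < H.
  have /andP[_ t2] := truncn_itv (exprn_ge0 d T'0).
  have MT : T' ^+ d < algC_to_real R M by apply: lt_le_trans t2 XM.
  have -> : T' = (T' ^+ d) `^ (d%:R)^-1.
    by rewrite -powR_mulrn // -powRrM mulfV ?gt_eqF // powRr1.
  by apply: gt0_ltr_powR => //; rewrite ?invr_gt0 ?nnegrE ?exprn_ge0 // (le_trans _ (ltW MT)) // exprn_ge0.
have lh : 0 < ln H by apply: ln_gt0; exact: le_lt_trans T'H.
have M1 := height_class_ge1 hx.
apply: (@le_trans _ _ (ln (ncard (@A_set R k d H))%:R / ln H)%:E); last first.
  apply: ereal_sup_ubound; exists H => //; split; last exact: le_lt_trans TT' T'H.
  by exists (algC_to_complex R x); apply/A_setP; exists M, x.
rewrite -EFinB lee_fin; rewrite (lnH M x hx) -/H in hM.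
have K2 := ln_large K eps T' eps0 _ T'1 H T'H.
apply: (@le_trans _ _ (c - K / ln H)).
  by rewrite lerD2l lerN2; apply: K2; rewrite /T' le_max lexx orbT.
rewrite ler_pdivlMr // mulrBl mulfVK ?gt_eqF //; apply: le_trans hM.
by rewrite /c natrM mulrA [g1%:R * _]mulrC.
Qed.
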